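(* Let $N\in\mathbb{N}$ and let $M=(m_{k,l})_{k,l=0}^{N-1}$ be a measure on $\mathfrak{B}(\mathbb{R})$ with values in the nonnegative Hermitian $N\times N$ complex matrices, such that the integrals $\int_{\mathbb{R}}x^n\,dm_{k,l}$ exist for all $n\in\mathbb{Z}_+$, $0\le k,l\le N-1$. Let $L^2_0(M)$ be the closure in $L^2(M)$ of the set of all vector-valued polynomials $p=(p_0,\dots,p_{N-1})\in\mathbb{P}^N$. Consider the matrix Hamburger moment problem with moments $S_n:=\int_{\mathbb{R}}x^n\,dM$, $n\in\mathbb{Z}_+$. Consider a Hilbert space $H$ and a sequence $\{x_n\}_{n=0}^\infty$ in $H$ such that $\mathop{\rm span}\{x_n\}_{n\in\mathbb{Z}_+}=H$ and $$(x_n,x_m)_H=\Gamma_{n,m},\qquad n,m\in\mathbb{Z}_+,$$ where $(\Gamma_{n,m})_{n,m=0}^\infty$ are the scalar entries of the block matrix $\Gamma=(S_{k+l})_{k,l=0}^\infty$. Let $A$ be the linear operator with $D(A)=\mathop{\rm Lin}\{x_n\}_{n\in\mathbb{Z}_+}$ defined by the equalities $Ax_k=x_{k+N}$, $k\in\mathbb{Z}_+$. The following conditions are equivalent: (i) $L^2_0(M)=L^2(M)$; (ii) $M$ is a canonical solution of the corresponding matrix Hamburger moment problem; (iii) $M(x)=(m_{k,j}(x))_{k,j=0}^{N-1}$ satisfies the relation $$\int_{\mathbb{R}}\frac{1}{x-\lambda}\,dm_{k,j}(x)=\left((A_U-\lambda E_H)^{-1}x_k,x_j\right)_H,\qquad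 \lambda\in\mathbb{C}_+,\ 0\le k,j\le N-1,$$ where $A_U$ is a quasiself-adjoint extension of $\overline{A}$ defined by a unitary operator $U$ from $N_i(\overline{A})$ onto $N_{-i}(\overline{A})$ (the latter being equivalent to the fact that $A_U$ is a self-adjoint extension of $A$ inside $H$); (iv) for every $\lambda\in\mathbb{C}_+$ there exists a linear bounded operator $D_\lambda$ in $H$ such that $$(D_\lambda x_{Nk+r},x_{Nl+s})_H=\int_{\mathbb{R}}\frac{x^{k+l}}{x-\lambda}\,dm_{r,s},\qquad 0\le r,s\le N-1;\ k,l\in\mathbb{Z}_+,$$ which is invertible and $$D_\lambda^{-1}+\lambda E_H\equiv A_U,$$ where $A_U$ is a self-adjoint extension of $A$ inside $H$ (the same for all $\lambda\in\mathbb{C}_+$).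
   Context: All Hilbert spaces are complex and separable. $\mathbb{Z}_+$ denotes the non-negative integers; $\mathbb{C}_+=\{z\in\mathbb{C}:\operatorname{Im}z>0\}$; $\mathfrak{B}(\mathbb{R})$ is the family of Borel sets; $\mathop{\rm Lin}$ is the set of (finite) linear combinations, $\mathop{\rm span}$ its closure; $E_H$ is the identity operator of $H$; $\overline{A}$ is the closure of $A$; $D(A)$ its domain. $A^{-1}$ is the inverse of an injective operator $A$, defined on its range; ''invertible'' means that the inverse exists in this sense. $\mathbb{P}^N$ is the set of vector-valued polynomials $p(x)=(p_0(x),\dots,p_{N-1}(x))$ with complex polynomial components. Space $L^2(M)$: put $\tau_M=\sum_{k=0}^{N-1}m_{k,k}$ and $M'_\tau=(dm_{k,l}/d\tau_M)_{k,l=0}^{N-1}$. $L^2(M)$ is the Hilbert space of equivalence classes of (measurable) row-vector-valued functions $f=(f_0,\dots,f_{N-1}):\mathbb{R}\to\mathbb{C}^{1\times N}$ with $\int_{\mathbb{R}}fM'_\tau f^*\,d\tau_M<\infty$ (identified when the norm of the difference is $0$), with scalar product $(f,g)_{L^2(M)}=\int_{\mathbb{R}}fM'_\tau g^*\,d\tau_M$. The same notation is used for a matrix measure $M(\delta)$ on $\mathfrak{B}(\mathbb{R})$ and its left-continuous distribution function $M(x)=M((-\infty,x))$, $x\in\mathbb{R}$. Matrix Hamburger moment problem: given Hermitian $N\times N$ complex matrices $\{S_n\}_{n=0}^\infty$, find a left-continuous non-decreasing matrix function $M(x)=(m_{k,l}(x))_{k,l=0}^{N-1}$ on $\mathbb{R}$,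 $M(-\infty)=0$, with $\int_{\mathbb{R}}x^n\,dM(x)=S_n$, $n\in\mathbb{Z}_+$; such an $M$ is a solution. Scalar entries of $\Gamma$: $\Gamma_{Nk+r,Nl+s}$ is the $(r,s)$ entry of $S_{k+l}$, for $k,l\in\mathbb{Z}_+$, $0\le r,s\le N-1$. A pair $H,\{x_n\}$ as in the statement exists, and $A$ is a correctly defined, densely defined symmetric operator in $H$. Defect subspaces: for a symmetric operator $T$ in $H$ and $\lambda\in\mathbb{C}\setminus\mathbb{R}$, $N_\lambda(T)=H\ominus(T-\lambda E_H)D(T)$. Quasiself-adjoint extension: for a contraction $C$ from $N_i(\overline{A})$ into $N_{-i}(\overline{A})$, the quasiself-adjoint extension $A_C$ of $\overline{A}$ defined by $C$ has domain $D(A_C)=D(\overline{A})\dotplus(C-E_H)N_i(\overline{A})$ and acts by $A_C(f+C\psi-\psi)=\overline{A}f+iC\psi+i\psi$, $f\in D(\overline{A})$, $\psi\in N_i(\overline{A})$. When $C=U$ is unitary from $N_i(\overline{A})$ onto $N_{-i}(\overline{A})$, $A_U$ is self-adjoint, and every self-adjoint extension of $A$ inside $H$ is of this form. ''Inside $H$'' means the extension acts in the same space $H$. Canonical solution: a solution $\mathbf{M}(t)=(\mathbf{m}_{k,j}(t))_{k,j=0}^{N-1}$ of the matrix Hamburger moment problem with moments $\{S_n\}$ is called canonical if there is a self-adjoint operator $\widehat{A}\supseteq\overline{A}$ in $H$, with left-continuous orthogonal resolution of unity $\widehat{E}_t$, such that $\mathbf{m}_{k,j}(t)=(\widehat{E}_tx_k,x_j)_H$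 for $t\in\mathbb{R}$, $0\le k,j\le N-1$. *)

(* Defs.v *)
From HB Require Import structures.
From mathcomp Require Import all_boot all_order all_algebra.
From mathcomp Require Import complex.
From mathcomp Require Import all_classical all_reals all_analysis.
Import Order.TTheory GRing.Theory Num.Theory.
Import numFieldNormedType.Exports.

Set Implicit Arguments.
Unset Strict Implicit.
Unset Printing Implicit Defensive.

Local Open Scope classical_set_scope.
Local Open Scope ring_scope.

Section charge_integral.
Context (R : realType) (nu : {charge set R -> \bar R}).

Let hahn := cid (svalP (cid (Hahn_decomposition nu))).

(* The Jordan parts do not depend on the chosen Hahn decomposition, by
   [Hahn_decomposition_uniq]. *)
Definition charge_pos : {finite_measure set R -> \bar R} :=
  jordan_pos (svalP hahn).
Definition charge_neg : {finite_measure set R -> \bar R} :=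
  jordan_neg (svalP hahn).

Definition charge_integrable (f : R -> R) : Prop :=
  charge_pos.-integrable setT (EFin \o f) /\
  charge_neg.-integrable setT (EFin \o f).

Definition charge_integral (f : R -> R) : R :=
  \int[charge_pos]_t f t - \int[charge_neg]_t f t.

End charge_integral.

Record complex_measure (R : realType) := ComplexMeasure {
  re_part : {charge set R -> \bar R} ;
  im_part : {charge set R -> \bar R} }.

Section complex_measure.
Context (R : realType).
Implicit Types (nu : complex_measure R) (f : R -> R[i]).

Definition cmeas nu (B : set R) : R[i] :=
  Complex (fine (re_part nu B)) (fine (im_part nu B)).

Definition cintegrable nu f : Prop :=
  [/\ charge_integrable (re_part nu) (fun t => complex.Re (f t)),
      charge_integrable (re_part nu) (fun t => complex.Im (f t)),
      charge_integrable (im_part nu) (fun t => complex.Re (f t)) &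
      charge_integrable (im_part nu) (fun t => complex.Im (f t))].

Definition cintegral nu f : R[i] :=
  Complex
    (charge_integral (re_part nu) (fun t => complex.Re (f t)) -
     charge_integral (im_part nu) (fun t => complex.Im (f t)))
    (charge_integral (im_part nu) (fun t => complex.Re (f t)) +
     charge_integral (re_part nu) (fun t => complex.Im (f t))).

Definition cdistr nu (t : R) : R[i] := cmeas nu [set` `]-oo, t[ ].

End complex_measure.

Definition nonneg_hermitian (R : realType) (N : nat) (X : 'M[R[i]]_N) : Prop :=
  X \is hermsymmx /\
  forall v : 'rV[R[i]]_N, 0 <= (v *m X *m (map_mx Num.conj v)^T) 0 0.

Record matrix_measure (R : realType) (N : nat) := MatrixMeasure {
  mm_entry :> 'I_N -> 'I_N -> complex_measure R ;
  mm_nonneg : forall B : set R, measurable B ->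
    nonneg_hermitian (\matrix_(k, l) cmeas (mm_entry k l) B) }.

Section matrix_measure.
Context (R : realType) (N : nat) (M : matrix_measure R N).

Definition moment (n : nat) : 'M[R[i]]_N :=
  \matrix_(k, l) cintegral (M k l) (fun t => (t%:C)%C ^+ n).

(* The trace measure sum_k m_kk. The library asks a measure to be nonnegative
   on all sets, while a charge is arbitrary on nonmeasurable ones, hence the
   value 0 there. *)
Definition tau (B : set R) : \bar R :=
  if `[< measurable B >] then (\sum_(k < N) re_part (M k k) B)%E else 0%E.

Lemma re_part_diag_ge0 (k : 'I_N) (B : set R) :
  measurable B -> (0 <= re_part (M k k) B)%E.
Proof.
move=> mB; have [_ /(_ (delta_mx 0 k))] := mm_nonneg M mB.
rewrite -rowE mxE (bigD1 k)//= big1 ?addr0; last first.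
  by move=> j jk; rewrite !mxE eqxx (negbTE jk)/= conjC0 mulr0.
rewrite !mxE !eqxx/= conjC1 mulr1 lecE/= => /andP[_].
by rewrite -lee_fin fineK// fin_num_measure.
Qed.

Lemma tau_ge0 (B : set R) : (0 <= tau B)%E.
Proof.
by rewrite /tau; case: asboolP => // mB; apply: sume_ge0 => k _;
  exact: re_part_diag_ge0.
Qed.

Lemma tau0 : tau set0 = 0%E.
Proof. by rewrite /tau; case: asboolP => // _; rewrite big1// => k _; rewrite charge0. Qed.

Lemma tau_semi_sigma_additive : semi_sigma_additive tau.
Proof.
move=> F mF tF mUF; rewrite {2}/tau asboolT//.
rewrite [X in X @ _ --> _](_ : _ = (fun n => \sum_(k < N)
    \sum_(0 <= i < n) re_part (M k k) (F i)))%E; last first.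
  apply/funext => n; rewrite exchange_big/=.
  by apply: eq_bigr => i _; rewrite /tau asboolT.
apply: cvg_nnesum.
- by move=> k _; apply: nearW => n; apply: sume_ge0 => i _; exact: re_part_diag_ge0.
- by move=> k _; exact: charge_semi_sigma_additive.
Qed.

HB.instance Definition _ := isMeasure.Build _ _ _ tau
  tau0 tau_ge0 tau_semi_sigma_additive.

Lemma tau_finite : fin_num_fun tau.
Proof.
move=> B mB; rewrite /tau asboolT//.
by apply/sum_fin_numP => k _ _; exact: fin_num_measure.
Qed.

HB.instance Definition _ := Measure_isFinite.Build _ _ _ tau tau_finite.

Definition density (t : R) : 'M[R[i]]_N :=
  \matrix_(k, l) Complex (fine (Radon_Nikodym (re_part (M k l)) tau t))
                         (fine (Radon_Nikodym (im_part (M k l)) tau t)).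

Definition L2_sqnorm (f : R -> 'rV[R[i]]_N) : \bar R :=
  (\int[tau]_t
    (complex.Re ((f t *m density t *m (map_mx Num.conj (f t))^T) 0 0))%:E)%E.

(* Functions rather than their classes: the subspaces considered below are
   stable under modification on a set of functions of norm 0. *)
Definition L2 : set (R -> 'rV[R[i]]_N) := [set f : R -> 'rV[R[i]]_N |
  (forall k, measurable_fun setT (fun t : R => complex.Re (f t 0 k)) /\
             measurable_fun setT (fun t : R => complex.Im (f t 0 k))) /\
  (L2_sqnorm f < +oo)%E].

Definition vpoly_fun (p : 'rV[{poly R[i]}]_N) (t : R) : 'rV[R[i]]_N :=
  map_mx (fun q : {poly R[i]} => q.[(t%:C)%C]) p.

Definition L20 : set (R -> 'rV[R[i]]_N) := [set f : R -> 'rV[R[i]]_N | L2 f /\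
  forall e : R, 0 < e -> exists p : 'rV[{poly R[i]}]_N,
    (L2_sqnorm (f \- vpoly_fun p)%R < (e ^+ 2)%:E)%E].

End matrix_measure.

Definition Lin (R : realType) (V : lmodType R[i]) (x : nat -> V) : set V :=
  [set u | exists (n : nat) (c : nat -> R[i]), u = \sum_(k < n) c k *: x k].

Section operators.
Context (R : realType) (H : completeNormedModType R[i]).
Context (dot : {dot H for (@Num.conj R[i])}).
(* An operator is its graph, so that closure is topological closure, extension is
   inclusion, and the adjoint is single-valued when the domain is dense. *)
Implicit Types T U : set (H * H).

Definition dom T : set H := [set p.1 | p in T].
Definition ran T : set H := [set p.2 | p in T].

Definition single_valued T : Prop :=
  forall u v w, T (u, v) -> T (u, w) -> v = w.

Definition linear_operator T : Prop :=
  [/\ T (0, 0),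
      forall (a : R[i]) u v u' v', T (u, v) -> T (u', v') ->
        T (a *: u + u', a *: v + v') &
      single_valued T].

Definition fun_graph (f : H -> H) : set (H * H) := [set p | p.2 = f p.1].

Definition op_inv T : set (H * H) := [set p | T (p.2, p.1)].

(* T + z E *)
Definition op_shift T (z : R[i]) : set (H * H) :=
  [set (p.1, p.2 + z *: p.1) | p in T].

Definition adjoint T : set (H * H) :=
  [set p | forall q, T q -> dot q.2 p.1 = dot q.1 p.2].

Definition self_adjoint T : Prop :=
  [/\ linear_operator T, closure (dom T) = setT & adjoint T = T].

Definition defect T (z : R[i]) : set H :=
  [set u | forall v, ran (op_shift T (- z)) v -> dot u v = 0].

Definition unitary_onto U (P Q : set H) : Prop :=
  [/\ linear_operator U, dom U = P, ran U = Q &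
      forall p q, U p -> U q -> dot p.2 q.2 = dot p.1 q.1].

(* The graph of f + U psi - psi |-> T f + i U psi + i psi. *)
Definition qsa_extension T U : set (H * H) :=
  [set (p.1 + q.2 - q.1, p.2 + 'i%C *: q.2 + 'i%C *: q.1) | p in T & q in U].

Definition orthogonal_projector (P : {linear H -> H}) : Prop :=
  (forall u, P (P u) = P u) /\ (forall u v, dot (P u) v = dot u (P v)).

Definition resolution_of_unity (E : R -> {linear H -> H}) : Prop :=
  [/\ forall t, orthogonal_projector (E t),
      forall s t u, s <= t -> E s (E t u) = E s u,
      forall t u, E s u @[s --> t^'-] --> E t u,
      forall u, E s u @[s --> -oo%R] --> (0 : H) &
      forall u, E s u @[s --> +oo%R] --> u].

(* T is the integral of t dE_t: its domain consists of the u such that t^2 is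
   integrable for d(E_t u, u), and (T u, w) is the integral of t d(E_t u, w).
   The complex measures are determined by their distribution functions. *)
Definition spectral_resolution T (E : R -> {linear H -> H}) : Prop :=
  resolution_of_unity E /\
  T = [set p |
    (exists2 nu : complex_measure R,
       (forall t, cdistr nu t = dot (E t p.1) p.1) &
       cintegrable nu (fun t => (t%:C)%C ^+ 2)) /\
    (forall w, exists nu : complex_measure R,
       [/\ forall t, cdistr nu t = dot (E t p.1) w,
           cintegrable nu (fun t => (t%:C)%C) &
           cintegral nu (fun t => (t%:C)%C) = dot p.2 w])].

(* The graph is spanned by the pairs (x_k, x_(k+N)), so that the domain is the
   span of the x_k. *)
Definition shift_operator (N : nat) (x : nat -> H) : set (H * H) :=
  Lin (fun k => (x k, x (k + N)%N)).

(* Left-continuous nondecreasing matrix functions vanishing at -oo with finite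
   moments are the distribution functions of the matrix measures. *)
Definition hamburger_solution (N : nat) (S : nat -> 'M[R[i]]_N)
    (M : matrix_measure R N) : Prop :=
  forall n k l, cintegrable (M k l) (fun t => (t%:C)%C ^+ n) /\
    cintegral (M k l) (fun t => (t%:C)%C ^+ n) = S n k l.

Definition canonical_solution (N : nat) (S : nat -> 'M[R[i]]_N)
    (x : nat -> H) (M : matrix_measure R N) : Prop :=
  hamburger_solution S M /\
  exists (T : set (H * H)) (E : R -> {linear H -> H}),
    [/\ self_adjoint T, closure (shift_operator N x) `<=` T,
        spectral_resolution T E &
        forall t (k j : 'I_N), cdistr (M k j) t = dot (E t (x k)) (x j)].

End operators.

(* Main.v *)
(** Write [p] for the vector of H in which the monomial t^k e_r is replaced by
    x_(Nk+r); the Gram relations say that p |-> [p] is isometric from the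
    polynomials in L^2(M) onto a dense subspace of H.

    (i) => (ii): when polynomials are dense the map extends to an isomorphism of
    L^2(M) with H; multiplication by t is self-adjoint there, extends the shift,
    and its resolution of unity is multiplication by the indicators of (-oo, s).

    (ii) => (iii): let y = (T - z)^-1 x_k, and let h be a density of the measure
    d(E_t y, x_j). Replacing x_j by E_s x_j shows that m_kj has density (t - z) h,
    hence the integral of 1/(t - z) against m_kj is the total mass (y, x_j).

    (iii) => (iv): D is the resolvent of A_U; the relation for arbitrary powers
    follows from t^(n+1)/(t - z) = t^n + z t^n/(t - z) and (T - z) D = 1.

    (iv) => (i): the moment relations give
    |q - p/(t - z)| = |[q] - D [p]| for polynomials p and q, so the closure of the
    polynomials is stable under multiplication by 1/(t - z) for every nonreal z.
    Multipliers of a closed subspace are stable under products and bounded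
    pointwise limits, hence all bounded Borel functions are multipliers, and the
    closure of the polynomials is the whole space. *)

Require Import Defs.
From HB Require Import structures.
From mathcomp Require Import all_boot all_order all_algebra.
From mathcomp Require Import complex spectral.
From mathcomp Require Import all_classical all_reals all_analysis.
From mathcomp Require Import measurable_realfun.
From mathcomp Require Import ring lra.
Import Order.TTheory GRing.Theory Num.Theory.
Import numFieldNormedType.Exports.

Set Implicit Arguments.
Unset Strict Implicit.
Unset Printing Implicit Defensive.

Local Open Scope classical_set_scope.
Local Open Scope ring_scope.

Local Notation Re := complex.Re.
Local Notation Im := complex.Im.

(** * Hilbert spaces and linear relations *)

(** The density of M is nonnegative only almost everywhere and may be singular. It is replaced by a
    version that is everywhere Hermitian, nonnegative and of trace 1, so that inequalities between
    quadratic forms hold at every point. Singularity is the obstacle to completeness of L^2(M): a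
    Cauchy sequence for the seminorm need not converge in coordinates, and it is projected pointwise
    on the range of the density, measurably in t. Completeness gives every vector of H a function in
    (i) => (ii), where the isomorphism is kept as a relation between vectors and functions and
    linear maps of H are extracted from it by choice. In (iv) => (i) the norm of p/(t - z) is not
    among the data; the resolvent identity at z and its conjugate recovers it from scalar products
    with p. Indicators of half-lines are reached from the resolvents at s + i and s - i through
    explicit polynomials converging to the sign. Integrals against a complex measure are always
    computed through a density with respect to a finite positive measure. *)

Lemma invS_small (R : realType) (e : R) : 0 < e ->
  exists n0, forall n, (n0 <= n)%N -> n.+1%:R^-1 < e.
Proof.
move=> e0; exists (Num.truncn e^-1) => n n0n.
rewrite -[ltRHS]invrK ltf_pV2 ?posrE ?invr_gt0//.
by rewrite (lt_le_trans (truncnS_gt _))// ler_nat ltnS.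
Qed.

(** The denominator r + 1, rather than r, keeps the tolerance meaningful when r = 0. *)
Lemma lin_bound (R : realType) (r c d e : R) : 0 <= r -> 0 <= d ->
  d < e / 2 / (r + 1) -> c < e / 2 -> r * d + c < e.
Proof.
move=> r0 d0; rewrite ltr_pdivlMr ?ltr_wpDl// => h1 h2.
have : r * d <= d * (r + 1) by rewrite mulrC ler_wpM2l// lerDl.
by lra.
Qed.

Section Hilbert_space.
Context (R : realType) (H : completeNormedModType R[i]).
Implicit Types (u v w : H) (e : R).

(* The norm of H has its values in R[i]. *)
Definition hnorm u : R := Re `|u|.

Lemma normE u : `|u| = (hnorm u)%:C%C.
Proof. by rewrite /hnorm RRe_real// normr_real. Qed.

Lemma hnorm_ge0 u : 0 <= hnorm u.
Proof. by rewrite -lecR -normE normr_ge0. Qed.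

Lemma hnorm0 : hnorm 0 = 0.
Proof. by rewrite /hnorm normr0. Qed.

Lemma hnorm_eq0 u : hnorm u = 0 -> u = 0.
Proof. by move=> u0; apply/eqP; rewrite -normr_eq0 normE u0. Qed.

Lemma hnormD u v : hnorm (u + v) <= hnorm u + hnorm v.
Proof. by rewrite -lecR rmorphD/= -!normE ler_normD. Qed.

Lemma hnormN u : hnorm (- u) = hnorm u.
Proof. by rewrite /hnorm normrN. Qed.

Lemma hnormBC u v : hnorm (u - v) = hnorm (v - u).
Proof. by rewrite /hnorm distrC. Qed.

Lemma hnormB_trans w u v : hnorm (u - v) <= hnorm (u - w) + hnorm (w - v).
Proof. by rewrite -[in leLHS](subrK w u) -addrA; exact: hnormD. Qed.

Lemma hnormZ (a : R[i]) u : hnorm (a *: u) = Re `|a| * hnorm u.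
Proof. by apply: complexI; rewrite -normE normrZ normE rmorphM/= RRe_real// normr_real. Qed.

Lemma Renorm_ge0 (a : R[i]) : 0 <= Re `|a|.
Proof. by rewrite -lecR RRe_real ?normr_real// normr_ge0. Qed.

Lemma hnorm_lin (a : R[i]) u v u' v' e : hnorm (u - u') < e / 2 / (Re `|a| + 1) ->
  hnorm (v - v') < e / 2 -> hnorm (a *: u + v - (a *: u' + v')) < e.
Proof.
move=> uu vv; rewrite opprD addrACA -scalerBr.
apply: le_lt_trans (hnormD _ _) _; rewrite hnormZ.
by apply: lin_bound uu vv; [exact: Renorm_ge0|exact: hnorm_ge0].
Qed.

(** Single-valuedness is asked only at 0: two values at the same point differ by a value at 0, by
    linearity of the relation. This is how every linear map of H is obtained below. *)
Lemma linear_ex (P : H -> H -> Prop) : (forall u, exists v, P u v) ->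
  (forall a u v u' v', P u v -> P u' v' -> P (a *: u + u') (a *: v + v')) ->
  (forall v, P 0 v -> v = 0) -> exists E : {linear H -> H}, forall u, P u (E u).
Proof.
move=> /choice[E EP] PL P0.
have Elin : linear E.
  move=> a u v; have h := PL a _ _ _ _ (EP u) (EP v).
  have := PL (-1) _ _ _ _ (EP (a *: u + v)) h.
  by rewrite !scaleN1r addNr => /P0 /eqP; rewrite addr_eq0 eqr_opp => /eqP.
pose EL := GRing.isLinear.Build _ _ _ _ E Elin.
pose E' : {linear H -> H} := HB.pack E EL.
by exists E'.
Qed.

Lemma closure_hnormP (P : set H) u :
  closure P u <-> forall e, 0 < e -> exists2 v, P v & hnorm (u - v) < e.
Proof.
split=> [Pu e e0|Pu B /nbhs_ballP[e /= e0 uB]].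
- have e0' : 0 < (e%:C)%C :> R[i] by rewrite ltcR.
  have [v [Pv uv]] := Pu _ (nbhsx_ballx u _ e0'); exists v => //.
  by move: uv; rewrite -ball_normE/= normE ltcR.
- have er : (Re e)%:C%C = e by rewrite RRe_real// gtr0_real.
  have [|v Pv uv] := Pu (Re e); first by rewrite -ltcR er.
  by exists v; split => //; apply: uB; rewrite -ball_normE/= normE -er ltcR.
Qed.

Lemma closure_hnorm2P (T : set (H * H)) u v :
  closure T (u, v) <-> forall e, 0 < e ->
    exists u' v', [/\ T (u', v'), hnorm (u - u') < e & hnorm (v - v') < e].
Proof.
split=> [Tu e e0|Tu B /nbhs_ballP[e /= e0 uB]].
- have e0' : 0 < (e%:C)%C :> R[i] by rewrite ltcR.
  have [[u' v'] [Tu' [uv1 uv2]]] := Tu _ (nbhsx_ballx (u, v) _ e0'); exists u', v'.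
  by move: uv1 uv2; rewrite -!ball_normE/= !normE !ltcR.
- have er : (Re e)%:C%C = e by rewrite RRe_real// gtr0_real.
  have [|u' [v' [Tu' uu vv]]] := Tu (Re e); first by rewrite -ltcR er.
  exists (u', v'); split => //; apply: uB; rewrite /= -er.
  by split; rewrite -ball_normE/= normE ltcR.
Qed.

Lemma hnorm_complete (s : nat -> H) :
  (forall e, 0 < e -> exists n0, forall n m,
     (n0 <= n)%N -> (n0 <= m)%N -> hnorm (s n - s m) < e) ->
  exists l, forall e, 0 < e -> exists n0, forall n, (n0 <= n)%N -> hnorm (s n - l) < e.
Proof.
move=> cs.
have : cvg (s @ \oo).
  apply/cauchy_cvgP/cauchy_exP => e e0.
  have er : (Re e)%:C%C = e by rewrite RRe_real// gtr0_real.
  have [|n0 sn0] := cs (Re e); first by rewrite -ltcR er.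
  exists (s n0); exists n0 => // n /= n0n.
  by rewrite -ball_normE/= normE -er ltcR sn0.
move=> /cvg_ex[l sl]; exists l => e e0.
have e0' : 0 < (e%:C)%C :> R[i] by rewrite ltcR.
move/cvgrPdist_lt : sl => /(_ _ e0')[n0 _ n0s]; exists n0 => n n0n.
by rewrite hnormBC -ltcR -normE; exact: n0s.
Qed.

End Hilbert_space.

(** * Scalar products, orthogonal projection and symmetric relations *)

Section dot_product.
Context (R : realType) (H : completeNormedModType R[i]).
Context (dot : {dot H for (@Num.conj R[i])}).
Hypothesis hdot : forall u, dot u u = `|u| ^+ 2.
Implicit Types (u v w : H) (a : R[i]).

Lemma dotC u v : dot u v = (dot v u)^*.
Proof. by rewrite hermC expr0 mul1r. Qed.

Lemma dotDl u v w : dot (u + v) w = dot u w + dot v w.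
Proof. by rewrite linearDl. Qed.
Lemma dotBl u v w : dot (u - v) w = dot u w - dot v w.
Proof. by rewrite linearDl linearNl. Qed.
Lemma dotZl a u w : dot (a *: u) w = a * dot u w.
Proof. by rewrite linearZl_LR. Qed.
Lemma dot0l w : dot 0 w = 0.
Proof. by rewrite linear0l. Qed.
Lemma dotDr u v w : dot w (u + v) = dot w u + dot w v.
Proof. by rewrite linearDr. Qed.
Lemma dotBr u v w : dot w (u - v) = dot w u - dot w v.
Proof. by rewrite linearDr linearNr. Qed.
Lemma dotZr a u w : dot w (a *: u) = a^* * dot w u.
Proof. by rewrite linearZr_LR. Qed.
Lemma dot0r w : dot w 0 = 0.
Proof. by rewrite linear0r. Qed.
Lemma dotNr u w : dot w (- u) = - dot w u.
Proof. by rewrite linearNr. Qed.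
Lemma dotNl u w : dot (- u) w = - dot u w.
Proof. by rewrite linearNl. Qed.

Lemma dotE u : dot u u = (hnorm u ^+ 2)%:C%C.
Proof. by rewrite hdot normE rmorphXn. Qed.

Lemma dot_eq0 u : dot u u = 0 -> u = 0.
Proof.
by move/eqP; rewrite hdot sqrf_eq0 normr_eq0 => /eqP.
Qed.

(** Pythagoras for u and its projection on the line of v. It serves both Cauchy-Schwarz and the
    variational step of the projection theorem. *)
Lemma dot_decomp u v : v != 0 -> let a := dot u v / dot v v in
  dot u u = dot (u - a *: v) (u - a *: v) + `|a| ^+ 2 * dot v v.
Proof.
move=> v0 a; have vv0 : dot v v != 0 by rewrite hdot sqrf_eq0 normr_eq0.
set u1 := u - a *: v.
have u1v : dot u1 v = 0 by rewrite dotBl dotZl divfK// subrr.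
have vu1 : dot v u1 = 0 by rewrite dotC u1v conjC0.
have uE : u = u1 + a *: v by rewrite /u1 subrK.
clearbody u1; rewrite [in LHS]uE dotDl !dotDr !dotZl !dotZr u1v vu1 normCK.
by rewrite !mulr0 addr0 add0r !mulrA.
Qed.

Lemma dot_CS u v : `|dot u v| <= (hnorm u * hnorm v)%:C%C.
Proof.
have [->|v0] := eqVneq v 0.
  by rewrite dot0r normr0 lecR mulr_ge0// hnorm_ge0.
have vv0 : dot v v != 0 by rewrite hdot sqrf_eq0 normr_eq0.
rewrite -(@ler_pXn2r _ 2)//; last by rewrite nnegrE lecR mulr_ge0// hnorm_ge0.
have -> : (hnorm u * hnorm v)%:C%C ^+ 2 = dot u u * dot v v.
  by rewrite !dotE rmorphM/= !rmorphXn/= exprMn.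
rewrite (dot_decomp u v0); set a := _ / _.
rewrite mulrDl -mulrA -expr2 -exprMn.
have -> : `|dot u v| ^+ 2 = (`|a| * dot v v) ^+ 2.
  rewrite /a normrM normfV [X in _ / X]ger0_norm ?divfK ?hdot ?exprn_ge0 -?hdot//.
by rewrite lerDr mulr_ge0// hdot exprn_ge0.
Qed.

Lemma dot_orth_closure (P : set H) w :
  (forall v, P v -> dot v w = 0) -> forall u, closure P u -> dot u w = 0.
Proof.
move=> Pw u /closure_hnormP Pu; apply/eqP/negPn/negP; rewrite -normr_gt0 => uw0.
have w0 : 0 < hnorm w.
  rewrite lt_def hnorm_ge0 andbT; apply/eqP => /hnorm_eq0 w0.
  by move: uw0; rewrite w0 dot0r normr0 ltxx.
have d0 : 0 < Re `|dot u w|.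
  by rewrite -ltcR RRe_real// normr_real.
have [|v Pv uv] := Pu (Re `|dot u w| / hnorm w); first by rewrite divr_gt0.
have := dot_CS (u - v) w; rewrite dotBl (Pw _ Pv) subr0.
rewrite -[X in X <= _]RRe_real ?normr_real// lecR leNgt.
by rewrite -ltr_pdivlMr// uv.
Qed.

Definition subspace (S : set H) :=
  S 0 /\ forall a u v, S u -> S v -> S (a *: u + v).

Lemma parallelogram u v :
  hnorm (u + v) ^+ 2 + hnorm (u - v) ^+ 2 = 2 * hnorm u ^+ 2 + 2 * hnorm v ^+ 2.
Proof.
apply: complexI; rewrite [LHS]rmorphD [RHS]rmorphD !(rmorphM _ 2) rmorph_nat/= -!dotE.
by rewrite !dotDl !dotDr !dotNr !dotNl; ring.
Qed.

Lemma hnormZn n u : hnorm (n%:R *: u) = n%:R * hnorm u.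
Proof. by rewrite hnormZ normr_nat -(rmorph_nat (real_complex R)). Qed.

(** Minimizing sequence for the squared distance from u to S. Midpoints stay in S, so the
    parallelogram law bounds |s_n - s_m|^2 by the excesses over the infimum and the sequence is
    Cauchy. *)
Lemma projection (S : set H) : subspace S -> closure S `<=` S ->
  forall u, exists2 s, S s & forall v, S v -> dot (u - s) v = 0.
Proof.
move=> [S0 SL] Scl u.
pose D := [set hnorm (u - s) ^+ 2 | s in S].
have D0 : lbound D 0 by move=> _ [s _ <-]; rewrite exprn_ge0// hnorm_ge0.
have infD : has_inf D by split; [exists (hnorm (u - 0) ^+ 2); exists 0|exists 0].
pose d := inf D.
have dD s : S s -> d <= hnorm (u - s) ^+ 2.
  by move=> Ss; apply: ge_inf; [case: infD|exists s].
have /choice[s sP] : forall n : nat, exists s, S s /\ hnorm (u - s) ^+ 2 < d + n.+1%:R^-1.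
  move=> n; have n0 : 0 < n.+1%:R^-1 :> R by rewrite invr_gt0.
  by have [_ [s Ss <-] sd] := inf_adherent n0 infD; exists s.
have dss n m : hnorm (s n - s m) ^+ 2 <= 2 * n.+1%:R^-1 + 2 * m.+1%:R^-1.
  have := parallelogram (u - s n) (u - s m).
  have -> : u - s n - (u - s m) = s m - s n by rewrite opprB addrC addrA subrK.
  have -> : u - s n + (u - s m) = 2 *: (u - 2^-1 *: (s n + s m)).
    rewrite scalerBr scalerA divff ?pnatr_eq0// scale1r scaler_nat mulr2n.
    by rewrite opprD addrACA.
  have /dD : S (2^-1 *: (s n + s m)).
    rewrite -[X in S X]addr0; apply: (SL) => //.
    by rewrite -[s n]scale1r; apply: (SL); [case: (sP n)|case: (sP m)].
  rewrite hnormZn.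
  have [_ ] := sP n; have [_] := sP m.
  rewrite (hnormBC (s m)); set x1 := hnorm (s n - s m); set x2 := hnorm (u - s m); set x3 := hnorm (u - s n).
  set x4 := hnorm _ ; rewrite exprMn; clearbody x1 x2 x3 x4.
  move: (x1 ^+ 2) (x2 ^+ 2) (x3 ^+ 2) (x4 ^+ 2) (n.+1%:R^-1) (m.+1%:R^-1).
  by move=> a1 a2 a3 a4 a5 a6 h1 h2 h3 h4; lra.
have [|l sl] := @hnorm_complete _ _ s.
  move=> e e0; have [|n0 sn0] := @invS_small R (e ^+ 2 / 4); first by rewrite divr_gt0// exprn_gt0.
  exists n0 => n m n0n n0m.
  rewrite -(@ltr_pXn2r _ 2)// ?nnegrE ?hnorm_ge0// 1?ltW//.
  apply: le_lt_trans (dss _ _) _; have := sn0 _ n0n; have := sn0 _ n0m.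
  by move: (n.+1%:R^-1) (m.+1%:R^-1) (e ^+ 2) => a1 a2 a3 h1 h2; lra.
have Sl : S l.
  apply: Scl; apply/closure_hnormP => e e0; have [n sn] := sl _ e0.
  by exists (s n); [case: (sP n)|rewrite hnormBC sn].
have uld : hnorm (u - l) ^+ 2 <= d.
  have d0 : 0 <= d by apply: lb_le_inf => //; case: infD.
  rewrite -(sqr_sqrtr d0) ler_pXn2r// ?nnegrE ?hnorm_ge0 ?sqrtr_ge0//.
  apply/ler_addgt0Pr => e e0.
  have e2 : 0 < e / 2 by rewrite divr_gt0.
  have [n1 sn1] := sl _ e2.
  have [|n2 sn2] := @invS_small R ((e / 2) ^+ 2); first by rewrite exprn_gt0// divr_gt0.
  pose n := maxn n1 n2.
  apply: le_trans (hnormB_trans (s n) _ _) _.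
  have h1 : hnorm (s n - l) < e / 2 by apply: sn1; rewrite leq_maxl.
  have h2 : hnorm (u - s n) <= Num.sqrt d + e / 2.
    have h0 : 0 <= Num.sqrt d + e / 2 by rewrite addr_ge0 ?sqrtr_ge0// ltW.
    rewrite -(@ler_pXn2r _ 2)// ?nnegrE ?hnorm_ge0//.
    have [_ h] := sP n; have h2 := sn2 n (leq_maxr _ _).
    rewrite (le_trans (ltW h))// sqrrD sqr_sqrtr// -addrA lerD2l.
    rewrite (le_trans (ltW h2))// lerDr mulrn_wge0// mulr_ge0 ?sqrtr_ge0//.
    by rewrite divr_ge0// ltW.
  by lra.
exists l => // v Sv; have [->|v0] := eqVneq v 0; first by rewrite dot0r.
(* Replacing l by l + a v in S lowers the squared distance by |a|^2 |v|^2; minimality of l forces a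
   = 0. *)
have := dot_decomp (u - l) v0; set a := _ / _ => E.
have : S (l + a *: v) by rewrite addrC; exact: SL.
move=> /dD; rewrite opprD addrA => h.
have : `|a| ^+ 2 * dot v v <= 0.
  rewrite -(lerD2l (dot (u - l - a *: v) (u - l - a *: v))) -E addr0 !dotE lecR.
  exact: le_trans h.
have vv0 : 0 < dot v v by rewrite hdot exprn_gt0// normr_gt0.
rewrite pmulr_lle0// -normrX normr_le0 sqrf_eq0 mulf_eq0 invr_eq0 (gt_eqF vv0) orbF.
by move/eqP.
Qed.

Lemma closure_subspace (S : set H) : subspace S -> subspace (closure S).
Proof.
move=> [S0 SL]; split; first exact: subset_closure.
move=> a u v /closure_hnormP Su /closure_hnormP Sv; apply/closure_hnormP => e e0.
have a0 : 0 < Re `|a| + 1 by rewrite ltr_wpDl// Renorm_ge0.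
have [|u' Su' uu'] := Su (e / 2 / (Re `|a| + 1)); first by rewrite !divr_gt0.
have [|v' Sv' vv'] := Sv (e / 2); first by rewrite divr_gt0.
by exists (a *: u' + v'); [exact: SL|exact: hnorm_lin].
Qed.

Lemma dense_orth (S : set H) : subspace S ->
  (forall w, (forall v, S v -> dot v w = 0) -> w = 0) -> closure S = setT.
Proof.
move=> SS Sw; apply/seteqP; split=> // u _.
have [|s Ss us] := @projection (closure S) (closure_subspace SS) _ u.
  by rewrite -(iffLR (closure_id _))//; exact: closed_closure.
suff /Sw/eqP : forall v, S v -> dot v (u - s) = 0 by rewrite subr_eq0 => /eqP ->.
by move=> v Sv; rewrite dotC us ?conjC0//; exact: subset_closure.
Qed.

Lemma conj_i : ('i%C : R[i])^* = - 'i%C.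
Proof. by apply/eqP; rewrite eq_complex/= oppr0 !eqxx. Qed.

Lemma conj_real (y : R) : (y%:C%C : R[i])^* = y%:C%C.
Proof. by apply/eqP; rewrite eq_complex/= oppr0 !eqxx. Qed.

Lemma conjM a b : (a * b)^* = a^* * b^*.
Proof. exact: rmorphM. Qed.

Lemma conjD a b : (a + b)^* = a^* + b^*.
Proof. exact: rmorphD. Qed.

Lemma conjN a : (- a)^* = - a^*.
Proof. exact: rmorphN. Qed.

Lemma mul_ii : 'i%C * 'i%C = -1 :> R[i].
Proof. by rewrite -expr2 sqr_i. Qed.

Implicit Types (T B : set (H * H)) (z : R[i]).

(** Unlike [linear_operator], this does not ask for single-valuedness, so that it passes to closures
    of graphs; [sa_criterion] recovers single-valuedness from symmetry and density of the domain. *)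
Definition linear_rel T := T (0, 0) /\
  forall a u v u' v', T (u, v) -> T (u', v') -> T (a *: u + u', a *: v + v').

Definition symmetric_rel T :=
  forall u v u' v', T (u, v) -> T (u', v') -> dot v u' = dot u v'.

Lemma ranP T z w :
  ran (op_shift T (- z)) w <-> exists u v, T (u, v) /\ w = v - z *: u.
Proof.
split=> [[_ [[u v] Tuv <-] <-]|[u [v [Tuv ->]]]]; last first.
  by exists (u, v - z *: u) => //; exists (u, v) => //=; rewrite scaleNr.
by exists u, v; rewrite /= scaleNr.
Qed.

Lemma ran_subspace T z : linear_rel T -> subspace (ran (op_shift T (- z))).
Proof.
move=> [T0 TL]; split; first by apply/ranP; exists 0, 0; rewrite scaler0 subr0.
move=> a _ _ /ranP[u [v [Tuv ->]]] /ranP[u' [v' [Tuv' ->]]]; apply/ranP.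
exists (a *: u + u'), (a *: v + v'); split; first exact: TL.
by rewrite scalerBr scalerDr !scalerA [a * z]mulrC opprD addrACA.
Qed.

Lemma linear_relB T u v u' v' : linear_rel T -> T (u, v) -> T (u', v') ->
  T (u - u', v - v').
Proof.
move=> [T0 TL] Tu Tu'; have := TL (-1) _ _ _ _ Tu' Tu.
by rewrite !scaleN1r ![- _ + _]addrC.
Qed.

Lemma closure_linear_rel T : linear_rel T -> linear_rel (closure T).
Proof.
move=> [T0 TL]; split; first exact: subset_closure.
move=> a u v u' v' /closure_hnorm2P Tu /closure_hnorm2P Tv; apply/closure_hnorm2P => e e0.
have a0 : 0 < Re `|a| + 1 by rewrite ltr_wpDl// Renorm_ge0.
have [|u1 [v1 [Tu1 uu1 vv1]]] := Tu (e / 2 / (Re `|a| + 1)).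
  by rewrite !divr_gt0.
have [|u2 [v2 [Tu2 uu2 vv2]]] := Tv (e / 2); first by rewrite divr_gt0.
by exists (a *: u1 + u2), (a *: v1 + v2); split; [exact: TL|exact: hnorm_lin..].
Qed.

(** For fixed (a, b) in T, the equation defining the adjoint is continuous in (u, w), by
    Cauchy-Schwarz. *)
Lemma adjoint_closed T : closure (adjoint dot T) `<=` adjoint dot T.
Proof.
move=> [u w] /closure_hnorm2P Tuw [a b] Tab /=.
apply/eqP; rewrite -subr_eq0; apply/negPn/negP; rewrite -normr_gt0 => d0.
have d0' : 0 < Re `|dot b u - dot a w| by rewrite -ltcR RRe_real ?normr_real.
have ab0 : 0 < hnorm a + hnorm b + 1 by rewrite ltr_wpDl// addr_ge0// hnorm_ge0.
have [|u' [w' [/(_ _ Tab)/= E uu ww]]] :=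
  Tuw (Re `|dot b u - dot a w| / (hnorm a + hnorm b + 1)).
  by rewrite divr_gt0.
have : `|dot b u - dot a w| <= `|dot b (u - u')| + `|dot a (w - w')|.
  rewrite (_ : dot b u - _ = dot b (u - u') - dot a (w - w')) ?ler_normB//.
  by rewrite !dotBr E; ring.
move=> /le_trans/(_ (lerD (dot_CS _ _) (dot_CS _ _))).
rewrite -rmorphD/= -[X in X <= _]RRe_real ?normr_real// lecR leNgt => /negP; apply.
set d := Re _ in d0' uu ww *.
have k0 : 0 < d / (hnorm a + hnorm b + 1) by rewrite divr_gt0.
rewrite -[ltRHS](@divfK _ (hnorm a + hnorm b + 1)) ?gt_eqF//.
move: k0 uu ww; set k := d / _ => k0 uu ww.
have h1 := ler_wpM2l (hnorm_ge0 b) (ltW uu).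
have h2 := ler_wpM2l (hnorm_ge0 a) (ltW ww).
by apply: le_lt_trans (lerD h1 h2) _; lra.
Qed.

Lemma sub_adjointC T B : T `<=` adjoint dot B -> B `<=` adjoint dot T.
Proof.
move=> TB [u v] Buv [u' v'] /TB /(_ _ Buv)/= E.
by rewrite dotC -E -dotC.
Qed.

Lemma symmetric_relP T : symmetric_rel T <-> T `<=` adjoint dot T.
Proof.
split=> [Ts [u v] Tuv [u' v'] Tuv'|Ts u v u' v' Tuv /Ts /(_ _ Tuv)//].
exact: Ts Tuv' Tuv.
Qed.

(** Symmetry says that T lies in its adjoint. An adjoint is closed and the inclusion can be turned
    round, so T is replaced by its closure on one side, then on the other. *)
Lemma closure_symmetric_rel T : symmetric_rel T -> symmetric_rel (closure T).
Proof.
have cl B T' : T' `<=` adjoint dot B -> closure T' `<=` adjoint dot B.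
  by move=> /closureS/subset_trans; apply; exact: adjoint_closed.
by move=> /symmetric_relP/cl/sub_adjointC/cl/symmetric_relP.
Qed.

(** Symmetry makes dot v u real, so the terms linear in Im z cancel and only the square of Im z
    remains. For nonreal z this bounds u by v - z u. *)
Lemma shift_norm T z u v : symmetric_rel T -> T (u, v) ->
  dot (v - z *: u) (v - z *: u) = dot (v - (Re z)%:C%C *: u) (v - (Re z)%:C%C *: u)
     + (Im z ^+ 2)%:C%C * dot u u.
Proof.
move=> Ts Tuv; rewrite !dotBl !dotBr !dotZl !dotZr (Ts _ _ _ _ Tuv Tuv).
rewrite [z in LHS]complexE rmorphD rmorphM/= conj_i.
rewrite !conj_real rmorphXn/=; set a := (Re z)%:C%C; set b := (Im z)%:C%C.
have := mul_ii; set i := 'i%C => ii; ring: ii.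
Qed.

Lemma shift_hnorm T z u v : symmetric_rel T -> T (u, v) ->
  `|Im z| * hnorm u <= hnorm (v - z *: u).
Proof.
move=> Ts Tuv; rewrite -(@ler_pXn2r _ 2)// ?nnegrE ?mulr_ge0 ?hnorm_ge0//.
rewrite -lecR -dotE (shift_norm _ Ts Tuv) exprMn rmorphM/= -dotE real_normK ?num_real//.
by rewrite lerDr dotE lecR exprn_ge0// hnorm_ge0.
Qed.
End dot_product.

(** * Ranges of T - z and the criterion of self-adjointness *)

Section self_adjoint_extensions.
Context (R : realType) (H : completeNormedModType R[i]).
Context (dot : {dot H for (@Num.conj R[i])}).
Hypothesis hdot : forall u, dot u u = `|u| ^+ 2.
Implicit Types (u v w : H) (T B : set (H * H)) (z : R[i]).

(** If v_n - z u_n converges, [shift_hnorm] makes u_n Cauchy; then v_n converges as well, and the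
    limit pair is in T because T is closed. *)
Lemma ran_closed T z : linear_rel T -> symmetric_rel dot T -> closure T `<=` T ->
  Im z != 0 ->
  closure (ran (op_shift T (- z))) `<=` ran (op_shift T (- z)).
Proof.
move=> TL Ts Tcl z0 w /closure_hnormP Tw.
have /choice[uv uvP] : forall n : nat, exists p : H * H, T p /\
    hnorm (w - (p.2 - z *: p.1)) < n.+1%:R^-1.
  move=> n; have [|w' /ranP[u [v [Tuv ->]]] ww'] := Tw n.+1%:R^-1.
    by rewrite invr_gt0.
  by exists (u, v).
pose s n := (uv n).1.
have y0 : 0 < `|Im z| by rewrite normr_gt0.
have [|u su] := @hnorm_complete _ _ s.
  move=> e e0; have [|n0 sn0] := @invS_small R (e * `|Im z| / 2).
    by rewrite divr_gt0// mulr_gt0.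
  exists n0 => n m n0n n0m.
  have [Tn wn] := uvP n; have [Tm wm] := uvP m.
  have := linear_relB TL (_ : T ((uv n).1, (uv n).2)) (_ : T ((uv m).1, (uv m).2)).
  rewrite -!surjective_pairing => /(_ Tn Tm) /(shift_hnorm hdot z Ts).
  rewrite -(ltr_pM2l y0) => /le_lt_trans; apply.
  have -> : (uv n).2 - (uv m).2 - z *: ((uv n).1 - (uv m).1) =
    (w - ((uv m).2 - z *: (uv m).1)) - (w - ((uv n).2 - z *: (uv n).1)).
    rewrite [RHS]addrC opprB addrA subrK scalerBr.
    by rewrite [in LHS]opprD addrACA -opprD.
  apply: le_lt_trans (hnormD _ _) _; rewrite hnormN.
  rewrite mulrC; have hn := lt_trans wn (sn0 _ n0n); have hm := lt_trans wm (sn0 _ n0m).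
  by apply: lt_le_trans (ltrD hm hn) _; rewrite -splitr.
apply/ranP; exists u, (w + z *: u); split; last by rewrite addrK.
apply: Tcl; apply/closure_hnorm2P => e e0.
pose c := Re `|z| + 1.
have c0 : 0 < c by rewrite ltr_wpDl// Renorm_ge0.
have c1 : 1 <= c by rewrite lerDr Renorm_ge0.
have [|n1 sn1] := su (e / 2 / c); first by rewrite !divr_gt0.
have [|n2 sn2] := @invS_small R (e / 2); first by rewrite divr_gt0.
pose n := maxn n1 n2; have [Tn wn] := uvP n.
have h1 : hnorm (u - s n) < e / 2 / c by rewrite hnormBC sn1// leq_maxl.
have h2 := lt_trans wn (sn2 n (leq_maxr _ _)).
exists (uv n).1, (uv n).2; split; first by rewrite -surjective_pairing.
  apply: lt_le_trans h1 _; rewrite ler_pdivrMr//.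
  by rewrite -[leLHS]mulr1 ler_pM//; lra.
have -> : w + z *: u - (uv n).2 = (w - ((uv n).2 - z *: (uv n).1)) + z *: (u - s n).
  by rewrite scalerBr opprB addrACA [X in _ = _ + X]addrAC subrr add0r.
apply: le_lt_trans (hnormD _ _) _; rewrite hnormZ.
have : Re `|z| * hnorm (u - s n) <= e / 2.
  rewrite ltr_pdivlMr// mulrC in h1; apply: le_trans (ltW h1).
  by rewrite ler_wpM2r ?hnorm_ge0// lerDl.
by lra.
Qed.

(** For (u, w) in the adjoint, surjectivity of T - i gives (u', v') in T with v' - i u' = w - i u.
    Then u - u' is orthogonal to the range of T + i, which is everything, so that (u, w) = (u',
    v'). *)
Lemma sa_criterion T : linear_rel T -> symmetric_rel dot T -> closure (dom T) = setT ->
  ran (op_shift T (- 'i%C)) = setT -> ran (op_shift T 'i%C) = setT ->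
  self_adjoint dot T.
Proof.
move=> TL Ts Td Ti Tni.
have adjT : adjoint dot T = T.
  apply/seteqP; split; last exact/symmetric_relP.
  move=> [u w] Auw.
  have : [set: H] (w - 'i%C *: u) by [].
  rewrite -Ti => /ranP[u' [v' [Tuv' E]]].
  have wv : w - v' = 'i%C *: (u - u').
    by apply/eqP; rewrite -subr_eq0 scalerBr opprD addrACA -opprD E subrr.
  have uu : u - u' = 0.
    apply: (dot_eq0 hdot).
    have : [set: H] (u - u') by [].
    rewrite -{1}Tni -['i%C]opprK => /ranP[a [b [Tab E2]]].
    rewrite {1}E2 scaleNr opprK dotDl dotBr (Ts _ _ _ _ Tab Tuv').
    have := Auw _ Tab; rewrite /= => ->.
    by rewrite -dotBr wv dotZl dotZr conj_i mulNr addNr.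
  move/eqP : (uu); rewrite subr_eq0 => /eqP ->.
  by move/eqP : wv; rewrite uu scaler0 subr_eq0 => /eqP ->.
split => //; case: TL => T0 TL; split => // u v w Tv Tw.
apply/eqP; rewrite -subr_eq0; apply/eqP.
(* By symmetry, two values at one point differ by a vector orthogonal to the dense domain. *)
have T0w : T (0, v - w) by have := linear_relB (conj T0 TL) Tv Tw; rewrite subrr.
have := @dot_orth_closure _ _ _ hdot (dom T) (v - w).
rewrite Td => h; apply: (dot_eq0 hdot); apply: h => // _ [[a b] Tab <-]/=.
by rewrite -(Ts _ _ _ _ Tab T0w) dot0r.
Qed.

Lemma sa_symmetric T : self_adjoint dot T -> symmetric_rel dot T.
Proof. by case=> _ _ TA; apply/symmetric_relP; rewrite TA. Qed.

Lemma sa_linear T : self_adjoint dot T -> linear_rel T.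
Proof. by case=> -[]. Qed.

Lemma sa_closed T : self_adjoint dot T -> closure T `<=` T.
Proof. by case=> _ _ <-; exact: (adjoint_closed hdot). Qed.

(** The range is closed, and a vector orthogonal to it is an eigenvector of T = adjoint T for conj
    z; a symmetric operator has no nonreal eigenvalue. *)
Lemma sa_ran T z : self_adjoint dot T -> Im z != 0 ->
  ran (op_shift T (- z)) = setT.
Proof.
move=> Tsa z0; have Ts := sa_symmetric Tsa; have TL := sa_linear Tsa.
have Tcl := ran_closed TL Ts (sa_closed Tsa) z0.
rewrite -(@dense_orth _ _ dot hdot (ran (op_shift T (- z)))).
- by apply/seteqP; split=> //; exact: subset_closure.
- exact: ran_subspace.
move=> w wT; apply: (dot_eq0 hdot).
have Tw : T (w, z^* *: w).
  case: Tsa => _ _ <- [a b] Tab /=; rewrite dotZr conjCK; apply/eqP.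
  by rewrite -subr_eq0 -dotZl -dotBl wT//; apply/ranP; exists a, b.
have := Ts _ _ _ _ Tw Tw; rewrite dotZl dotZr conjCK => /eqP.
rewrite -subr_eq0 -mulrBl mulf_eq0 => /orP[/eqP zz|/eqP//].
have := congr1 (@complex.Im R) zz; case: z z0 zz {Tcl wT Tw} => a b/= z0 _.
by move/eqP; rewrite -opprD oppr_eq0 -mulr2n mulrn_eq0 (negbTE z0).
Qed.

(** Adjoints reverse inclusions: B = adjoint B lies in adjoint T = T. *)
Lemma sa_maximal T B : self_adjoint dot T -> self_adjoint dot B -> T `<=` B -> T = B.
Proof.
move=> Tsa Bsa TB; apply/seteqP; split => //; case: Tsa => _ _ <-.
have /symmetric_relP := sa_symmetric Bsa => + p Bp => /(_ p Bp) Ap q /TB.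
exact: Ap.
Qed.
End self_adjoint_extensions.

(** * Self-adjoint extensions *)

Section von_Neumann.
Context (R : realType) (H : completeNormedModType R[i]).
Context (dot : {dot H for (@Num.conj R[i])}).
Hypothesis hdot : forall u, dot u u = `|u| ^+ 2.
Implicit Types (u v w : H) (T B U : set (H * H)) (z : R[i]).

Lemma dot_ext u v : (forall w, dot u w = dot v w) -> u = v.
Proof.
move=> uv; apply/eqP; rewrite -subr_eq0; apply/eqP/(dot_eq0 hdot).
by rewrite dotBl uv subrr.
Qed.

(* Tested against an arbitrary vector, a vector identity becomes a scalar one. *)
Ltac vring := apply: dot_ext => ?;
  rewrite ?(dotDl, dotBl, dotNl, dotZl, dot0l); ring.

(** Here and below, T (y, u + z *: y) is the graph form of y = (T - z)^-1 u. *)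
Lemma resolvent_bound T z u y : self_adjoint dot T -> T (y, u + z *: y) ->
  `|Im z| * hnorm y <= hnorm u.
Proof.
move=> Tsa Ty; have := shift_hnorm hdot z (sa_symmetric Tsa) Ty.
by rewrite addrK.
Qed.

Lemma resolvent_uniq T z u y y' : self_adjoint dot T -> Im z != 0 ->
  T (y, u + z *: y) -> T (y', u + z *: y') -> y = y'.
Proof.
move=> Tsa z0 Ty Ty'; apply/eqP; rewrite -subr_eq0; apply/eqP/hnorm_eq0.
have T0 : T (y - y', 0 + z *: (y - y')).
  by have := linear_relB (sa_linear Tsa) Ty Ty'; rewrite opprD addrACA subrr -scalerBr.
have := resolvent_bound Tsa T0; rewrite hnorm0.
have : 0 < `|Im z| by rewrite normr_gt0.
by have := hnorm_ge0 (y - y'); rewrite le_eqVlt => /orP[/eqP|]; nra.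
Qed.

Lemma resolvent_ex T z : self_adjoint dot T -> Im z != 0 ->
  exists D : {linear H -> H}, forall u, T (D u, u + z *: D u).
Proof.
move=> Tsa z0; have TL := sa_linear Tsa.
apply: (@linear_ex _ _ (fun u y => T (y, u + z *: y))) => [u|a u v u' v' Tv Tv'|v Tv].
- have : [set: H] u by [].
  by rewrite -(sa_ran hdot Tsa z0) => /ranP[y [v [Tyv ->]]]; exists y; rewrite subrK.
- have := TL.2 a _ _ _ _ Tv Tv'; congr (T (_, _)); vring.
- by apply: (resolvent_uniq Tsa z0 Tv); rewrite scaler0 addr0; case: TL.
Qed.

Section closed_symmetric.
Variable T : set (H * H).
Hypotheses (TL : linear_rel T) (Ts : symmetric_rel dot T)
  (Tcl : closure T `<=` T) (Td : closure (dom T) = setT).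

Lemma ran_defect z u : Im z != 0 ->
  exists f g, T (f, g) /\ defect dot T z (u - (g - z *: f)).
Proof.
move=> z0.
have [s /ranP[f [g [Tfg ->]]] us] :=
  projection hdot (ran_subspace z TL) (ran_closed hdot TL Ts Tcl z0) u.
by exists f, g.
Qed.

(** In terms of the adjoint: u is an eigenvector of it for conj z. *)
Lemma defectP z u : defect dot T z u -> forall f g, T (f, g) -> dot u g = z^* * dot u f.
Proof.
move=> Du f g Tfg; rewrite -dotZr; apply/eqP; rewrite -subr_eq0 -dotBr Du//.
by apply/ranP; exists f, g.
Qed.

Lemma defectPl z u : defect dot T z u -> forall f g, T (f, g) -> dot g u = z * dot f u.
Proof. by move=> Du f g Tfg; rewrite dotC (defectP Du Tfg) conjM conjCK -dotC. Qed.

Lemma Im_i : Im 'i%C != 0 :> R.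
Proof. by rewrite /= oner_neq0. Qed.
Lemma Im_Ni : Im (- 'i%C) != 0 :> R.
Proof. by rewrite /= oppr_eq0 oner_neq0. Qed.

Lemma mulr2i_neq0 : 2 * 'i%C != 0 :> R[i].
Proof. by rewrite mulf_neq0 ?pnatr_eq0// eq_complex/= oner_eq0 andbF. Qed.

Lemma sub_qsa U : linear_operator U -> T `<=` qsa_extension T U.
Proof.
by move=> [U0 _ _] [f g] Tfg; exists (f, g) => //; exists (0, 0) => //=;
  rewrite !scaler0 !addr0 subr0.
Qed.

(** The hypotheses on U match those of [sa_criterion]: isometry cancels the terms in psi and phi and
    gives symmetry, the full domain N_i gives surjectivity of A_U - i, and the full range N_-i that
    of A_U + i. *)
Lemma qsa_self_adjoint U :
  unitary_onto dot U (defect dot T 'i%C) (defect dot T (- 'i%C)) ->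
  self_adjoint dot (qsa_extension T U).
Proof.
move=> [[U0 UL Usv] Udom Uran Uiso].
have Upsi p : U p -> defect dot T 'i%C p.1 by move=> Up; rewrite -Udom; exists p.
have Uphi p : U p -> defect dot T (- 'i%C) p.2 by move=> Up; rewrite -Uran; exists p.
apply: sa_criterion => //.
- split; first by apply: sub_qsa => //; case: TL.
  move=> a u v u' v' [[f g] Tfg [[psi phi] Up] [<- <-]] [[f' g'] Tfg' [[psi' phi'] Up'] [<- <-]].
  exists (a *: f + f', a *: g + g'); first by case: TL => _; apply.
  exists (a *: psi + psi', a *: phi + phi'); first exact: UL.
  by congr (_, _); rewrite /=; vring.
- move=> _ _ _ _ [[f g] Tfg [[psi phi] Up] [<- <-]] [[f' g'] Tfg' [[psi' phi'] Up'] [<- <-]] /=.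
  have E := Uiso _ _ Up Up'; rewrite /= in E.
  have E1 := defectP (Upsi _ Up) Tfg'; have E2 := defectP (Uphi _ Up) Tfg'.
  have E3 := defectPl (Upsi _ Up') Tfg; have E4 := defectPl (Uphi _ Up') Tfg.
  rewrite /= ?conjN ?conj_i ?opprK in E1 E2 E3 E4.
  rewrite !(dotDl, dotDr, dotBl, dotBr, dotNl, dotNr, dotZl, dotZr) !conj_i E E1 E2 E3 E4 (Ts Tfg Tfg').
  by ring.
- apply/seteqP; split => // u _; move: (Td); rewrite -subTset => /(_ u I).
  apply: closureS => _ [p Tp <-]; exists p => //.
  by apply: sub_qsa.
- apply/seteqP; split => // u _; apply/ranP.
  have [f [g [Tfg Du]]] := ran_defect u Im_i.
  (* (A_U - i)(f + U psi - psi) = (T - i) f + 2 i psi, so psi is the component of u in the defect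
     space divided by 2 i. *)
  have : dom U ((2 * 'i%C)^-1 *: (u - (g - 'i%C *: f))).
    rewrite Udom => v Tv; by rewrite dotZl Du// mulr0.
  move=> [[psi phi] Up /= psiE].
  exists (f + phi - psi), (g + 'i%C *: phi + 'i%C *: psi); split.
    by exists (f, g) => //; exists (psi, phi).
  have : u - (g - 'i%C *: f) = (2 * 'i%C) *: psi.
    by rewrite psiE scalerA divff ?scale1r// mulr2i_neq0.
  move/eqP; rewrite subr_eq => /eqP ->.
  by have := mul_ii R; set i := 'i%C => ii; apply: dot_ext => ?;
    rewrite ?(dotDl, dotBl, dotNl, dotZl, dot0l); ring: ii.
- apply/seteqP; split => // u _; rewrite -['i%C]opprK; apply/ranP.
  have [f [g [Tfg Du]]] := ran_defect u Im_Ni.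
  (* (A_U + i)(f + U psi - psi) = (T + i) f + 2 i U psi: this time it is phi = U psi that is
     prescribed. *)
  have : ran U ((2 * 'i%C)^-1 *: (u - (g - (- 'i%C) *: f))).
    rewrite Uran => v Tv; by rewrite dotZl Du// mulr0.
  move=> [[psi phi] Up /= psiE].
  exists (f + phi - psi), (g + 'i%C *: phi + 'i%C *: psi); split.
    by exists (f, g) => //; exists (psi, phi).
  have : u - (g - (- 'i%C) *: f) = (2 * 'i%C) *: phi.
    by rewrite psiE scalerA divff ?scale1r// mulr2i_neq0.
  move/eqP; rewrite subr_eq => /eqP ->.
  by have := mul_ii R; set i := 'i%C => ii; apply: dot_ext => ?;
    rewrite ?(dotDl, dotBl, dotNl, dotZl, dot0l); ring: ii.
Qed.

(** The extension defined by the restricted Cayley transform of B is contained in B by construction;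
    both are self-adjoint, and self-adjoint operators are maximal. *)
Lemma sa_qsa B : self_adjoint dot B -> T `<=` B ->
  exists2 U, unitary_onto dot U (defect dot T 'i%C) (defect dot T (- 'i%C)) &
    B = qsa_extension T U.
Proof.
move=> Bsa TB; have Bs := sa_symmetric Bsa; have BL := sa_linear Bsa.
have i2 := mulr2i_neq0.
(* The Cayley transform of B, restricted to the defect space. *)
pose U := [set p | [/\ defect dot T 'i%C p.1, defect dot T (- 'i%C) p.2 &
  B (p.2 - p.1, 'i%C *: p.2 + 'i%C *: p.1)]].
have UU : unitary_onto dot U (defect dot T 'i%C) (defect dot T (- 'i%C)).
  have iso p q : U p -> U q -> dot p.2 q.2 = dot p.1 q.1.
    case: p q => [psi phi] [psi' phi'] [/= _ _ Bp] [/= _ _ Bq].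
    have := Bs _ _ _ _ Bp Bq.
    rewrite !(dotDl, dotDr, dotBl, dotBr, dotNl, dotNr, dotZl, dotZr) !conj_i => E.
    apply: (mulfI i2); apply/eqP; rewrite -subr_eq0; move/eqP: E.
    by rewrite -subr_eq0; apply: eq_ind; congr (_ == 0); ring.
  have UL : forall (a : R[i]) u v u' v', U (u, v) -> U (u', v') ->
      U (a *: u + u', a *: v + v').
    move=> a u v u' v' [/= D1 D2 Bp] [/= D1' D2' Bq]; split=> /=.
    - by move=> w Tw; rewrite dotDl dotZl D1// D1'// mulr0 addr0.
    - by move=> w Tw; rewrite dotDl dotZl D2// D2'// mulr0 addr0.
    - have := BL.2 a _ _ _ _ Bp Bq; congr (B (_, _)); rewrite /=; vring.
  split => //.
  - split => //.
    + split=> /=; [by move=> ? _; rewrite dot0l|by move=> ? _; rewrite dot0l|].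
      by rewrite !scaler0 addr0 subr0; case: BL.
    + move=> u v w Uv Uw; apply/eqP; rewrite -subr_eq0; apply/eqP/(dot_eq0 hdot).
      have U0 : U (0, v - w).
        by have := UL (-1) _ _ _ _ Uw Uv; rewrite !scaleN1r addNr addrC.
      by have := iso _ _ U0 U0; rewrite /= dot0l.
  - apply/seteqP; split => [_ [p [? _ _] <-]//|psi Dpsi].
    have : [set: H] ((2 * 'i%C) *: psi) by [].
    (* With y = (B - i)^-1 (2 i psi), the vector y + psi is (B + i)(B - i)^-1 psi. *)
    rewrite -(sa_ran hdot Bsa Im_i) => /ranP[y [v [Byv E]]].
    have vE : v = 'i%C *: (y + psi) + 'i%C *: psi.
      by rewrite -[LHS](subrK ('i%C *: y)) -E; vring.
    exists (psi, y + psi) => //; split => //=; last by rewrite addrK -vE.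
    move=> w /ranP[f [g [Tfg ->]]].
    have := Bs _ _ _ _ Byv (TB _ Tfg); have := defectP Dpsi Tfg.
    rewrite vE !(dotDl, dotDr, dotBl, dotBr, dotNl, dotNr, dotZl, dotZr) ?conjN !conj_i => -> <-.
    by ring.
  - apply/seteqP; split => [_ [p [? _ _] <-]//|phi Dphi].
    have : [set: H] ((2 * 'i%C) *: phi) by [].
    (* The inverse Cayley transform: phi - y with y = (B + i)^-1 (2 i phi). *)
    rewrite -(sa_ran hdot Bsa Im_Ni) => /ranP[y [v [Byv E]]].
    have vE : v = 'i%C *: phi + 'i%C *: (phi - y).
      by rewrite -[LHS](subrK (- 'i%C *: y)) -E; vring.
    exists (phi - y, phi) => //; split => //=; last by rewrite opprB addrC subrK -vE.
    move=> w /ranP[f [g [Tfg ->]]].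
    have := Bs _ _ _ _ Byv (TB _ Tfg); have := defectP Dphi Tfg.
    rewrite vE !(dotDl, dotDr, dotBl, dotBr, dotNl, dotNr, dotZl, dotZr) ?conjN !conj_i ?opprK => -> <-.
    by ring.
exists U => //; apply/esym; apply: (sa_maximal (qsa_self_adjoint UU) Bsa).
move=> _ [[f g] Tfg [[psi phi] [/= _ _ Bp] <-]] /=.
have := BL.2 1 _ _ _ _ (TB _ Tfg) Bp; rewrite !scale1r; congr (B (_, _)); vring.
Qed.
End closed_symmetric.
End von_Neumann.

Local Notation ReF f := (fun t => Re (f t)).
Local Notation ImF f := (fun t => Im (f t)).

(** * Integration of complex functions *)

Section complex_modulus.
Context (R : realType).
Implicit Types (x y : R[i]).

Definition cabs x : R := Re `|x|.

Lemma cabsE x : `|x| = (cabs x)%:C%C.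
Proof. by rewrite /cabs RRe_real// normr_real. Qed.

Lemma cabs_ge0 x : 0 <= cabs x.
Proof. by rewrite -lecR -cabsE normr_ge0. Qed.

Lemma cabsM x y : cabs (x * y) = cabs x * cabs y.
Proof. by apply: complexI; rewrite rmorphM/= -!cabsE normrM. Qed.

Lemma cabsD x y : cabs (x + y) <= cabs x + cabs y.
Proof. by rewrite -lecR rmorphD/= -!cabsE ler_normD. Qed.

Lemma cabsN x : cabs (- x) = cabs x.
Proof. by rewrite /cabs normrN. Qed.

Lemma cabs0 : cabs 0 = 0 :> R.
Proof. by rewrite /cabs normr0. Qed.

Lemma cabs_conj x : cabs x^* = cabs x.
Proof. by rewrite /cabs norm_conjC. Qed.

Lemma cabs_sqr x : cabs x ^+ 2 = Re x ^+ 2 + Im x ^+ 2.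
Proof. by apply: complexI; rewrite rmorphXn/= -cabsE add_Re2_Im2. Qed.

Lemma cabs_real (r : R) : cabs (r%:C)%C = `|r|.
Proof. by rewrite /cabs normc_def/= expr0n/= addr0 sqrtr_sqr. Qed.

Lemma Re_le_cabs x : `|Re x| <= cabs x.
Proof.
rewrite -(@ler_pXn2r _ 2)// ?nnegrE ?cabs_ge0//.
by rewrite real_normK ?num_real// cabs_sqr lerDl sqr_ge0.
Qed.

Lemma Im_le_cabs x : `|Im x| <= cabs x.
Proof.
rewrite -(@ler_pXn2r _ 2)// ?nnegrE ?cabs_ge0//.
by rewrite real_normK ?num_real// cabs_sqr lerDr sqr_ge0.
Qed.

Lemma cabs_le x : cabs x <= `|Re x| + `|Im x|.
Proof.
rewrite -(@ler_pXn2r _ 2)// ?nnegrE ?cabs_ge0// ?addr_ge0//.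
rewrite cabs_sqr sqrrD !real_normK ?num_real//.
by have := mulr_ge0 (normr_ge0 (Re x)) (normr_ge0 (Im x)); lra.
Qed.

Lemma ReM x y : Re (x * y) =
  Re x * Re y - Im x * Im y.
Proof. by case: x y => a b [c d]. Qed.

Lemma ImM x y : Im (x * y) =
  Re x * Im y + Im x * Re y.
Proof. by case: x y => a b [c d]. Qed.

Lemma ReD x y : Re (x + y) = Re x + Re y.
Proof. by case: x y => a b [c d]. Qed.
Lemma ImD x y : Im (x + y) = Im x + Im y.
Proof. by case: x y => a b [c d]. Qed.
Lemma ReN x : Re (- x) = - Re x.
Proof. by case: x. Qed.
Lemma ImN x : Im (- x) = - Im x.
Proof. by case: x. Qed.
Lemma ReJ x : Re x^* = Re x.
Proof. by case: x. Qed.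
Lemma ImJ x : Im x^* = - Im x.
Proof. by case: x. Qed.
Definition ReImE := (ReD, ImD, ReN, ImN, ReM, ImM, ReJ, ImJ).

Lemma complex_ext x y :
  Re x = Re y -> Im x = Im y -> x = y.
Proof. by case: x y => a b [c d] /= -> ->. Qed.
End complex_modulus.

Section complex_functions.
Context d (T : measurableType d) (R : realType).
Implicit Types (f g h : T -> R[i]) (c : R[i]).

Definition cmfun f := measurable_fun setT (ReF f) /\ measurable_fun setT (ImF f).

Lemma cmfun_cst c : cmfun (fun=> c).
Proof. by split; exact: measurable_cst. Qed.

Lemma cmfun_real (r : T -> R) : measurable_fun setT r -> cmfun (fun t => (r t)%:C%C).
Proof. by split => //=; exact: measurable_cst. Qed.

Lemma cmfunD f g : cmfun f -> cmfun g -> cmfun (fun t => f t + g t).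
Proof.
move=> [f1 f2] [g1 g2]; split.
  by under eq_fun do rewrite ReD; exact: measurable_funD.
by under eq_fun do rewrite ImD; exact: measurable_funD.
Qed.

Lemma cmfunM f g : cmfun f -> cmfun g -> cmfun (fun t => f t * g t).
Proof.
move=> [f1 f2] [g1 g2]; split.
  by under eq_fun do rewrite ReM; apply: measurable_funB; exact: measurable_funM.
by under eq_fun do rewrite ImM; apply: measurable_funD; exact: measurable_funM.
Qed.

Lemma cmfunJ f : cmfun f -> cmfun (fun t => (f t)^*).
Proof.
move=> [f1 f2]; split; first by under eq_fun do rewrite ReJ.
by under eq_fun do rewrite ImJ; exact: measurable_funN.
Qed.

Lemma cmfunN f : cmfun f -> cmfun (fun t => - f t).
Proof.
move=> [f1 f2]; split.
  by under eq_fun do rewrite ReN; exact: measurable_funN.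
by under eq_fun do rewrite ImN; exact: measurable_funN.
Qed.

Lemma cmfunB f g : cmfun f -> cmfun g -> cmfun (fun t => f t - g t).
Proof. by move=> mf mg; apply: cmfunD => //; exact: cmfunN. Qed.

Lemma cmfunX f n : cmfun f -> cmfun (fun t => f t ^+ n).
Proof.
move=> mf; elim: n => [|n IHn]; first exact: cmfun_cst.
by under eq_fun do rewrite exprS; exact: cmfunM.
Qed.

Lemma cmfun_sum I (r : seq I) (F : I -> T -> R[i]) :
  (forall i, cmfun (F i)) -> cmfun (fun t => \sum_(i <- r) F i t).
Proof.
move=> mF; elim: r => [|i r IHr].
  by under eq_fun do rewrite big_nil; exact: cmfun_cst.
by under eq_fun do rewrite big_cons; exact: cmfunD.
Qed.

Context (mu : {finite_measure set T -> \bar R}).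

Definition cinteg f := mu.-integrable setT (EFin \o (ReF f)) /\
  mu.-integrable setT (EFin \o (ImF f)).

Definition cint f : R[i] := Complex (\int[mu]_t Re (f t))
  (\int[mu]_t Im (f t)).

Lemma eq_cint f g : f =1 g -> cint f = cint g.
Proof. by move=> /funext ->. Qed.

Lemma cinteg_cmfun f : cinteg f -> cmfun f.
Proof. by case=> /measurable_int/measurable_EFinP f1 /measurable_int/measurable_EFinP. Qed.

Lemma rintegrableD (f g : T -> R) : mu.-integrable setT (EFin \o f) ->
  mu.-integrable setT (EFin \o g) -> mu.-integrable setT (EFin \o (fun t => f t + g t)).
Proof. by move=> fi gi; have := integrableD measurableT fi gi. Qed.

Lemma rintegrableZ (r : R) (f : T -> R) : mu.-integrable setT (EFin \o f) ->
  mu.-integrable setT (EFin \o (fun t => r * f t)).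
Proof. by move=> fi; have := integrableZl measurableT r fi. Qed.

Lemma cinteg_le (g : T -> R) f : cmfun f -> (forall t, cabs (f t) <= g t) ->
  mu.-integrable setT (EFin \o g) -> cinteg f.
Proof.
move=> [f1 f2] fg gi; split; apply: le_integrable gi => //.
- exact/measurable_EFinP.
- move=> t _ /=; rewrite lee_fin (le_trans (Re_le_cabs _))//.
  by rewrite (le_trans (fg t))// ler_norm.
- exact/measurable_EFinP.
- move=> t _ /=; rewrite lee_fin (le_trans (Im_le_cabs _))//.
  by rewrite (le_trans (fg t))// ler_norm.
Qed.

Lemma cinteg_bound f : cinteg f ->
  mu.-integrable setT (EFin \o (fun t => `|Re (f t)| + `|Im (f t)|)).
Proof.
move=> [f1 f2].
by apply: rintegrableD; exact: integrable_norm.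
Qed.

Lemma cinteg_dom f g : cmfun f -> cinteg g -> (forall t, cabs (f t) <= cabs (g t)) -> cinteg f.
Proof.
move=> mf gi fg; apply: cinteg_le (cinteg_bound gi) => // t.
exact: le_trans (fg t) (cabs_le _).
Qed.

Lemma cintegD f g : cinteg f -> cinteg g -> cinteg (fun t => f t + g t).
Proof.
move=> [f1 f2] [g1 g2]; split.
- by under eq_fun do rewrite ReD; exact: rintegrableD.
- by under eq_fun do rewrite ImD; exact: rintegrableD.
Qed.

Lemma cintD f g : cinteg f -> cinteg g -> cint (fun t => f t + g t) = cint f + cint g.
Proof.
move=> [f1 f2] [g1 g2]; apply: complex_ext; rewrite /cint ?ReD ?ImD/=.
- by rewrite -RintegralD//; apply: eq_Rintegral => t _; rewrite ReD.
- by rewrite -RintegralD//; apply: eq_Rintegral => t _; rewrite ImD.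
Qed.

Lemma cintegZ c f : cinteg f -> cinteg (fun t => c * f t).
Proof.
move=> fi; apply: (@cinteg_le (fun t => cabs c * (`|Re (f t)| + `|Im (f t)|))).
- by apply: cmfunM; [exact: cmfun_cst|exact: cinteg_cmfun].
- by move=> t; rewrite cabsM ler_wpM2l ?cabs_ge0// cabs_le.
- by apply: rintegrableZ; exact: cinteg_bound.
Qed.

Lemma cintZ c f : cinteg f -> cint (fun t => c * f t) = c * cint f.
Proof.
move=> [f1 f2]; have Z := rintegrableZ.
apply: complex_ext; rewrite /cint ?ReM ?ImM/= -!RintegralZl//.
- by rewrite -RintegralB//; [apply: eq_Rintegral => t _; rewrite ReM|exact: Z..].
- by rewrite -RintegralD//; [apply: eq_Rintegral => t _; rewrite ImM|exact: Z..].
Qed.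

Lemma cintegN f : cinteg f -> cinteg (fun t => - f t).
Proof. by move=> /(cintegZ (-1)); under eq_fun do rewrite mulN1r. Qed.

Lemma cintN f : cinteg f -> cint (fun t => - f t) = - cint f.
Proof. by move=> fi; rewrite -mulN1r -cintZ//; apply: eq_cint => t; rewrite mulN1r. Qed.

Lemma cintegB f g : cinteg f -> cinteg g -> cinteg (fun t => f t - g t).
Proof. by move=> fi gi; apply: cintegD => //; exact: cintegN. Qed.

Lemma cintB f g : cinteg f -> cinteg g -> cint (fun t => f t - g t) = cint f - cint g.
Proof. by move=> fi gi; rewrite -cintN// -cintD//; exact: cintegN. Qed.

Lemma cintegJ f : cinteg f -> cinteg (fun t => (f t)^*).
Proof.
move=> fi; apply: cinteg_dom (fi) _; first exact/cmfunJ/cinteg_cmfun.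
by move=> t; rewrite cabs_conj.
Qed.

Lemma cintJ f : cinteg f -> cint (fun t => (f t)^*) = (cint f)^*.
Proof.
move=> [f1 f2]; apply: complex_ext; rewrite ?ReJ ?ImJ/=.
  by apply: eq_Rintegral => t _; rewrite ReJ.
rewrite -mulN1r -RintegralZl//; apply: eq_Rintegral => t _.
by rewrite ImJ mulN1r.
Qed.

Lemma cinteg0 : cinteg (fun=> 0).
Proof. by split; exact: integrable0. Qed.

Lemma cint0 : cint (fun=> 0) = 0.
Proof. by apply: complex_ext => /=; rewrite Rintegral_cst// mul0r. Qed.

Lemma cinteg_sum I (r : seq I) (F : I -> T -> R[i]) :
  (forall i, cinteg (F i)) -> cinteg (fun t => \sum_(i <- r) F i t).
Proof.
move=> mF; elim: r => [|i r IHr].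
  by under eq_fun do rewrite big_nil; exact: cinteg0.
by under eq_fun do rewrite big_cons; exact: cintegD.
Qed.

Lemma cint_sum I (r : seq I) (F : I -> T -> R[i]) :
  (forall i, cinteg (F i)) -> cint (fun t => \sum_(i <- r) F i t) = \sum_(i <- r) cint (F i).
Proof.
move=> mF; elim: r => [|i r IHr].
  by under eq_fun do rewrite big_nil; rewrite cint0 big_nil.
under eq_fun do rewrite big_cons; rewrite cintD// ?IHr ?big_cons//.
exact: cinteg_sum.
Qed.

Lemma cintegM_bounded (C : R) f g : cmfun f -> (forall t, cabs (f t) <= C) ->
  cinteg g -> cinteg (fun t => f t * g t).
Proof.
move=> mf fC gi.
apply: (@cinteg_dom _ (fun t => C%:C%C * g t)).
- by apply: cmfunM => //; exact: cinteg_cmfun.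
- exact: cintegZ.
move=> t; rewrite !cabsM ler_wpM2r ?cabs_ge0//.
rewrite (le_trans (fC t))// /cabs normc_def/= expr0n addr0 sqrtr_sqr.
exact: ler_norm.
Qed.

Lemma ae_eq_cint f g : cmfun f -> cmfun g ->
  {ae mu, forall t, f t = g t} -> cint f = cint g.
Proof.
move=> [f1 f2] [g1 g2] fg; apply: complex_ext => /=; congr fine;
  apply: ae_eq_integral => //; try exact/measurable_EFinP.
- by apply: filterS fg => t /= -> .
- by apply: filterS fg => t /= -> .
Qed.

Lemma ae_eq_integrable (f g : T -> \bar R) : measurable_fun setT g ->
  ae_eq mu setT f g -> mu.-integrable setT f -> mu.-integrable setT g.
Proof.
move=> mg fg /integrableP[mf foo]; apply/integrableP; split => //.
rewrite -(@ae_eq_integral _ _ _ _ _ _ (abse \o f))//; try exact: measurableT_comp.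
by apply: filterS fg => t /= h /h ->.
Qed.

Lemma ae_eq_cinteg f g : cmfun g -> {ae mu, forall t, f t = g t} -> cinteg f -> cinteg g.
Proof.
move=> [g1 g2] fg [f1 f2]; split.
- apply: ae_eq_integrable f1; first exact/measurable_EFinP.
  by apply: filterS fg => t /= ->.
- apply: ae_eq_integrable f2; first exact/measurable_EFinP.
  by apply: filterS fg => t /= ->.
Qed.

End complex_functions.

(** * Measures, charges and complex measures with a density *)

Section density_of_measure.
Context d (T : measurableType d) (R : realType).
Context (mu sigma : {finite_measure set T -> \bar R}) (g : T -> R).
Hypothesis gi : sigma.-integrable setT (EFin \o g).
Hypothesis muE : forall A, measurable A -> mu A = (\int[sigma]_(t in A) (g t)%:E)%E.

Lemma density_dominates : mu `<< sigma.
Proof.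
apply/null_content_dominatesP => A mA A0; rewrite muE//.
apply: null_set_integral => //.
by apply: measurable_funTS; exact: measurable_int gi.
Qed.

Lemma density_RN : ae_eq sigma setT (Radon_Nikodym_SigmaFinite.f mu sigma) (EFin \o g).
Proof.
have RNi := Radon_Nikodym_SigmaFinite.f_integrable density_dominates.
apply: integral_ae_eq => //; first exact: measurable_int gi.
move=> E _ mE; rewrite -muE//.
by rewrite -(Radon_Nikodym_SigmaFinite.f_integral density_dominates).
Qed.

Lemma density_change (f : T -> \bar R) : (forall t, 0 <= f t)%E ->
  measurable_fun setT f ->
  (\int[mu]_t f t = \int[sigma]_t (f t * (g t)%:E))%E.
Proof.
move=> f0 mf; rewrite -(Radon_Nikodym_SigmaFinite.change_of_variables density_dominates)//.
have RNi := Radon_Nikodym_SigmaFinite.f_integrable density_dominates.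
apply: ae_eq_integral => //.
- by apply: emeasurable_funM => //; exact: measurable_int RNi.
- by apply: emeasurable_funM => //; exact: measurable_int gi.
by apply: filterS density_RN => t /= h /h ->.
Qed.

Lemma density_integrable (f : T -> R) : measurable_fun setT f ->
  mu.-integrable setT (EFin \o f) <-> sigma.-integrable setT (EFin \o (fun t => f t * g t)).
Proof.
move=> mf; have mfE : measurable_fun setT (EFin \o f) by exact/measurable_EFinP.
have mg : measurable_fun setT g by apply/measurable_EFinP; exact: measurable_int gi.
(* g agrees almost everywhere with the Radon-Nikodym derivative of a positive measure, hence is
   nonnegative there, so that |f| g = |f g|. *)
have g0 : ae_eq sigma setT (EFin \o g) (EFin \o (fun t => `|g t|)).
  apply: filterS density_RN => t /= /[swap] tT /(_ tT) h; congr EFin; rewrite ger0_norm//.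
  by rewrite -lee_fin -h Radon_Nikodym_SigmaFinite.f_ge0//; exact: density_dominates.
have E : (\int[mu]_t `|(EFin \o f) t| = \int[sigma]_t `|(f t * g t)%:E|)%E.
  rewrite density_change//; last exact: measurableT_comp.
  apply: ae_eq_integral => //.
  - by apply: emeasurable_funM => //; [exact: measurableT_comp|exact/measurable_EFinP].
  - by apply: measurableT_comp => //; apply/measurable_EFinP; exact: measurable_funM.
  - by apply: filterS g0 => t /= h /h [{1}->]; rewrite -EFinM normrM.
split=> /integrableP[_]; rewrite ?E -?E => foo; apply/integrableP; split; rewrite ?E -?E//.
by apply/measurable_EFinP; exact: measurable_funM.
Qed.

Lemma density_integral (f : T -> R) : mu.-integrable setT (EFin \o f) ->
  \int[mu]_t f t = \int[sigma]_t (f t * g t).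
Proof.
move=> fi; congr fine.
have mfE := measurable_int _ fi.
have mg : measurable_fun setT (EFin \o g) by exact: measurable_int gi.
rewrite -(Radon_Nikodym_change_of_variables density_dominates)//.
pose c := charge_of_finite_measure mu.
have RNi := @Radon_Nikodym_integrable _ _ _ c sigma density_dominates.
apply: ae_eq_integral => //.
- by apply: emeasurable_funM => //; exact: measurable_int RNi.
- by apply: (@emeasurable_funM _ _ _ _ (EFin \o f) (EFin \o g)).
have : ae_eq sigma setT (Radon_Nikodym c sigma) (EFin \o g).
  apply: integral_ae_eq => //.
  move=> E _ mE; rewrite -muE//.
  by rewrite -(@Radon_Nikodym_integral _ _ _ c sigma _ density_dominates).
by apply: filterS => t /= h /h ->.
Qed.
End density_of_measure.

Section density_of_charge.
Context (R : realType) (nu : {charge set R -> \bar R}).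
Context (sigma : {finite_measure set R -> \bar R}) (h : R -> R).
Hypothesis hi : sigma.-integrable setT (EFin \o h).
Hypothesis nuE : forall A, measurable A -> nu A = (\int[sigma]_(t in A) (h t)%:E)%E.

Let mh : measurable_fun setT h.
Proof. by apply/measurable_EFinP; exact: measurable_int hi. Qed.

Lemma integrable_indicM (f : R -> R) (P : set R) : measurable P ->
  sigma.-integrable setT (EFin \o f) ->
  sigma.-integrable setT (EFin \o (fun t => f t * \1_P t)).
Proof.
move=> mP fi; apply: (le_integrable _ _ _ fi) => //.
  apply/measurable_EFinP/measurable_funM; last exact: measurable_indic.
  by apply/measurable_EFinP; exact: measurable_int fi.
move=> t _ /=; rewrite lee_fin indicE normrM.
by case: (_ \in _); rewrite ?normr1 ?normr0 ?mulr1 ?mulr0// normr_ge0.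
Qed.

(** The same choice of Hahn decomposition as in [charge_pos] and [charge_neg], so that these unfold
    by conversion to restrictions of nu. *)
Let hahn := cid (svalP (cid (Hahn_decomposition nu))).
Let P := sval (cid (Hahn_decomposition nu)).
Let N := sval hahn.

(** On the Hahn sets P and N the Jordan parts have densities h 1_P and - h 1_N, whose difference is
    h. *)
Lemma charge_densities (f : R -> R) : measurable_fun setT f ->
  (charge_integrable nu f <-> sigma.-integrable setT (EFin \o (fun t => f t * h t))) /\
  (charge_integrable nu f -> charge_integral nu f = \int[sigma]_t (f t * h t)).
Proof.
move=> mf; have [[mP posP] [mN negN] PN PN0] := svalP hahn.
have posE A : measurable A -> charge_pos nu A = (\int[sigma]_(t in A) (h t * \1_P t)%:E)%E.
  move=> mA; change (crestr0 nu mP A = (\int[sigma]_(t in A) (h t * \1_P t)%:E)%E).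
  rewrite /crestr0 mem_set// /crestr.
  rewrite nuE; last exact: measurableI.
  rewrite integral_mkcondr; apply: eq_integral => t _.
  by rewrite patchE indicE; case: ifPn => //; rewrite ?mulr1 ?mulr0.
have negE A : measurable A -> charge_neg nu A = (\int[sigma]_(t in A) (- h t * \1_N t)%:E)%E.
  move=> mA; change (jordan_neg (svalP hahn) A = (\int[sigma]_(t in A) (- h t * \1_N t)%:E)%E).
  rewrite jordan_negE cjordan_negE /crestr0 mem_set// /crestr.
  rewrite nuE; last exact: measurableI.
  rewrite -integralN/=.
    rewrite integral_mkcondr; apply: eq_integral => t _.
    by rewrite patchE indicE; case: ifPn => //; rewrite ?mulr1 ?mulr0.
  apply: integrable_add_def => //; first exact: measurableI.
  by apply: integrableS hi => //; exact: measurableI.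
have Pi := integrable_indicM mP hi.
have Ni : sigma.-integrable setT (EFin \o (fun t => - h t * \1_N t)).
  apply: integrable_indicM => //.
  by under eq_fun do rewrite -mulN1r; exact: rintegrableZ.
have hPN t : h t = h t * \1_P t - (- h t * \1_N t).
  rewrite mulNr opprK -mulrDr !indicE.
  have : (P `|` N) t by rewrite PN.
  case=> [Pt|Nt].
    rewrite mem_set// memNset ?addr0 ?mulr1// => Nt.
    by have : (P `&` N) t by []; rewrite PN0.
  rewrite [t \in N]mem_set// memNset ?add0r ?mulr1// => Pt.
  by have : (P `&` N) t by []; rewrite PN0.
have ipos := density_integrable Pi posE mf.
have ineg := density_integrable Ni negE mf.
have fhE : (fun t => f t * h t) =
    (fun t => f t * (h t * \1_P t) - f t * (- h t * \1_N t)).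
  by apply/funext => t; rewrite {1}hPN mulrBr.
split.
  split=> [[/ipos fp /ineg fn]|fh].
    rewrite fhE; have := integrableB measurableT fp fn; exact.
  split.
    by apply/ipos; under eq_fun do rewrite mulrA; exact: integrable_indicM.
  apply/ineg; under eq_fun do rewrite mulrA mulrN; apply: integrable_indicM => //.
  by under eq_fun do rewrite -mulN1r; exact: rintegrableZ.
move=> [fp fn]; rewrite /charge_integral (density_integral Pi posE fp).
rewrite (density_integral Ni negE fn) -RintegralB//; [|exact/ipos|exact/ineg].
by apply: eq_Rintegral => t _; rewrite -mulrBr -hPN.
Qed.
End density_of_charge.

Section density_of_complex_measure.
Context (R : realType).
Implicit Types (nu : complex_measure R) (h f : R -> R[i]).

(** The representation nu = h sigma. It trades the four Jordan parts of nu for a single positive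
    measure. *)
Definition cdens nu (sigma : {finite_measure set R -> \bar R}) h := cinteg sigma h /\
  forall A, measurable A -> cmeas nu A = cint sigma (fun t => (\1_A t)%:C%C * h t).

Lemma cmfun_indic (A : set R) : measurable A -> cmfun (fun t => (\1_A t)%:C%C : R[i]).
Proof. by move=> mA; apply: cmfun_real; exact: measurable_indic. Qed.

Lemma cabs_indic (A : set R) t : cabs ((\1_A t)%:C%C : R[i]) <= 1.
Proof. by rewrite cabs_real indicE normr_nat; case: (_ \in _). Qed.

Lemma cinteg_indicM (sigma : {finite_measure set R -> \bar R}) (A : set R) h :
  measurable A -> cinteg sigma h -> cinteg sigma (fun t => (\1_A t)%:C%C * h t).
Proof.
move=> mA hi; apply: (@cintegM_bounded _ _ _ _ 1) => //; first exact: cmfun_indic.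
move=> t; rewrite indicE; case: (_ \in _); rewrite ?cabs0// /cabs normr1//=.
Qed.

Lemma cdens_parts nu sigma h : cdens nu sigma h ->
  (forall A, measurable A -> re_part nu A = (\int[sigma]_(t in A) (Re (h t))%:E)%E) /\
  (forall A, measurable A -> im_part nu A = (\int[sigma]_(t in A) (Im (h t))%:E)%E).
Proof.
move=> [hi nuE]; split => A mA; move: (nuE A mA) (cinteg_indicM mA hi) => [E1 E2] [i1 i2];
  (rewrite -[LHS]fineK ?E1 ?E2; last exact: fin_num_measure);
  (rewrite [in RHS]integral_mkcond /Rintegral fineK; last exact: integrable_fin_num);
  apply: eq_integral => t _; rewrite ?ReM ?ImM/= mul0r ?subr0 ?addr0 patchE indicE;
  by case: (_ \in _); rewrite ?mul1r ?mul0r.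
Qed.

Lemma cintegrable_dens nu sigma h f : cdens nu sigma h -> cmfun f ->
  (cintegrable nu f <-> cinteg sigma (fun t => f t * h t)) /\
  (cintegrable nu f -> cintegral nu f = cint sigma (fun t => f t * h t)).
Proof.
move=> nuh [f1 f2]; have [E1 E2] := cdens_parts nuh.
have [[h1 h2] _] := nuh; have [mh1 mh2] := cinteg_cmfun (conj h1 h2).
have [A1 B1] := charge_densities h1 E1 f1.
have [A2 B2] := charge_densities h1 E1 f2.
have [A3 B3] := charge_densities h2 E2 f1.
have [A4 B4] := charge_densities h2 E2 f2.
split; first split.
- move=> [/A1 i1 /A2 i2 /A3 i3 /A4 i4]; split.
  + under eq_fun do rewrite ReM; exact: (integrableB measurableT i1 i4).
  + under eq_fun do rewrite ImM; exact: (rintegrableD i3 i2).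
- move=> fhi; have fhb := cinteg_bound fhi.
  (* The real and imaginary parts of f h only contain sums of products of parts, but each single
     product is dominated by |f h| = |f| |h|. *)
  have le (r s : R -> R) : measurable_fun setT r -> measurable_fun setT s ->
      (forall t, `|r t| <= cabs (f t)) -> (forall t, `|s t| <= cabs (h t)) ->
      sigma.-integrable setT (EFin \o (fun t => r t * s t)).
    move=> mr ms rf sh; apply: (le_integrable _ _ _ fhb) => //.
      by apply/measurable_EFinP; exact: measurable_funM.
    move=> t _ /=; rewrite lee_fin normrM.
    apply: (@le_trans _ _ (cabs (f t * h t))); first by rewrite cabsM ler_pM.
    by rewrite (le_trans (cabs_le _))// ler_norm.
  split; [apply/A1|apply/A2|apply/A3|apply/A4]; apply: le => // t; exact: Re_le_cabs || exact: Im_le_cabs.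
- move=> [i1 i2 i3 i4]; rewrite /cintegral B1// B2// B3// B4//.
  move/A1 : i1 => i1; move/A2 : i2 => i2; move/A3 : i3 => i3; move/A4 : i4 => i4.
  apply: complex_ext => /=.
  + by rewrite -RintegralB//; apply: eq_Rintegral => t _; rewrite ReM.
  + by rewrite -RintegralD//; apply: eq_Rintegral => t _; rewrite ImM.
Qed.

End density_of_complex_measure.

(** * Complex measures are determined on half-lines *)

Section distribution_functions.
Context (R : realType).
Implicit Types (nu : complex_measure R) (h f : R -> R[i]).

Lemma charge_jordan (n : {charge set R -> \bar R}) (A : set R) : measurable A ->
  n A = (charge_pos n A - charge_neg n A)%E.
Proof.
by move=> mA; rewrite [LHS](jordan_decomp (svalP (cid (svalP (cid (Hahn_decomposition n))))) mA) /cadd/= cscaleN1.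
Qed.

(** Moving negative parts across, n1 = n2 becomes n1^+ + n2^- = n2^+ + n1^-, an equality of finite
    positive measures, to which uniqueness on the pi-system of open half-lines applies. *)
Lemma charge_eq_distr (n1 n2 : {charge set R -> \bar R}) :
  (forall t, n1 `]-oo, t[%classic = n2 `]-oo, t[%classic) ->
  forall A, measurable A -> n1 A = n2 A.
Proof.
move=> n12 A mA.
pose m1 := measure_add (charge_pos n1) (charge_neg n2).
pose m2 := measure_add (charge_pos n2) (charge_neg n1).
have e1 B : m1 B = (charge_pos n1 B + charge_neg n2 B)%E by exact: measure_addE.
have e2 B : m2 B = (charge_pos n2 B + charge_neg n1 B)%E by exact: measure_addE.
have key B : measurable B -> m1 B = m2 B <-> n1 B = n2 B.
  move=> mB; rewrite [m1 B]e1 [m2 B]e2 (charge_jordan n1 mB) (charge_jordan n2 mB).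
  have f1 : charge_pos n1 B \is a fin_num by exact: fin_num_measure.
  have f2 : charge_pos n2 B \is a fin_num by exact: fin_num_measure.
  have f3 : charge_neg n1 B \is a fin_num by exact: fin_num_measure.
  have f4 : charge_neg n2 B \is a fin_num by exact: fin_num_measure.
  rewrite -(fineK f1) -(fineK f2) -(fineK f3) -(fineK f4) -!EFinB -!EFinD.
  by split=> -[E]; congr EFin; lra.
apply/key => //.
apply: (@measure_unique _ R _ (@RGenInftyO.G R) (fun n => `]-oo, n%:R[%classic)) => //.
- exact: RGenInftyO.measurableE.
- move=> _ _ [x ->] [y ->]; exists (Num.min x y).
  by apply/seteqP; split=> t /=; rewrite !in_itv/= lt_min => /andP.
- by move=> i; exists i%:R.
- apply/seteqP; split => // t _; exists (Num.truncn `|t|).+1 => //=.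
  by rewrite in_itv/= (le_lt_trans (ler_norm _))// truncnS_gt.
- by move=> _ [x ->]; apply/key; [exact: measurable_itv|exact: n12].
- move=> k; rewrite [ltLHS]e1 lte_add_pinfty// ltey_eq.
    by rewrite fin_num_measure.
  by rewrite fin_num_measure.
Qed.

Lemma cmeas_eq_distr nu1 nu2 : cdistr nu1 =1 cdistr nu2 ->
  forall A, measurable A -> cmeas nu1 A = cmeas nu2 A.
Proof.
move=> E A mA.
have E1 t : re_part nu1 `]-oo, t[%classic = re_part nu2 `]-oo, t[%classic.
  have /= e := congr1 (@complex.Re _) (E t).
  by rewrite -[LHS]fineK ?e ?fineK//; exact: fin_num_measure.
have E2 t : im_part nu1 `]-oo, t[%classic = im_part nu2 `]-oo, t[%classic.
  have /= e := congr1 (@complex.Im _) (E t).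
  by rewrite -[LHS]fineK ?e ?fineK//; exact: fin_num_measure.
by rewrite /cmeas (charge_eq_distr E1 mA) (charge_eq_distr E2 mA).
Qed.

Definition complex_measure_of (sigma : {finite_measure set R -> \bar R}) h
    (hi : cinteg sigma h) : complex_measure R :=
  ComplexMeasure (induced_charge hi.1) (induced_charge hi.2).

Lemma cdens_measure_of (sigma : {finite_measure set R -> \bar R}) h
  (hi : cinteg sigma h) : cdens (complex_measure_of hi) sigma h.
Proof.
split => // A mA; apply: complex_ext => /=; congr fine; rewrite /induced_charge integral_mkcond;
  apply: eq_integral => t _; rewrite ?ReM ?ImM/= ?mul0r ?subr0 ?addr0 patchE indicE;
  by case: (_ \in _); rewrite ?mul1r ?mul0r.
Qed.

(** Spectral measures are known only through t |-> (E_t u, v); this turns such knowledge into a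
    density. *)
Lemma cdens_distr nu (sigma : {finite_measure set R -> \bar R}) h : cinteg sigma h ->
  (forall t, cdistr nu t = cint sigma (fun s => (\1_(`]-oo, t[%classic) s)%:C%C * h s)) ->
  cdens nu sigma h.
Proof.
move=> hi E; split => // A mA.
rewrite -(cdens_measure_of hi).2//; apply: cmeas_eq_distr => // t.
by rewrite E /cdistr (cdens_measure_of hi).2//; exact: measurable_itv.
Qed.

Lemma charge_dens (n : {charge set R -> \bar R}) (sigma : {finite_measure set R -> \bar R}) :
  n `<< sigma -> let h := fun t => fine (Radon_Nikodym n sigma t) in
  sigma.-integrable setT (EFin \o h) /\
  forall A, measurable A -> n A = (\int[sigma]_(t in A) (h t)%:E)%E.
Proof.
move=> ns h; have hE : EFin \o h = Radon_Nikodym n sigma.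
  by apply/funext => t /=; rewrite fineK// Radon_Nikodym_fin_num.
split; first by rewrite hE; exact: Radon_Nikodym_integrable.
move=> A mA; rewrite (Radon_Nikodym_integral ns mA).
by apply: eq_integral => t _; rewrite -hE.
Qed.

Lemma complex_dens nu (sigma : {finite_measure set R -> \bar R}) :
  re_part nu `<< sigma -> im_part nu `<< sigma ->
  cdens nu sigma (fun t => Complex (fine (Radon_Nikodym (re_part nu) sigma t))
    (fine (Radon_Nikodym (im_part nu) sigma t))).
Proof.
move=> n1 n2; have [i1 E1] := charge_dens n1; have [i2 E2] := charge_dens n2.
have hi := conj i1 i2 : cinteg sigma (fun t => Complex (fine (Radon_Nikodym (re_part nu) sigma t))
    (fine (Radon_Nikodym (im_part nu) sigma t))).
split => // A mA; rewrite -(cdens_measure_of hi).2// /cmeas; apply: complex_ext => /=.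
  by congr fine; exact: E1.
by congr fine; exact: E2.
Qed.

(** The sum of the four Jordan parts is finite and dominates nu. *)
Lemma cdens_ex nu : exists sigma h, cdens nu sigma h.
Proof.
pose m : {measure set R -> \bar R} := measure_add (measure_add (charge_pos (re_part nu)) (charge_neg (re_part nu)))
  (measure_add (charge_pos (im_part nu)) (charge_neg (im_part nu))).
have mE A : m A = (charge_pos (re_part nu) A + charge_neg (re_part nu) A +
   (charge_pos (im_part nu) A + charge_neg (im_part nu) A))%E.
  by etransitivity; [exact: measure_addE|congr (_ + _)%E; exact: measure_addE].
have mfin : fin_num_fun m.
  by move=> A mA; rewrite mE !fin_numD !fin_num_measure.
pose mf := Measure_isFinite.Build _ _ _ m mfin.
pose sigma : {finite_measure set R -> \bar R} := HB.pack (Measure.sort m) mf.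
have m0 A : measurable A -> m A = 0%E -> re_part nu A = 0%E /\ im_part nu A = 0%E.
  move=> mA /eqP; rewrite mE !padde_eq0// ?adde_ge0// => /andP[/andP[/eqP a /eqP b]].
  move=> /andP[/eqP c /eqP d].
  by rewrite !charge_jordan// a b c d oppe0 adde0.
exists sigma; eexists; apply: complex_dens; apply/null_content_dominatesP => A mA /m0[]//.
Qed.

End distribution_functions.

(** * The matrix density *)

Section hermitian_forms.
Context (R : realType) (N : nat).
Implicit Types (X : 'M[R[i]]_N) (u v w : 'rV[R[i]]_N) (a : R[i]).

Definition hform X u v : R[i] := (u *m X *m (map_mx Num.conj v)^T) 0 0.

Lemma hformE X u v : hform X u v = \sum_l (\sum_k u 0 k * X k l) * (v 0 l)^*.
Proof. by rewrite /hform mxE; apply: eq_bigr => l _; rewrite !mxE. Qed.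

Lemma hformE2 X u v : hform X u v = \sum_k \sum_l u 0 k * (v 0 l)^* * X k l.
Proof.
rewrite hformE exchange_big/=; apply: eq_bigr => l _.
by rewrite big_distrl/=; apply: eq_bigr => k _; rewrite mulrAC.
Qed.

Lemma hformDl X u v w : hform X (u + v) w = hform X u w + hform X v w.
Proof. by rewrite /hform !mulmxDl mxE. Qed.
Lemma hformZl X a u w : hform X (a *: u) w = a * hform X u w.
Proof. by rewrite /hform -!scalemxAl mxE. Qed.
Lemma hformDr X u v w : hform X w (u + v) = hform X w u + hform X w v.
Proof. by rewrite /hform map_mxD linearD/= mulmxDr mxE. Qed.
Lemma hformZr X a u w : hform X w (a *: u) = a^* * hform X w u.
Proof. by rewrite /hform map_mxZ linearZ/= -scalemxAr mxE. Qed.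
Lemma hformNl X u w : hform X (- u) w = - hform X u w.
Proof. by rewrite -scaleN1r hformZl mulN1r. Qed.
Lemma hformNr X u w : hform X w (- u) = - hform X w u.
Proof. by rewrite -scaleN1r hformZr rmorphN rmorph1 mulN1r. Qed.
Lemma hform0l X w : hform X 0 w = 0.
Proof. by rewrite -(scale0r 0) hformZl mul0r. Qed.

Lemma hform_delta X k l : hform X (delta_mx 0 k) (delta_mx 0 l) = X k l.
Proof.
rewrite /hform -rowE mxE (bigD1 l)//= [X in _ + X]big1 ?addr0; last first.
  by move=> j jl; rewrite !mxE eqxx (negbTE jl)/= conjC0 mulr0.
by rewrite !mxE !eqxx conjC1 mulr1.
Qed.

Lemma hform_herm X u v : X \is hermsymmx -> hform X v u = (hform X u v)^*.
Proof.
move=> /is_hermitianmxP; rewrite expr0 scale1r => XE.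
rewrite !hformE2 exchange_big/= rmorph_sum; apply: eq_bigr => l _.
rewrite rmorph_sum/=; apply: eq_bigr => k _; rewrite !rmorphM/= conjCK.
by rewrite {1}XE !mxE (mulrC (_ ^*)).
Qed.

(** Nonnegativity at u + a v, where a is the number of modulus 1 that turns both cross terms into -
    |hform X u v|. *)
Lemma psd_bound X u v : nonneg_hermitian X ->
  2 * cabs (hform X u v) <= Re (hform X u u) + Re (hform X v v).
Proof.
move=> [Xh Xp]; set b := hform X u v.
have pos w : 0 <= Re (hform X w w).
  by have := Xp w; rewrite lecE => /andP[].
have [b0|b0] := eqVneq b 0; first by rewrite b0 cabs0 mulr0 addr_ge0.
pose a := - (b / (cabs b)%:C%C).
have nb0 : (cabs b)%:C%C != 0 by rewrite -cabsE normr_eq0.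
have aa : a * a^* = 1.
  by rewrite -normCK /a normrN normrM normfV -cabsE normr_id mulfV ?expr1n// normr_eq0.
have ab : a^* * b = - (cabs b)%:C%C.
  rewrite /a rmorphN rmorphM/= fmorphV/= -cabsE conj_normC mulNr mulrAC [_^* * _]mulrC.
  by rewrite -normCK expr2 mulfK// normr_eq0.
have := Xp (u + a *: v); rewrite -/(hform X _ _) !(hformDl, hformDr, hformZl, hformZr) -/b.
rewrite (hform_herm u v Xh) -/b.
have -> : a * b^* = - (cabs b)%:C%C.
  have := congr1 Num.conj ab; rewrite rmorphM/= conjCK => ->.
  by rewrite rmorphN -cabsE/= conj_normC.
rewrite ab mulrA aa mul1r lecE => /andP[_]/=.
by rewrite !ReD !ReN/=; lra.
Qed.
(** Trace 1 reflects the normalization by the trace measure; together with nonnegativity it confines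
    the eigenvalues to [0, 1]. *)
Definition good X := nonneg_hermitian X /\ \sum_k X k k = 1.

Lemma good_qD X u v : good X -> Re (hform X (u + v) (u + v)) <=
  2 * Re (hform X u u) + 2 * Re (hform X v v).
Proof.
move=> [[_ Xp] _]; have := Xp (u - v); rewrite -/(hform _ _ _) lecE => /andP[_ /=].
rewrite !(hformDl, hformDr, hformNl, hformNr) !(ReD, ReN).
move: (Re (hform X u u)) (Re (hform X v v)) => a b.
move: (Re (hform X u v)) (Re (hform X v u)) => x y.
by lra.
Qed.

End hermitian_forms.

Section rational_vectors.
Context (R : realType) (N : nat).

Definition ratvec (w : 'rV[rat * rat]_N) : 'rV[R[i]]_N :=
  \row_k Complex (ratr (w 0 k).1) (ratr (w 0 k).2).

Lemma rat_seq (r : R) : exists s : nat -> rat, (ratr (s n) : R) @[n --> \oo] --> r.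
Proof.
have /choice[s sP] : forall n : nat, exists q : rat, ratr q \in `]r - n.+1%:R^-1, r + n.+1%:R^-1[.
  by move=> n; apply: rat_in_itvoo; rewrite ltrBlDr -addrA ltrDl addr_gt0// invr_gt0.
exists s; apply/cvgrPdist_lt => e e0.
have [n0 hn0] := @invS_small R e e0; exists n0 => // n /= n0n.
apply: lt_trans (hn0 n n0n); rewrite distrC.
by move: (sP n); rewrite in_itv/= => /andP[h1 h2]; rewrite ltr_distl h1 h2.
Qed.

(** The form is a polynomial in the real and imaginary parts of the coordinates, hence continuous,
    and rational vectors are dense. *)
Lemma psd_dense (X : 'M[R[i]]_N) :
  (forall w, 0 <= Re (hform X (ratvec w) (ratvec w))) ->
  forall v, 0 <= Re (hform X v v).
Proof.
move=> Xw v.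
have /choice[a aP] : forall k : 'I_N, exists s : nat -> rat,
    (ratr (s n) : R) @[n --> \oo] --> Re (v 0 k) by move=> k; exact: rat_seq.
have /choice[b bP] : forall k : 'I_N, exists s : nat -> rat,
    (ratr (s n) : R) @[n --> \oo] --> Im (v 0 k) by move=> k; exact: rat_seq.
pose w n : 'rV[rat * rat]_N := \row_k (a k n, b k n).
have cw : Re (hform X (ratvec (w n)) (ratvec (w n))) @[n --> \oo] -->
    Re (hform X v v).
  pose F (al be : 'I_N -> R) : R := \sum_k \sum_l ((al k * al l + be k * be l) * Re (X k l)
    - (be k * al l - al k * be l) * Im (X k l)).
  have FE u : Re (hform X u u) = F (fun k => Re (u 0 k)) (fun k => Im (u 0 k)).
    rewrite hformE2 /F raddf_sum/=; apply: eq_bigr => k _.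
    rewrite raddf_sum/=; apply: eq_bigr => l _.
    by rewrite !ReImE; lra.
  rewrite FE; under eq_fun do rewrite FE.
  rewrite /F; apply: cvg_big => [|k _]; first exact: add_continuous.
  apply: cvg_big => [|l _]; first exact: add_continuous.
  under eq_fun do rewrite /ratvec !mxE/=.
  by apply: cvgB; apply: cvgM; try exact: cvg_cst; [apply: cvgD|apply: cvgB]; exact: cvgM.
rewrite -(cvg_lim _ cw)//; apply: limr_ge; first exact: cvgP cw.
exact: nearW.
Qed.
End rational_vectors.

Section ae_from_integrals.
Context (R : realType) (mu : {finite_measure set R -> \bar R}).

(** Tested on the set where g < 0: a nonpositive function with nonnegative integral vanishes almost
    everywhere. *)
Lemma ae_ge0_integral (g : R -> R) : mu.-integrable setT (EFin \o g) ->
  (forall A, measurable A -> 0 <= \int[mu]_t (\1_A t * g t)) ->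
  {ae mu, forall t, 0 <= g t}.
Proof.
move=> gi gA; have mg : measurable_fun setT g.
  by apply/measurable_EFinP; exact: measurable_int gi.
pose E := [set t | g t < 0].
have mE : measurable E.
  rewrite (_ : E = setT `&` g @^-1` `]-oo, 0[%classic); first by apply: mg => //; exact: measurable_itv.
  by apply/seteqP; split=> t /=; rewrite in_itv/= // => -[].
pose f t := \1_E t * g t.
have f0 t : f t <= 0.
  rewrite /f indicE; case: (boolP (t \in E)) => [|_]; last by rewrite mul0r.
  by rewrite inE /E/= mul1r => /ltW.
have fi : mu.-integrable setT (EFin \o f).
  have -> : f = fun t => g t * \1_E t by apply/funext => t; rewrite /f mulrC.
  exact: integrable_indicM.
have : ae_eq mu setT (EFin \o f) (cst 0%E).
  apply/ae_eq_integral_abs => //; first exact: measurable_int fi.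
  apply/eqP; rewrite eq_le integral_ge0// andbT.
  have -> : (\int[mu]_(x in setT) `|(EFin \o f) x| = \int[mu]_(x in setT) - (f x)%:E)%E.
    by apply: eq_integral => t _ /=; rewrite ler0_norm.
  rewrite integralN/=; last by apply: integrable_add_def => //; exact: fi.
  have := gA E mE; rewrite /Rintegral -/f => h.
  by rewrite leeNl oppe0 -[leRHS]fineK ?lee_fin//; exact: integrable_fin_num fi.
apply: filterS => t /= /(_ I) [ft]; rewrite leNgt; apply/negP => gt.
by move: ft; rewrite /f indicE mem_set// mul1r => g0; rewrite g0 ltxx in gt.
Qed.

Lemma ae_eq0_cint (h : R -> R[i]) : cinteg mu h ->
  (forall A, measurable A -> cint mu (fun t => (\1_A t)%:C%C * h t) = 0) ->
  {ae mu, forall t, h t = 0}.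
Proof.
move=> [h1 h2] hA.
have z (g : R -> R) : mu.-integrable setT (EFin \o g) ->
    (forall A, measurable A -> \int[mu]_t (\1_A t * g t) = 0) -> {ae mu, forall t, g t = 0}.
  move=> gi gA.
  have p1 : {ae mu, forall t, 0 <= g t} by apply: ae_ge0_integral => // A mA; rewrite gA.
  have p2 : {ae mu, forall t, 0 <= - g t}.
    apply: ae_ge0_integral => [|A mA].
      by under eq_fun do rewrite -mulN1r; exact: rintegrableZ.
    under eq_Rintegral do rewrite mulrN -mulN1r.
    rewrite RintegralZl// ?gA ?mulr0//.
    have -> : (fun t => \1_A t * g t) = fun t => g t * \1_A t.
      by apply/funext => t; rewrite mulrC.
    exact: integrable_indicM.
  by apply: filterS2 p1 p2 => t /= a b; apply/eqP; rewrite eq_le a -oppr_ge0 b.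
have z1 : {ae mu, forall t, Re (h t) = 0}.
  apply: z => // A mA; have := congr1 (@complex.Re R) (hA A mA); rewrite /= => e; rewrite -[RHS]e.
  by apply: eq_Rintegral => t _; rewrite ReM/= mul0r subr0.
have z2 : {ae mu, forall t, Im (h t) = 0}.
  apply: z => // A mA; have := congr1 (@complex.Im R) (hA A mA); rewrite /= => e; rewrite -[RHS]e.
  by apply: eq_Rintegral => t _; rewrite ImM/= mul0r addr0.
by apply: filterS2 z1 z2 => t a b; exact: complex_ext.
Qed.

Lemma ae_eq_cint_indic (h1 h2 : R -> R[i]) : cinteg mu h1 -> cinteg mu h2 ->
  (forall A, measurable A -> cint mu (fun t => (\1_A t)%:C%C * h1 t) =
    cint mu (fun t => (\1_A t)%:C%C * h2 t)) ->
  {ae mu, forall t, h1 t = h2 t}.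
Proof.
move=> i1 i2 h12; have : {ae mu, forall t, h1 t - h2 t = 0}.
  apply: ae_eq0_cint => [|A mA]; first exact: cintegB.
  under eq_cint do rewrite mulrBr.
  by rewrite cintB ?h12 ?subrr//; exact: cinteg_indicM.
by apply: filterS => t /eqP; rewrite subr_eq0 => /eqP.
Qed.
End ae_from_integrals.

Section good_density.
Context (R : realType) (N : nat) (M : matrix_measure R N).

Let X A := (\matrix_(k, l) cmeas (M k l) A : 'M[R[i]]_N).

Lemma tau_sum A : measurable A -> tau M A = (\sum_(k < N) re_part (M k k) A)%E.
Proof. by move=> mA; rewrite /tau asboolT. Qed.

(** The diagonal entries of M(A) are nonnegative and vanish with their sum; [psd_bound] on basis
    vectors then bounds the off-diagonal ones. This is the absolute continuity behind
    [cdens_density]. *)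
Lemma tau0_cmeas A k l : measurable A -> tau M A = 0%E -> cmeas (M k l) A = 0.
Proof.
move=> mA; rewrite tau_sum// => /eqP.
rewrite seq_psume_eq0 => [|j _]; last exact: re_part_diag_ge0.
move=> /allP h; have z j : Re (X A j j) = 0.
  by rewrite mxE/= (eqP (h j _)) ?mem_index_enum.
have := psd_bound (delta_mx 0 k) (delta_mx 0 l) (mm_nonneg M mA).
rewrite !hform_delta !z addr0 mxE => c0.
apply/eqP; rewrite -normr_eq0 cabsE; apply/eqP; congr (_%:C)%C.
by apply/eqP; rewrite eq_le cabs_ge0 andbT; lra.
Qed.

Lemma cdens_density k l : cdens (M k l) (tau M) (fun t => density M t k l).
Proof.
rewrite (_ : (fun t => _) = fun t => Complex (fine (Radon_Nikodym (re_part (M k l)) (tau M) t))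
    (fine (Radon_Nikodym (im_part (M k l)) (tau M) t))); last first.
  by apply/funext => t; rewrite mxE.
apply: complex_dens; apply/null_content_dominatesP => A mA /(tau0_cmeas k l mA) [].
  by move=> e _; rewrite -[LHS]fineK ?e//; exact: fin_num_measure.
by move=> _ e; rewrite -[LHS]fineK ?e//; exact: fin_num_measure.
Qed.

Lemma cmeas_hform A u v : measurable A ->
  cinteg (tau M) (fun t => hform (density M t) u v) /\
  cint (tau M) (fun t => (\1_A t)%:C%C * hform (density M t) u v) = hform (X A) u v.
Proof.
move=> mA.
have di k l := (cdens_density k l).1.
split; first by under eq_fun do rewrite hformE2; do 2 (apply: cinteg_sum => ?); exact: cintegZ.
under eq_cint do rewrite hformE2 mulr_sumr.
rewrite cint_sum; last first.
  move=> k; apply: cinteg_indicM => //; apply: cinteg_sum => l; exact: cintegZ.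
rewrite hformE2; apply: eq_bigr => k _.
under eq_cint do rewrite mulr_sumr.
rewrite cint_sum; last by move=> l; apply: cinteg_indicM => //; exact: cintegZ.
apply: eq_bigr => l _; under eq_cint do rewrite mulrCA.
by rewrite cintZ ?mxE -?(cdens_density k l).2//; exact: cinteg_indicM.
Qed.

Lemma cint_indic_cst A : measurable A -> cint (tau M) (fun t => (\1_A t)%:C%C * 1) = (fine (tau M A))%:C%C.
Proof.
move=> mA; apply: complex_ext => /=.
  under eq_Rintegral do rewrite mulr0 subr0 mulr1.
  by rewrite /Rintegral integral_indic// setIT.
by under eq_Rintegral do rewrite mulr0 mul0r addr0; rewrite Rintegral_cst// mul0r.
Qed.

(** Each property is transferred from the matrices M(A), which are integrals of the density over A:
    symmetry and nonnegativity from those of M(A), trace 1 from tau(A) being the trace of M(A). *)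
Lemma ae_good : {ae tau M, forall t, good (density M t)}.
Proof.
have herm : {ae tau M, forall t, forall k l, density M t l k = (density M t k l)^*}.
  apply: filter_forall => k; apply: filter_forall => l.
  apply: ae_eq_cint_indic => [||A mA]; first exact: (cdens_density l k).1.
    by apply: cintegJ; exact: (cdens_density k l).1.
  rewrite -(cdens_density l k).2//.
  have -> : (fun t => (\1_A t)%:C%C * (density M t k l)^*) = (fun t => ((\1_A t)%:C%C * density M t k l)^*).
    by apply/funext => t; rewrite conjM conj_real.
  rewrite cintJ; last by apply: cinteg_indicM => //; exact: (cdens_density k l).1.
  rewrite -(cdens_density k l).2//.
  have [/is_hermitianmxP + _] := mm_nonneg M mA; rewrite expr0 scale1r => /matrixP/(_ l k).
  by rewrite !mxE.
(* Rational vectors suffice, so that countably many null sets are discarded. *)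
have psd : {ae tau M, forall t, forall w, 0 <= Re (hform (density M t) (ratvec R w) (ratvec R w))}.
  have : {ae tau M, forall t, forall n : nat, forall w, unpickle n = Some w ->
     0 <= Re (hform (density M t) (ratvec R w) (ratvec R w))}.
    apply: ae_foralln => n; case: (unpickle n) => [w|]; last exact: filterE.
    have [[i1 _] _] := cmeas_hform (ratvec R w) (ratvec R w) measurableT.
    have h : {ae tau M, forall t, 0 <= Re (hform (density M t) (ratvec R w) (ratvec R w))}.
      apply: ae_ge0_integral => // A mA.
      have [_ /(congr1 (@complex.Re R))/= E] := cmeas_hform (ratvec R w) (ratvec R w) mA.
      have [_ /(_ (ratvec R w))] := mm_nonneg M mA; rewrite lecE => /andP[_ /=].
      rewrite -/(hform _ _ _) -E; congr (0 <= _); apply: eq_Rintegral => t _.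
      by rewrite ReM/= mul0r subr0.
    by apply: filterS h => t ht w' [<-].
  by apply: filterS => t h w; apply: (h (pickle w)); rewrite pickleK.
have tr : {ae tau M, forall t, \sum_k density M t k k = 1}.
  have i1 : cinteg (tau M) (fun t => \sum_k density M t k k).
    by apply: cinteg_sum => k; exact: (cdens_density k k).1.
  have i2 : cinteg (tau M) (fun=> 1).
    by split; exact: finite_measure_integrable_cst.
  apply: ae_eq_cint_indic => // A mA; rewrite cint_indic_cst//.
  under eq_cint do rewrite mulr_sumr.
  rewrite cint_sum; last by move=> k; apply: cinteg_indicM => //; exact: (cdens_density k k).1.
  under eq_bigr do rewrite -(cdens_density _ _).2//.
  have E k : cmeas (M k k) A = (fine (re_part (M k k) A))%:C%C.
    have [_ /(_ (delta_mx 0 k))] := mm_nonneg M mA.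
    rewrite -/(hform _ _ _) hform_delta mxE lecE /= => /andP[/eqP e _].
    by apply: complex_ext.
  under eq_bigr do rewrite E.
  rewrite -rmorph_sum/= sum_fine; last by move=> k _; exact: fin_num_measure.
  by rewrite tau_sum.
apply: filterS3 herm psd tr => t hh /psd_dense pp tt; split => //.
have hm : density M t \is hermsymmx.
  apply/is_hermitianmxP; rewrite expr0 scale1r; apply/matrixP => k l.
  by rewrite [RHS]mxE [in RHS]mxE hh.
split => //.
move=> v; rewrite -/(hform _ _ _) lecE pp andbT.
have /(congr1 (@complex.Im R)) := hform_herm v v hm; rewrite ImJ => e.
by apply/eqP; move: e => /=; lra.
Qed.

(** On a measurable null set containing the bad points the density is replaced by the projection on
    one basis vector. A matrix of trace 1 exists only for N > 0. *)
Lemma good_density (hN : (0 < N)%N) : exists D : R -> 'M[R[i]]_N,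
  [/\ forall k l, cmfun (fun t => D t k l), forall t, good (D t) &
    {ae tau M, forall t, density M t = D t}].
Proof.
have [N0 [mN0 N00 sub]] := ae_good.
pose k0 := Ordinal hN; pose E : 'M[R[i]]_N := delta_mx k0 k0.
have gE : good E.
  have h u v : hform E u v = u 0 k0 * (v 0 k0)^*.
    rewrite hformE (bigD1 k0)//= [X in _ + X]big1 ?addr0; last first.
      by move=> j jk; rewrite big1 ?mul0r// => i _; rewrite mxE (negbTE jk) andbF mulr0.
    rewrite (bigD1 k0)//= [X in _ + X]big1 ?addr0 ?mxE ?eqxx ?mulr1//.
    by move=> j jk; rewrite mxE (negbTE jk) mulr0.
  split; last first.
    rewrite (bigD1 k0)//= big1 ?addr0 ?mxE ?eqxx// => j jk.
    by rewrite mxE (negbTE jk).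
  split; last by move=> v; rewrite -/(hform _ _ _) h mul_conjC_ge0.
  apply/is_hermitianmxP; rewrite expr0 scale1r; apply/matrixP => k l; rewrite !mxE.
  by rewrite andbC; case: (_ && _); rewrite ?conjC1 ?conjC0.
exists (fun t => if t \in N0 then E else density M t); split.
- move=> k l.
  have -> : (fun t => (if t \in N0 then E else density M t) k l) =
     (fun t => (\1_N0 t)%:C%C * E k l + (\1_(~` N0) t)%:C%C * density M t k l).
    apply/funext => t; rewrite !indicE in_setC; case: (t \in N0) => /=.
      by rewrite mul1r mul0r addr0.
    by rewrite mul0r mul1r add0r.
  apply: cmfunD; apply: cmfunM.
  + exact: cmfun_indic.
  + exact: cmfun_cst.
  + by apply: cmfun_indic; exact: measurableC.
  + by apply: cinteg_cmfun; exact: (cdens_density k l).1.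
- move=> t; case: ifPn => // tN; have := @sub t; rewrite /= => h.
  by apply: contrapT => /h /mem_set; rewrite (negbTE tN).
- exists N0; split => // t /=; apply: contra_notP => tN.
  by rewrite memNset.
Qed.
End good_density.

(** * The space L^2(M) *)

Record regular_density (R : realType) (N : nat) (M : matrix_measure R N) := RegularDensity {
  rdens :> R -> 'M[R[i]]_N ;
  rdens_cmfun : forall k l, cmfun (fun t => rdens t k l) ;
  rdens_good : forall t, good (rdens t) ;
  rdens_ae : {ae tau M, forall t, density M t = rdens t} }.

Section L2_space.
Context (R : realType) (N : nat) (M : matrix_measure R N) (D : regular_density M).
Let mD := rdens_cmfun D.
Let gD := rdens_good D.
Let aD := rdens_ae D.
Implicit Types (f g h : R -> 'rV[R[i]]_N) (c : R -> R[i]).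

Definition vmfun f := forall k, cmfun (fun t => f t 0 k).

Fact ip_sig f g : {z | z = cint (tau M) (fun t => hform (D t) (f t) (g t))}.
Proof. by eexists. Qed.
(* Sealed, so that failing conversion tests do not unfold integrals. *)
Definition ip f g : R[i] := sval (ip_sig f g).
Lemma ipE f g : ip f g = cint (tau M) (fun t => hform (D t) (f t) (g t)).
Proof. exact: svalP (ip_sig f g). Qed.

Fact nsq_sig f : {z | z = Re (ip f f)}. Proof. by eexists. Qed.
Definition nsq f : R := sval (nsq_sig f).
Lemma nsqE f : nsq f = Re (ip f f).
Proof. exact: svalP (nsq_sig f). Qed.

Fact n2_sig f : {z | z = Num.sqrt (nsq f)}. Proof. by eexists. Qed.
Definition n2 f : R := sval (n2_sig f).
Lemma n2E f : n2 f = Num.sqrt (nsq f).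
Proof. exact: svalP (n2_sig f). Qed.

Record sqint f : Prop := SqInt {
  sqint_vmfun : vmfun f ;
  sqint_cinteg : cinteg (tau M) (fun t => hform (D t) (f t) (f t)) }.

Lemma cmfun_hform (F : R -> 'M[R[i]]_N) f g : (forall k l, cmfun (fun t => F t k l)) ->
  vmfun f -> vmfun g -> cmfun (fun t => hform (F t) (f t) (g t)).
Proof.
move=> mF mf mg; under eq_fun do rewrite hformE2.
apply: cmfun_sum => k; apply: cmfun_sum => l; apply: cmfunM; last exact: mF.
by apply: cmfunM; [exact: mf|apply: cmfunJ; exact: mg].
Qed.

Lemma q_ge0 t u : 0 <= Re (hform (D t) u u).
Proof. by have [[_ /(_ u) +] _] := gD t; rewrite lecE => /andP[]. Qed.

Lemma q_real t u : hform (D t) u u = (Re (hform (D t) u u))%:C%C.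
Proof.
have [[_ /(_ u) +] _] := gD t; rewrite lecE -/(hform _ _ _) => /andP[/eqP e _].
by apply: complex_ext.
Qed.

Lemma q_bound t u v : 2 * cabs (hform (D t) u v) <=
  Re (hform (D t) u u) + Re (hform (D t) v v).
Proof. by apply: psd_bound; case: (gD t). Qed.

Lemma q_conj t u v : hform (D t) v u = (hform (D t) u v)^*.
Proof. by apply: hform_herm; case: (gD t) => -[]. Qed.

Lemma L2_sqnormE f : vmfun f ->
  L2_sqnorm M f = (\int[tau M]_t (Re (hform (D t) (f t) (f t)))%:E)%E.
Proof.
move=> mf; rewrite /L2_sqnorm; apply: ae_eq_integral => //.
- apply/measurable_EFinP.
  have dm k l : cmfun (fun t => density M t k l) by apply: cinteg_cmfun; exact: (cdens_density M k l).1.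
  by have [] := cmfun_hform dm mf mf.
- by apply/measurable_EFinP; have [] := cmfun_hform mD mf mf.
- by apply: filterS aD => t /= -> .
Qed.

Lemma L2P f : L2 M f <-> sqint f.
Proof.
have q0 t : Im (hform (D t) (f t) (f t)) = 0 by rewrite q_real.
split=> [[mf]|[mf [i1 i2]]]; last first.
  split => //; rewrite L2_sqnormE//.
  by have /integrableP[_] := i1; under eq_integral do rewrite gee0_abs ?lee_fin ?q_ge0//.
rewrite L2_sqnormE// => foo; split => //; split.
  apply/integrableP; split; first by apply/measurable_EFinP; have [] := cmfun_hform mD mf mf.
  by under eq_integral do rewrite gee0_abs ?lee_fin ?q_ge0//.
by under eq_fun do rewrite q0; exact: integrable0.
Qed.

Lemma L2_sqnorm_nsq f : sqint f -> L2_sqnorm M f = (nsq f)%:E.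
Proof.
move=> [mf [i1 _]]; rewrite L2_sqnormE// nsqE ipE/= /Rintegral fineK//.
exact: integrable_fin_num i1.
Qed.

Lemma nsq_ge0 f : 0 <= nsq f.
Proof. by rewrite nsqE ipE/=; apply: Rintegral_ge0 => t _; exact: q_ge0. Qed.

Lemma vmfunD f g : vmfun f -> vmfun g -> vmfun (f \+ g).
Proof. by move=> mf mg k; under eq_fun do rewrite mxE; exact: cmfunD. Qed.

Lemma vmfunM c f : cmfun c -> vmfun f -> vmfun (fun t => c t *: f t).
Proof. by move=> mc mf k; under eq_fun do rewrite mxE; exact: cmfunM. Qed.

Lemma sqintD f g : sqint f -> sqint g -> sqint (f \+ g).
Proof.
move=> [mf fi] [mg gi];  split; first exact: vmfunD.
have [i1 _] := cintegD (cintegZ 2 fi) (cintegZ 2 gi).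
apply: cinteg_le (i1); first by apply: cmfun_hform => //; exact: vmfunD.
move=> t; rewrite [X in cabs X]q_real /cabs normc_def/= expr0n/= addr0 sqrtr_sqr ger0_norm ?q_ge0//.
apply: le_trans (good_qD _ _ (gD t)) _.
by rewrite ReD !mulr_natl !raddfMn/=.
Qed.

Lemma sqintM (C : R) c f : cmfun c -> (forall t, cabs (c t) <= C) -> sqint f ->
  sqint (fun t => c t *: f t).
Proof.
move=> mc cC [mf fi];  split; first exact: vmfunM.
under eq_fun do rewrite hformZl hformZr mulrA.
apply: (@cintegM_bounded _ _ _ _ (C * C)) => //; first by apply: cmfunM => //; exact: cmfunJ.
by move=> t; rewrite cabsM cabs_conj ler_pM ?cabs_ge0.
Qed.

Lemma sqintZ a f : sqint f -> sqint (fun t => a *: f t).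
Proof. by move=> fL; apply: (@sqintM (cabs a) (fun=> a)) => //; exact: cmfun_cst. Qed.

Lemma sqintN f : sqint f -> sqint (\- f).
Proof.
by move=> /(sqintZ (-1)); rewrite (_ : (fun t => _) = \- f)//; apply/funext => t; rewrite scaleN1r.
Qed.

Lemma sqintB f g : sqint f -> sqint g -> sqint (f \- g).
Proof. by move=> fL gL; exact: (sqintD fL (sqintN gL)). Qed.

Lemma ip_cinteg f g : sqint f -> sqint g -> cinteg (tau M) (fun t => hform (D t) (f t) (g t)).
Proof.
move=> [mf fi] [mg gi].
have [i1 _] := cintegD fi gi.
apply: cinteg_le (i1); first exact: cmfun_hform.
move=> t; have := q_bound t (f t) (g t); have := cabs_ge0 (hform (D t) (f t) (g t)).
by rewrite ReD; lra.
Qed.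

Lemma ipDl f g h : sqint f -> sqint g -> sqint h -> ip (f \+ g) h = ip f h + ip g h.
Proof.
move=> fL gL hL; rewrite !ipE -cintD; [|exact: ip_cinteg..].
by apply: eq_cint => t; rewrite hformDl.
Qed.

Lemma ipZl a f h : sqint f -> sqint h -> ip (fun t => a *: f t) h = a * ip f h.
Proof.
move=> fL hL; rewrite !ipE -cintZ; last exact: ip_cinteg.
by apply: eq_cint => t; rewrite hformZl.
Qed.

Lemma ipC f h : sqint f -> sqint h -> ip f h = (ip h f)^*.
Proof.
move=> fL hL; rewrite !ipE -cintJ; last exact: ip_cinteg.
by apply: eq_cint => t; rewrite q_conj.
Qed.

Lemma ip_real f : ip f f = (nsq f)%:C%C.
Proof.
apply: complex_ext; first by rewrite nsqE.
by rewrite ipE/=; under eq_Rintegral do rewrite q_real/=; rewrite Rintegral_cst// mul0r.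
Qed.

Lemma ipNl f h : sqint f -> sqint h -> ip (\- f) h = - ip f h.
Proof.
move=> fL hL; have -> : \- f = fun t => (-1) *: f t.
  by apply/funext => t; rewrite scaleN1r.
by rewrite (ipZl _ fL hL) mulN1r.
Qed.

Lemma ipBl f g h : sqint f -> sqint g -> sqint h -> ip (f \- g) h = ip f h - ip g h.
Proof. by move=> fL gL hL; rewrite -(ipNl gL hL); exact: (ipDl fL (sqintN gL) hL). Qed.

Lemma ipDr f g h : sqint f -> sqint g -> sqint h -> ip h (f \+ g) = ip h f + ip h g.
Proof.
move=> fL gL hL.
rewrite (ipC hL (sqintD fL gL)) (ipDl fL gL hL) conjD.
by congr (_ + _); symmetry; [exact: (ipC hL fL)|exact: (ipC hL gL)].
Qed.

Lemma ipZr a f h : sqint f -> sqint h -> ip h (fun t => a *: f t) = a^* * ip h f.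
Proof.
move=> fL hL.
rewrite (ipC hL (sqintZ a fL)) (ipZl a fL hL) conjM.
by congr (_ * _); symmetry; exact: (ipC hL fL).
Qed.

Lemma ipBr f g h : sqint f -> sqint g -> sqint h -> ip h (f \- g) = ip h f - ip h g.
Proof.
move=> fL gL hL.
rewrite (ipC hL (sqintB fL gL)) (ipBl fL gL hL) conjD conjN.
by congr (_ - _); symmetry; [exact: (ipC hL fL)|exact: (ipC hL gL)].
Qed.

Lemma nsqZ a f : sqint f -> nsq (fun t => a *: f t) = cabs a ^+ 2 * nsq f.
Proof.
move=> fL; apply: complexI; rewrite -ip_real (ipZl _ fL (sqintZ a fL)) (ipZr _ fL fL).
by rewrite mulrA ip_real rmorphM rmorphXn/= -cabsE -normCK.
Qed.

Lemma nsqD f g : sqint f -> sqint g -> nsq (f \+ g) = nsq f + nsq g + 2 * Re (ip f g).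
Proof.
move=> fL gL; rewrite !nsqE (ipDl fL gL (sqintD fL gL)).
rewrite (ipDr fL gL fL) (ipDr fL gL gL) (ipC gL fL).
move: (ip f f) (ip f g) (ip g g) => [a a'] [b b'] [c c'] /=.
by ring.
Qed.

Lemma nsqB f g : sqint f -> sqint g ->
  nsq (f \- g) = nsq f + nsq g - 2 * Re (ip f g).
Proof.
move=> fL gL; rewrite !nsqE (ipBl fL gL (sqintB fL gL)).
rewrite (ipBr fL gL fL) (ipBr fL gL gL) (ipC gL fL).
move: (ip f f) (ip f g) (ip g g) => [a a'] [b b'] [c c'] /=.
by ring.
Qed.

Lemma n2_sqr f : n2 f ^+ 2 = nsq f.
Proof. by rewrite n2E sqr_sqrtr// nsq_ge0. Qed.

Lemma n2_ge0 f : 0 <= n2 f.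
Proof. by rewrite n2E sqrtr_ge0. Qed.

Lemma n2Z a f : sqint f -> n2 (fun t => a *: f t) = cabs a * n2 f.
Proof. by move=> fL; rewrite !n2E (nsqZ a fL) sqrtrM ?exprn_ge0 ?cabs_ge0// sqrtr_sqr ger0_norm// cabs_ge0. Qed.

(** Expanding the squared norm of r f - s g gives [key]; r = |g| and s = |f| conclude when both
    norms are nonzero. Functions of norm 0 need not vanish, which is why the other cases are
    separate. *)
Lemma Re_ip_le f g : sqint f -> sqint g -> Re (ip f g) <= n2 f * n2 g.
Proof.
move=> fL gL.
have key (r s : R) : 2 * (r * (s * Re (ip f g))) <= r ^+ 2 * nsq f + s ^+ 2 * nsq g.
  have := nsq_ge0 ((fun t => r%:C%C *: f t) \- (fun t => s%:C%C *: g t)).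
  have fr := sqintZ r%:C%C fL; have gs := sqintZ s%:C%C gL.
  rewrite (nsqB fr gs) (nsqZ _ fL) (nsqZ _ gL) !cabs_real !real_normK ?num_real//.
  rewrite (ipZl _ fL gs) (ipZr _ gL fL) conj_real !ReM/= !mul0r !subr0.
  by move: (nsq f) (nsq g) (Re _) => a b c; lra.
move: key (n2_ge0 f) (n2_ge0 g); rewrite -(n2_sqr f) -(n2_sqr g).
move: (n2 f) (n2 g) (Re _) => x y c key x0 y0.
have inv (a : R) : 0 < c -> (a ^+ 2 + 1) / c * c = a ^+ 2 + 1.
  by move=> c0; rewrite divfK// gt_eqF.
have [x00|xn0] := eqVneq x 0.
  (* If |f| = 0 and c > 0, [key] reads 2 r c <= y^2 for every r, and r = (y^2 + 1) / c violates
     it. *)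
  rewrite x00 mul0r leNgt; apply/negP => c0.
  have := key ((y ^+ 2 + 1) / c) 1; rewrite mul1r inv// x00 expr0n mulr0 add0r expr1n mul1r.
  by have := sqr_ge0 y; move: (y ^+ 2) => b; lra.
have [y00|yn0] := eqVneq y 0.
  rewrite y00 mulr0 leNgt; apply/negP => c0.
  have := key 1 ((x ^+ 2 + 1) / c); rewrite mul1r inv// y00 expr0n mulr0 addr0 expr1n mul1r.
  by have := sqr_ge0 x; move: (x ^+ 2) => b; lra.
have xy : 0 < x * y by rewrite mulr_gt0// lt_def ?xn0 ?yn0.
have := key y x; rewrite (_ : 2 * _ = 2 * (x * y * c)); last by ring.
rewrite (_ : _ + _ = 2 * (x * y * (x * y))); last by ring.
by rewrite !ler_pM2l.
Qed.

Lemma n2D f g : sqint f -> sqint g -> n2 (f \+ g) <= n2 f + n2 g.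
Proof.
move=> fL gL; rewrite -(@ler_pXn2r _ 2)// ?nnegrE ?addr_ge0 ?n2_ge0//.
have eqW (a b : R) : a = b -> a <= b by move=> ->.
apply: le_trans (eqW _ _ (etrans (n2_sqr _) (nsqD fL gL))) _.
have := Re_ip_le fL gL; have := n2_sqr f; have := n2_sqr g.
by move: (n2 f) (n2 g) (nsq f) (nsq g) (Re _) => a b c d x <- <-; nra.
Qed.

Lemma n2N f : sqint f -> n2 (\- f) = n2 f.
Proof.
move=> fL; have -> : \- f = fun t => (-1) *: f t.
  by apply/funext => t; rewrite scaleN1r.
by rewrite (n2Z _ fL) cabsN /cabs normr1 mul1r.
Qed.

Lemma n2BC f g : sqint f -> sqint g -> n2 (f \- g) = n2 (g \- f).
Proof.
move=> fL gL; rewrite -(n2N (sqintB fL gL)).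
have -> // : \- (f \- g) = g \- f.
by apply/funext => t; rewrite /= opprB.
Qed.

Lemma n2B_trans h f g : sqint f -> sqint g -> sqint h ->
  n2 (f \- g) <= n2 (f \- h) + n2 (h \- g).
Proof.
move=> fL gL hL.
have -> : f \- g = (f \- h) \+ (h \- g).
  by apply/funext => t /=; rewrite addrA subrK.
exact: n2D (sqintB fL hL) (sqintB hL gL).
Qed.

Lemma L2_sqnorm_lt f (e : R) : sqint f -> 0 < e -> (L2_sqnorm M f < (e ^+ 2)%:E)%E <-> n2 f < e.
Proof.
move=> fL e0; rewrite (L2_sqnorm_nsq fL) lte_fin -n2_sqr.
by rewrite ltr_pXn2r// nnegrE ?n2_ge0// ltW.
Qed.

End L2_space.

(** * Dominated convergence and resolvent functions *)

Section convergence.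
Context (R : realType).

Lemma dominated_Rintegral (mu : {finite_measure set R -> \bar R})
    (f_ : nat -> R -> R) (f g : R -> R) :
  (forall n, measurable_fun setT (f_ n)) -> measurable_fun setT f ->
  (forall t, f_ n t @[n --> \oo] --> f t) ->
  mu.-integrable setT (EFin \o g) -> (forall n t, `|f_ n t| <= g t) ->
  \int[mu]_t f_ n t @[n --> \oo] --> \int[mu]_t f t.
Proof.
move=> mf_ mf cf gi fg.
have [fi _ h] : [/\ mu.-integrable setT (EFin \o f),
    [sequence (\int[mu]_(x in setT) `|(f_ n x)%:E - (f x)%:E|)%E]_n @ \oo --> 0%E &
    [sequence (\int[mu]_(x in setT) (f_ n x)%:E)%E]_n @ \oo --> (\int[mu]_(x in setT) (f x)%:E)%E].
  apply: (@dominated_convergence _ _ _ mu setT measurableT (fun n => EFin \o f_ n) (EFin \o f) (EFin \o g)) => //.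
  - by move=> n; exact/measurable_EFinP.
  - exact/measurable_EFinP.
  - by apply: aeW => t _; apply: cvg_EFin; [exact: nearW|exact: cf].
  - by apply: aeW => t n _; rewrite /= lee_fin.
apply: fine_cvg; rewrite fineK//.
exact: integrable_fin_num fi.
Qed.

Definition resolvent_fun (z : R[i]) (t : R) : R[i] := ((t%:C)%C - z)^-1.

Lemma resolvent_neq0 (z : R[i]) t : Im z != 0 -> (t%:C)%C - z != 0.
Proof.
move=> z0; apply/eqP => /(congr1 (@complex.Im R)); rewrite ImD ImN/= add0r => /eqP.
by rewrite oppr_eq0 (negbTE z0).
Qed.

(** 1/(t - z) is t - conj z divided by |t - z|^2, a real continuous function of t without zero. *)
Lemma cmfun_resolvent (z : R[i]) : Im z != 0 -> cmfun (resolvent_fun z).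
Proof.
move=> z0; pose m t := ((t - Re z) ^+ 2 + Im z ^+ 2)^-1.
have mpos t : (t - Re z) ^+ 2 + Im z ^+ 2 != 0.
  by rewrite gt_eqF// ltr_wpDl ?sqr_ge0// exprn_even_gt0.
have -> : resolvent_fun z = fun t => ((t%:C)%C - z^*) * ((m t)%:C)%C.
  apply/funext => t; have n0 := resolvent_neq0 t z0.
  apply: (mulfI n0); rewrite divff// mulrA /m.
  have -> : ((t%:C)%C - z) * ((t%:C)%C - z^*) = ((t - Re z) ^+ 2 + Im z ^+ 2)%:C%C.
    by case: z {z0 m mpos n0} => a b; apply: complex_ext; rewrite /= ; ring.
  by rewrite -rmorphM/= mulfV.
have mt : cmfun (fun t : R => (t%:C)%C : R[i]) by apply: cmfun_real.
apply: cmfunM; first by apply: cmfunB => //; exact: cmfun_cst.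
apply: cmfun_real; apply: continuous_measurable_fun => t.
apply: cvgV => //; apply: cvgD; last exact: cvg_cst.
rewrite !expr2; apply: cvgM; apply: cvgB; try exact: cvg_cst; exact: cvg_id.
Qed.

Lemma resolvent_bound_fun (z : R[i]) t : Im z != 0 ->
  cabs (resolvent_fun z t) <= `|Im z|^-1.
Proof.
move=> z0; rewrite /resolvent_fun.
have -> : cabs ((t%:C)%C - z)^-1 = (cabs ((t%:C)%C - z))^-1.
  by apply: complexI; rewrite -cabsE normfV cabsE fmorphV.
have i0 : 0 < `|Im z| by rewrite normr_gt0.
have h : `|Im z| <= cabs ((t%:C)%C - z).
  by apply: le_trans (Im_le_cabs _); rewrite ImD ImN/= add0r normrN.
by rewrite lef_pV2// posrE (lt_le_trans i0).
Qed.
End convergence.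

Section L2_convergence.
Context (R : realType) (N : nat) (M : matrix_measure R N) (D : regular_density M).
Implicit Types (f g h : R -> 'rV[R[i]]_N) (c : R -> R[i]).

Lemma nsq_dominated (h_ : nat -> R -> 'rV[R[i]]_N) (G : R -> R) :
  (forall n, vmfun (h_ n)) ->
  (forall t, Re (hform (D t) (h_ n t) (h_ n t)) @[n --> \oo] --> (0 : R)) ->
  (tau M).-integrable setT (EFin \o G) ->
  (forall n t, Re (hform (D t) (h_ n t) (h_ n t)) <= G t) ->
  nsq D (h_ n) @[n --> \oo] --> (0 : R).
Proof.
move=> mh ch Gi hG.
have E n : nsq D (h_ n) = \int[tau M]_t Re (hform (D t) (h_ n t) (h_ n t)).
  by rewrite nsqE ipE.
under eq_fun do rewrite E.
have -> : (0 : R) = \int[tau M]_t (cst 0 t : R) by rewrite Rintegral_cst// mul0r.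
apply: dominated_Rintegral (Gi) _ => //.
- by move=> n; have [] := cmfun_hform (rdens_cmfun D) (mh n) (mh n).
- by move=> n t; rewrite ger0_norm//; exact: q_ge0.
Qed.

Lemma n2_small (h_ : nat -> R -> 'rV[R[i]]_N) : nsq D (h_ n) @[n --> \oo] --> (0 : R) ->
  forall e, 0 < e -> exists n0, forall n, (n0 <= n)%N -> n2 D (h_ n) < e.
Proof.
move=> h0 e e0; have e20 : 0 < e ^+ 2 by rewrite exprn_gt0.
move/cvgrPdist_lt : h0 => /(_ _ e20)[n0 _ hn]; exists n0 => n /hn.
rewrite sub0r normrN ger0_norm ?nsq_ge0// -n2_sqr => h.
by rewrite -(@ltr_pXn2r _ 2)// nnegrE ?n2_ge0// ltW.
Qed.

Lemma qZ t (a : R[i]) u : Re (hform (D t) (a *: u) (a *: u)) =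
  cabs a ^+ 2 * Re (hform (D t) u u).
Proof.
rewrite hformZl hformZr mulrA -normCK (q_real D) cabsE.
by rewrite -rmorphXn/= mul0r subr0.
Qed.

(** Dominated convergence: the squared integrand is at most (2 C)^2 times that of f. *)
Lemma multiplier_cvg (c_ : nat -> R -> R[i]) c (C : R) f :
  (forall n, cmfun (c_ n)) -> cmfun c ->
  (forall n t, cabs (c_ n t) <= C) -> (forall t, cabs (c t) <= C) ->
  (forall t, cabs (c t - c_ n t) @[n --> \oo] --> (0 : R)) -> sqint D f ->
  forall e, 0 < e -> exists n0, forall n, (n0 <= n)%N ->
    n2 D ((fun t => c t *: f t) \- (fun t => c_ n t *: f t)) < e.
Proof.
move=> mc_ mc bc_ bc cc fL.
have E n : (fun t => c t *: f t) \- (fun t => c_ n t *: f t) = fun t => (c t - c_ n t) *: f t.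
  by apply/funext => t; rewrite scalerBl.
apply: (n2_small (h_ := fun n => (fun t => c t *: f t) \- (fun t => c_ n t *: f t))).
under eq_fun do rewrite E.
apply: (@nsq_dominated _ (fun t => (C + C) ^+ 2 * Re (hform (D t) (f t) (f t)))).
- by move=> n; apply: vmfunM; [exact: cmfunB|exact: sqint_vmfun fL].
- move=> t; under eq_fun do rewrite qZ.
  have : cabs (c t - c_ n t) * cabs (c t - c_ n t) * Re (hform (D t) (f t) (f t))
      @[n --> \oo] --> 0 * 0 * Re (hform (D t) (f t) (f t)).
    by apply: cvgM; [apply: cvgM; exact: cc|exact: cvg_cst].
  by under eq_fun do rewrite -expr2; rewrite !mul0r.
- by apply: rintegrableZ; have [] := sqint_cinteg fL.
- move=> n t; rewrite qZ ler_wpM2r ?(q_ge0 D)//.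
  have C0 : 0 <= C by exact: le_trans (cabs_ge0 _) (bc t).
  rewrite ler_pXn2r// ?nnegrE ?cabs_ge0// ?addr_ge0//.
  by apply: le_trans (cabsD _ _) _; rewrite cabsN lerD.
Qed.
End L2_convergence.

(** * Multipliers of a closed subspace *)

Section sign_iteration.
Context (R : realType).

(* Newton--Schulz iteration: polynomials converging pointwise to the sign
   on [-1, 1], and staying in [-1, 1]. *)
Definition sgn_step (y : R) : R := y * (3 - y ^+ 2) / 2.
Definition sgn_iter (n : nat) (y : R) : R := iter n sgn_step y.

Lemma sgn_stepN y : sgn_step (- y) = - sgn_step y.
Proof. by rewrite /sgn_step sqrrN !mulNr. Qed.

Lemma sgn_iterN n y : sgn_iter n (- y) = - sgn_iter n y.
Proof. by rewrite /sgn_iter; elim: n => //= n ->; rewrite sgn_stepN. Qed.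

Lemma sgn_step_itv y : 0 <= y <= 1 -> y <= sgn_step y <= 1.
Proof.
move=> /andP[y0 y1]; rewrite /sgn_step; apply/andP; split; first nra.
(* This product is twice 1 - sgn_step y. *)
have : 0 <= (1 - y) ^+ 2 * (2 + y) by rewrite mulr_ge0 ?sqr_ge0//; lra.
by nra.
Qed.

Lemma sgn_iter_itv n y : 0 <= y <= 1 -> y <= sgn_iter n y <= 1.
Proof.
move=> /andP[y0 y1]; elim: n => [|n /andP[h1 h2]]; first by rewrite /= lexx.
have /andP[h3 h4] : sgn_iter n y <= sgn_iter n.+1 y <= 1.
  by apply: sgn_step_itv; rewrite h2 (le_trans y0 h1).
by rewrite h4 (le_trans h1 h3).
Qed.

Lemma sgn_iter_cvg_pos y : 0 < y <= 1 -> sgn_iter n y @[n --> \oo] --> (1 : R).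
Proof.
(* One step maps the error 1 - z to (1 - z)(1 - (z + z^2)/2), and the iterates z stay above y, so
   the error shrinks at least by the factor r. *)
move=> /andP[y0 y1]; pose r := 1 - y / 2.
have r0 : 0 <= r by rewrite /r; lra.
have r1 : r < 1 by rewrite /r; lra.
have yi n : y <= sgn_iter n y <= 1 by apply: sgn_iter_itv; rewrite ltW.
have h n : 1 - sgn_iter n y <= r ^+ n.
  elim: n => [|n IHn]; first by rewrite expr0 gerBl /= ltW.
  have /andP[z1 z2] := yi n; rewrite exprS.
  apply: le_trans (_ : _ <= r * (1 - sgn_iter n y)) _; last by rewrite ler_wpM2l.
  rewrite /= /sgn_step -/(sgn_iter n y) /r; move: (sgn_iter n y) z1 z2 => z z1 z2.
  have : 0 <= (1 - z) * (z ^+ 2 + z - y) by rewrite mulr_ge0 ?subr_ge0//; nra.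
  by nra.
apply/cvgrPdist_le => e e0.
have : r ^+ n @[n --> \oo] --> (0 : R) by apply: cvg_expr; rewrite ger0_norm.
move=> /cvgrPdist_le/(_ e e0); apply: filterS => n; rewrite sub0r normrN.
rewrite ger0_norm ?exprn_ge0// => rn.
have /andP[_ z2] := yi n; rewrite ger0_norm ?subr_ge0//.
exact: le_trans (h n) rn.
Qed.

Lemma sgn_iter0 n : sgn_iter n 0 = 0.
Proof. by elim: n => //= n ->; rewrite /sgn_step mul0r mul0r. Qed.

Lemma sgn_iter_cvg y : `|y| <= 1 -> sgn_iter n y @[n --> \oo] --> Num.sg y.
Proof.
have [y0|y0|y0] := ltrgtP y 0; move=> y1.
- rewrite ltr0_sg//.
  have yN : 0 < - y <= 1 by rewrite oppr_gt0 y0 -ltr0_norm.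
  have -> : (fun n => sgn_iter n y) = fun n => - sgn_iter n (- y).
    by apply/funext => n; rewrite sgn_iterN opprK.
  by apply: cvgN; exact: sgn_iter_cvg_pos.
- by rewrite gtr0_sg//; apply: sgn_iter_cvg_pos; rewrite y0 (le_trans (ler_norm _)).
- by rewrite y0 sgr0; under eq_fun do rewrite sgn_iter0; exact: cvg_cst.
Qed.

Lemma sgn_iter_bound n y : `|y| <= 1 -> `|sgn_iter n y| <= 1.
Proof.
wlog y0 : y / 0 <= y.
  move=> W; have [/W//|/ltW y0] := leP 0 y.
  by rewrite -normrN => /W; rewrite sgn_iterN normrN oppr_ge0; apply.
rewrite ger0_norm// => y1; have /andP[h1 h2] := @sgn_iter_itv n y (introT andP (conj y0 y1)).
by rewrite ger0_norm// (le_trans y0).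
Qed.
End sign_iteration.

Import HBNNSimple.

Section multipliers.
Context (R : realType) (N : nat) (M : matrix_measure R N) (D : regular_density M).
Variable S : set (R -> 'rV[R[i]]_N).
Hypothesis SL : forall f, S f -> sqint D f.
Hypothesis SD : forall f g, S f -> S g -> S (f \+ g).
Hypothesis SZ : forall a f, S f -> S (fun t => a *: f t).
Hypothesis Scl : forall f, sqint D f ->
  (forall e, 0 < e -> exists2 g, S g & n2 D (f \- g) < e) -> S f.

Definition multiplier (c : R -> R[i]) := [/\ cmfun c,
  exists C, forall t, cabs (c t) <= C & forall f, S f -> S (fun t => c t *: f t)].

Lemma multiplierD c c' : multiplier c -> multiplier c' -> multiplier (fun t => c t + c' t).
Proof.
move=> [mc [C cC] Sc] [mc' [C' cC'] Sc']; split; first exact: cmfunD.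
  by exists (C + C') => t; rewrite (le_trans (cabsD _ _))// lerD.
move=> f Sf; have := SD (Sc _ Sf) (Sc' _ Sf).
by under [X in S X -> _]eq_fun do rewrite /= -scalerDl.
Qed.

Lemma multiplierM c c' : multiplier c -> multiplier c' -> multiplier (fun t => c t * c' t).
Proof.
move=> [mc [C cC] Sc] [mc' [C' cC'] Sc']; split; first exact: cmfunM.
  by exists (C * C') => t; rewrite cabsM ler_pM ?cabs_ge0.
move=> f Sf; have := Sc _ (Sc' _ Sf).
by under [X in S X -> _]eq_fun do rewrite scalerA.
Qed.

Lemma multiplier_cst a : multiplier (fun=> a).
Proof.
by split; [exact: cmfun_cst|exists (cabs a)|move=> f Sf; exact: SZ].
Qed.

Lemma multiplierZ a c : multiplier c -> multiplier (fun t => a * c t).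
Proof. by move=> mc; apply: multiplierM => //; exact: multiplier_cst. Qed.

Lemma multiplierB c c' : multiplier c -> multiplier c' -> multiplier (fun t => c t - c' t).
Proof.
move=> mc mc'; have := multiplierD mc (multiplierZ (-1) mc').
by under eq_fun do rewrite mulN1r.
Qed.

Lemma multiplier_lim (c_ : nat -> R -> R[i]) c (C : R) :
  (forall n, multiplier (c_ n)) -> cmfun c ->
  (forall n t, cabs (c_ n t) <= C) -> (forall t, cabs (c t) <= C) ->
  (forall t, cabs (c t - c_ n t) @[n --> \oo] --> (0 : R)) -> multiplier c.
Proof.
move=> mc_ mc bc_ bc cc; split => //; first by exists C.
move=> f Sf; have fL := SL Sf; apply: Scl; first exact: (sqintM (C := C)).
move=> e e0; have mcn n : cmfun (c_ n) by case: (mc_ n).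
have [n0 hn] := multiplier_cvg mcn mc bc_ bc cc fL e0.
by exists (fun t => c_ n0 t *: f t); [case: (mc_ n0) => _ _; apply|exact: hn].
Qed.

Hypothesis Srz : forall z f, Im z != 0 -> S f -> S (fun t => resolvent_fun z t *: f t).

Lemma multiplier_resolvent z : Im z != 0 -> multiplier (resolvent_fun z).
Proof.
move=> z0; split; first exact: cmfun_resolvent.
  by exists (`|Im z|^-1) => t; exact: resolvent_bound_fun.
by move=> f; exact: Srz.
Qed.

(** The sum of the resolvent functions at s + i and s - i: a real function with values in [-1, 1]
    and the sign of t - s, hence a starting point for the sign iteration. *)
Definition sign_kernel (s t : R) : R := 2 * (t - s) / ((t - s) ^+ 2 + 1).

Lemma sign_kernel_resolvent s t : (sign_kernel s t)%:C%C =
  resolvent_fun (Complex s 1) t + resolvent_fun (Complex s (-1)) t.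
Proof.
have n1 : (t%:C)%C - Complex s 1 != 0 by apply: resolvent_neq0; rewrite /= oner_neq0.
have n2 : (t%:C)%C - Complex s (-1) != 0 by apply: resolvent_neq0; rewrite /= oppr_eq0 oner_neq0.
have m0 : (t - s) ^+ 2 + 1 != 0 by rewrite gt_eqF// ltr_wpDl ?sqr_ge0.
have E : ((t%:C)%C - Complex s 1) * ((t%:C)%C - Complex s (-1)) = ((t - s) ^+ 2 + 1)%:C%C.
  by apply: complex_ext; rewrite /=; ring.
apply: (mulfI (mulf_neq0 n1 n2)); rewrite {1}E [RHS]mulrDr /resolvent_fun.
rewrite [X in _ = X + _]mulrAC divff// mul1r mulfK//.
rewrite -rmorphM/= /sign_kernel mulrC divfK//.
by apply: complex_ext; rewrite /=; ring.
Qed.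

Lemma sign_kernel_bound s t : `|sign_kernel s t| <= 1.
Proof.
have m0 : 0 < (t - s) ^+ 2 + 1 by rewrite ltr_wpDl ?sqr_ge0.
rewrite /sign_kernel normrM normfV [X in _ / X]gtr0_norm// ler_pdivrMr// mul1r.
rewrite ler_norml; move: (t - s) => x; have := sqr_ge0 (x - 1); have := sqr_ge0 (x + 1).
by move=> *; apply/andP; split; nra.
Qed.

Lemma sg_sign_kernel s t : Num.sg (sign_kernel s t) = Num.sg (t - s).
Proof.
have m0 : 0 < ((t - s) ^+ 2 + 1)^-1 by rewrite invr_gt0 ltr_wpDl ?sqr_ge0.
by rewrite /sign_kernel !sgrM (gtr0_sg m0) mulr1 gtr0_sg ?mul1r.
Qed.

Lemma multiplier_sgn_iter s n : multiplier (fun t => (sgn_iter n (sign_kernel s t))%:C%C).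
Proof.
elim: n => [|n IHn].
  have -> : (fun t => (sgn_iter 0 (sign_kernel s t))%:C%C) =
      fun t => resolvent_fun (Complex s 1) t + resolvent_fun (Complex s (-1)) t.
    by apply/funext => t; rewrite -sign_kernel_resolvent.
  apply: multiplierD; apply: multiplier_resolvent; rewrite /= ?oppr_eq0 oner_neq0//.
have -> : (fun t => (sgn_iter n.+1 (sign_kernel s t))%:C%C) =
    fun t => (2^-1 : R)%:C%C * ((sgn_iter n (sign_kernel s t))%:C%C *
     ((3 : R)%:C%C - (sgn_iter n (sign_kernel s t))%:C%C * (sgn_iter n (sign_kernel s t))%:C%C)).
  apply/funext => t; rewrite -rmorphM -rmorphB -!rmorphM/=; congr (_%:C)%C.
  by rewrite -/(sgn_iter n _) /sgn_step expr2 mulrC.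
apply: multiplierZ; apply: multiplierM => //; apply: multiplierB; last exact: multiplierM.
exact: multiplier_cst.
Qed.

Lemma multiplier_sg s : multiplier (fun t => (Num.sg (t - s))%:C%C).
Proof.
have cs t : sgn_iter n (sign_kernel s t) @[n --> \oo] --> Num.sg (t - s).
  by rewrite -sg_sign_kernel; apply: sgn_iter_cvg; exact: sign_kernel_bound.
apply: (@multiplier_lim (fun n t => (sgn_iter n (sign_kernel s t))%:C%C) _ 1).
- by move=> n; exact: multiplier_sgn_iter.
- apply: cmfun_real; apply: (@measurable_fun_cvg _ _ _ setT (fun n t => sgn_iter n (sign_kernel s t))).
    by move=> n; have [[]] := multiplier_sgn_iter s n.
  by move=> t _; exact: cs.
- by move=> n t; rewrite cabs_real sgn_iter_bound// sign_kernel_bound.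
- by move=> t; rewrite cabs_real normr_sg; case: (_ != 0).
- move=> t; under eq_fun do rewrite -rmorphB cabs_real.
  rewrite -(normr0 R) -(subrr (Num.sg (t - s))); apply: cvg_norm.
  by apply: cvgB; [exact: cvg_cst|exact: cs].
Qed.

Lemma multiplier_itv s : multiplier (fun t => (\1_(`]-oo, s[%classic) t)%:C%C).
Proof.
(* For a sign e, (e^2 - e)/2 is 1 at e = -1 and 0 at e = 0 and e = 1; the value at 0 fits the
   half-line being open. *)
have -> : (fun t => (\1_(`]-oo, s[%classic) t)%:C%C) = fun t => (2^-1 : R)%:C%C *
    ((Num.sg (t - s))%:C%C * (Num.sg (t - s))%:C%C - (Num.sg (t - s))%:C%C) :> R[i].
  apply/funext => t; rewrite -rmorphM -rmorphB -rmorphM/=; congr (_%:C)%C.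
  rewrite indicE; have [ts|ts|->] := ltrgtP t s.
  - by rewrite mem_set/= ?in_itv//= ltr0_sg ?subr_lt0//; lra.
  - by rewrite memNset/= ?in_itv/= ?gtr0_sg ?subr_gt0 ?ltNge ?(ltW ts)//; lra.
  - by rewrite memNset/= ?in_itv/= ?ltxx// subrr sgr0; lra.
apply: multiplierZ; apply: multiplierB; last exact: multiplier_sg.
by apply: multiplierM; exact: multiplier_sg.
Qed.

(** The sets whose indicator is a multiplier form a sigma-algebra, countable unions being bounded
    limits of finite ones, and it contains the open half-lines. *)
Lemma multiplier_indic (E : set R) : measurable E -> multiplier (fun t => (\1_E t)%:C%C).
Proof.
have mU A B : multiplier (fun t => (\1_A t)%:C%C) -> multiplier (fun t => (\1_B t)%:C%C) ->
    multiplier (fun t => (\1_(A `|` B) t)%:C%C).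
  move=> mA mB; have -> : (fun t => (\1_(A `|` B) t)%:C%C) = fun t => (\1_A t)%:C%C + (\1_B t)%:C%C
      - (\1_A t)%:C%C * (\1_B t)%:C%C :> R[i].
    apply/funext => t; rewrite -rmorphM -rmorphD -rmorphB/= !indicE in_setU; congr (_%:C)%C.
    by case: (t \in A); case: (t \in B) => /=; ring.
  by apply: multiplierB; [exact: multiplierD|exact: multiplierM].
have m0 : multiplier (fun t => (\1_(@set0 R) t)%:C%C).
  by under eq_fun do rewrite indicE in_set0; exact: multiplier_cst.
pose G := [set B : set R | measurable B /\ multiplier (fun t => (\1_B t)%:C%C)].
suff : measurable `<=` G by move=> /[apply] -[].
have -> : (measurable : set (set R)) = <<s @RGenInftyO.G R >> by exact: RGenInftyO.measurableE.
apply: smallest_sub; last first.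
  by move=> _ [s ->]; split; [exact: measurable_itv|exact: multiplier_itv].
split.
- by split.
- move=> A [mA MA]; rewrite setTD; split; first exact: measurableC.
  have -> : (fun t => (\1_(~` A) t)%:C%C) = fun t => 1 - (\1_A t)%:C%C :> R[i].
    apply/funext => t; rewrite !indicE in_setC; case: (_ \in _) => /=.
      by rewrite subrr.
    by rewrite subr0.
  by apply: multiplierB => //; exact: multiplier_cst.
- move=> A mA; have mUA : measurable (\bigcup_n A n).
    by apply: bigcup_measurable => n _; case: (mA n).
  split => //.
  pose B n := \big[setU/set0]_(i < n) A i.
  apply: (@multiplier_lim (fun n t => (\1_(B n) t)%:C%C) _ 1) => //.
  + move=> n; rewrite /B; elim: n => [|n IHn]; first by rewrite big_ord0.
    by rewrite big_ord_recr/=; apply: mU => //; case: (mA n).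
  + exact: cmfun_indic.
  + by move=> n t; exact: cabs_indic.
  + by move=> t; exact: cabs_indic.
  + move=> t; under eq_fun do rewrite -rmorphB cabs_real.
    have [[n _ Ant]|nA] := pselect ((\bigcup_n A n) t); last first.
      have z : \1_(\bigcup_n A n) t = 0 :> R by rewrite indicE memNset.
      have zn n : \1_(B n) t = 0 :> R.
        rewrite indicE memNset// /B -bigcup_mkord => -[k _ Akt]; apply: nA; by exists k.
      by under eq_fun do rewrite z zn subrr normr0; exact: cvg_cst.
    apply: cvg_near_cst; exists n.+1 => // k /= nk.
    rewrite !indicE mem_set; last by exists n.
    rewrite mem_set ?subrr ?normr0//.
    by rewrite /B -bigcup_mkord; exists n.
Qed.

(** Increasing approximation by simple functions, which are finite combinations of indicators and
    inherit the bound C. *)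
Lemma multiplier_nonneg (r : R -> R) (C : R) : measurable_fun setT r ->
  (forall t, 0 <= r t <= C) -> multiplier (fun t => (r t)%:C%C).
Proof.
move=> mr rC.
have mrE : measurable_fun setT (EFin \o r) by exact/measurable_EFinP.
pose h := nnsfun_approx measurableT mrE.
have ch t : h n t @[n --> \oo] --> r t.
  have : (EFin \o h n) t @[n --> \oo] --> (EFin \o r) t.
    by apply: cvg_nnsfun_approx => // x _; rewrite lee_fin; case/andP: (rC x).
  by move=> /fine_cvg; exact.
have hr n t : h n t <= r t.
  have nd : nondecreasing_seq (fun n => h n t).
    by move=> k m km; exact/lefP/(nd_nnsfun_approx measurableT mrE km).
  rewrite -(cvg_lim _ (ch t))//; apply: nondecreasing_cvgn_le => //.
  exact: cvgP (ch t).
apply: (@multiplier_lim (fun n t => (h n t)%:C%C) _ C).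
- move=> n.
  have -> : (fun t => (h n t)%:C%C) = fun t => \sum_(y <- finmap.enum_fset (fset_set (range (h n))))
      (y%:C%C * (\1_(h n @^-1` [set y]) t)%:C%C) :> R[i].
    apply/funext => t; rewrite fimfunE fsbig_finite//= rmorph_sum/=.
    by apply: eq_bigr => y _; rewrite rmorphM.
  elim: (finmap.enum_fset _) => [|y s IHs].
    by under eq_fun do rewrite big_nil; exact: multiplier_cst.
  under eq_fun do rewrite big_cons; apply: multiplierD => //.
  by apply: multiplierZ; apply: multiplier_indic.
- exact: cmfun_real.
- move=> n t; rewrite cabs_real ger0_norm// (le_trans (hr _ _))//.
  by case/andP: (rC t).
- by move=> t; case/andP: (rC t) => r0 rC'; rewrite cabs_real ger0_norm.
- move=> t; under eq_fun do rewrite -rmorphB cabs_real.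
  rewrite -(normr0 R) -(subrr (r t)); apply: cvg_norm.
  by apply: cvgB; [exact: cvg_cst|exact: ch].
Qed.

Lemma multiplier_bounded c (C : R) : cmfun c -> (forall t, cabs (c t) <= C) -> multiplier c.
Proof.
move=> [m1 m2] cC.
have mre (r : R -> R) : measurable_fun setT r -> (forall t, `|r t| <= C) ->
    multiplier (fun t => (r t)%:C%C).
  move=> mr rC; have -> : (fun t => (r t)%:C%C) = fun t => (r t + C)%:C%C - C%:C%C :> R[i].
    by apply/funext => t; rewrite -rmorphB/= addrK.
  apply: multiplierB; last exact: multiplier_cst.
  apply: (@multiplier_nonneg _ (C + C)); first by apply: measurable_funD.
  move=> t; have := rC t; rewrite ler_norml => /andP[h1 h2]; apply/andP; split; lra.
have -> : c = fun t => (Re (c t))%:C%C + 'i%C * (Im (c t))%:C%C.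
  by apply/funext => t; rewrite -complexE.
apply: multiplierD; last apply: multiplierZ; apply: mre => // t.
  exact: le_trans (Re_le_cabs _) (cC t).
exact: le_trans (Im_le_cabs _) (cC t).
Qed.

Hypothesis S0 : S (fun=> 0).
Hypothesis Se : forall k, S (fun=> delta_mx 0 k).

(** Cut to the set where its coordinates are bounded by n, f is a sum of bounded multiples of the
    constant functions e_k of S; these truncations converge to f. *)
Lemma resolvent_stable_full f : sqint D f -> S f.
Proof.
move=> fL; apply: Scl => // e e0; have mf := sqint_vmfun fL.
pose s t := \sum_k (`|Re (f t 0 k)| + `|Im (f t 0 k)|).
have ms : measurable_fun setT s.
  have : forall r : seq 'I_N, measurable_fun setT
      (fun t => \sum_(k <- r) (`|Re (f t 0 k)| + `|Im (f t 0 k)|)).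
    elim=> [|k r IHr]; first by under eq_fun do rewrite big_nil; exact: measurable_cst.
    under eq_fun do rewrite big_cons; apply: measurable_funD => //.
    by have [m1 m2] := mf k; apply: measurable_funD; exact: measurableT_comp.
  exact.
have fs t k : cabs (f t 0 k) <= s t.
  rewrite (le_trans (cabs_le _))// /s (bigD1 k)//= lerDl.
  by apply: sumr_ge0 => j _; rewrite addr_ge0.
pose A n := [set t | s t <= n%:R].
have mA n : measurable (A n).
  rewrite (_ : A n = setT `&` s @^-1` `]-oo, n%:R]%classic).
    by apply: ms => //; exact: measurable_itv.
  by apply/seteqP; split=> t /=; rewrite in_itv/= // => -[].
pose f_ n t := (\1_(A n) t)%:C%C *: f t.
have Sf n : S (f_ n).
  have -> : f_ n = fun t => \sum_k ((\1_(A n) t)%:C%C * f t 0 k) *: delta_mx 0 k.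
    apply/funext => t; rewrite /f_ [in LHS](row_sum_delta (f t)) scaler_sumr.
    by apply: eq_bigr => k _; rewrite scalerA.
  have Sk k : S (fun t => ((\1_(A n) t)%:C%C * f t 0 k) *: delta_mx 0 k).
    have [_ _] : multiplier (fun t => (\1_(A n) t)%:C%C * f t 0 k); last by apply; exact: Se.
    apply: (@multiplier_bounded _ n%:R).
      by apply: cmfunM; [exact: cmfun_indic|exact: mf].
    move=> t; rewrite cabsM cabs_real indicE; have [|tA] := boolP (t \in A n).
      by rewrite inE /A/= => st; rewrite normr1 mul1r (le_trans (fs t k)).
    by rewrite normr0 mul0r.
  elim: (index_enum _) => [|k r IHr].
    by under eq_fun do rewrite big_nil.
  by under eq_fun do rewrite big_cons; exact: SD (Sk k) IHr.
have [n0 hn] : exists n0, forall n, (n0 <= n)%N -> n2 D ((fun t => 1 *: f t) \- f_ n) < e.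
  apply: (@multiplier_cvg _ _ _ D (fun n t => (\1_(A n) t)%:C%C) (fun=> 1) 1) => //.
  - by move=> n; exact: cmfun_indic.
  - by move=> n t; rewrite cabs_real indicE; case: (_ \in _); rewrite ?normr1 ?normr0.
  - by move=> t; rewrite /cabs normr1.
  - move=> t; apply: cvg_near_cst; exists (Num.truncn (s t)).+1 => // n /= sn.
    rewrite indicE mem_set ?subrr ?cabs0// /A/=.
    by rewrite ltW// (lt_le_trans (truncnS_gt _))// ler_nat.
exists (f_ n0) => //; have := hn n0 (leqnn _).
by have -> : (fun t => 1 *: f t) = f by apply/funext => t; rewrite scale1r.
Qed.
End multipliers.

(** * Completeness of L^2(M) *)

Section projection_on_range.
Context (R : realType) (N : nat).
Implicit Types (X : 'M[R[i]]_N).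

Lemma cabs_sum I (r : seq I) (F : I -> R[i]) :
  cabs (\sum_(k <- r) F k) <= \sum_(k <- r) cabs (F k).
Proof.
elim: r => [|k r IHr]; first by rewrite !big_nil cabs0.
by rewrite !big_cons (le_trans (cabsD _ _))// lerD.
Qed.

Definition mx_iter (Y : 'M[R[i]]_N) (n : nat) : 'M[R[i]]_N := iter n (fun Z => Z *m Y) 1%:M.

(* The orthogonal projection on the range is the limit of 1 - (1 - X)^n, hence
   a measurable function of X. *)
Lemma good_projection X : good X -> exists (P : 'M[R[i]]_N) (c : R), [/\ 0 <= c,
  forall i j, cabs (mx_iter (1%:M - X) n i j - (1%:M - P) i j) @[n --> \oo] --> (0 : R),
  P *m X = X &
  forall (v : 'rV[R[i]]_N) j, cabs ((v *m P) 0 j) <= c * Num.sqrt (Re (hform X v v))].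
Proof.
move=> [[Xh Xp] Xtr].
have [W [V [d [WV VW VT XE]]]] : exists (W V : 'M[R[i]]_N) (d : 'rV[R[i]]_N),
    [/\ W *m V = 1%:M, V *m W = 1%:M, (map_mx Num.conj V)^T = W & X = V *m diag_mx d *m W].
  pose W := spectralmx X; pose V := (map_mx Num.conj W)^T.
  have WV : W *m V = 1%:M by have /unitarymxP := spectral_unitarymx X; rewrite /V -map_trmx.
  have iW : invmx W = V by rewrite /W invmx_unitary ?spectral_unitarymx// -map_trmx.
  exists W, V, (spectral_diag X); split => //; first exact: mulmx1C.
    by apply/matrixP => i j; rewrite !mxE conjCK.
  by rewrite -iW; apply/orthomx_spectralP; exact: hermitian_normalmx.
have hE v : hform X v v = \sum_k (v *m V) 0 k * d 0 k * ((v *m V) 0 k)^*.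
  rewrite /hform XE; have -> : (map_mx Num.conj v)^T = V *m (map_mx Num.conj (v *m V))^T.
    by rewrite map_mxM trmx_mul VT mulmxA VW mul1mx.
  rewrite !mulmxA -(mulmxA _ W V) WV mulmx1 mul_mx_diag mxE.
  by apply: eq_bigr => k _; rewrite !mxE.
have d0 k : 0 <= d 0 k.
  have := Xp (row k W); rewrite -/(hform _ _ _) hE rowE -mulmxA WV mulmx1.
  rewrite (bigD1 k)//= big1 ?addr0 ?mxE ?eqxx ?mul1r ?conjC1 ?mulr1// => j jk.
  by rewrite mxE (negbTE jk) andbF !mul0r.
have dtr : \sum_k d 0 k = 1.
  rewrite -Xtr -/(mxtrace X) {1}XE mxtrace_mulC mulmxA WV mul1mx.
  by rewrite mxtrace_diag.
have d1 k : d 0 k <= 1 by rewrite -dtr (bigD1 k)//= lerDl sumr_ge0.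
have dr k : d 0 k = (Re (d 0 k))%:C%C by rewrite RRe_real// ger0_real.
have iterE n : mx_iter (1%:M - X) n = V *m diag_mx (\row_k (1 - d 0 k) ^+ n) *m W.
  elim: n => [|n IHn].
    have -> : \row_k (1 - d 0 k) ^+ 0 = const_mx 1 by apply/rowP => k; rewrite !mxE expr0.
    by rewrite diag_const_mx mulmx1 VW.
  rewrite /mx_iter iterS -/(mx_iter _ n) IHn.
  have -> : 1%:M - X = V *m diag_mx (\row_k (1 - d 0 k)) *m W.
    have -> : \row_k (1 - d 0 k) = const_mx 1 - d by apply/rowP => k; rewrite !mxE.
    by rewrite linearB/= diag_const_mx mulmxBr mulmxBl mulmx1 VW -XE.
  rewrite !mulmxA -(mulmxA _ W V) WV mulmx1 -(mulmxA V) mulmx_diag.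
  by congr (_ *m diag_mx _ *m _); apply/rowP => k; rewrite !mxE exprSr.
(* The indicator of the nonzero eigenvalues; (1 - d)^n tends to 1 - e since d lies in [0, 1]. *)
pose e k : R[i] := (d 0 k != 0)%:R.
pose P := V *m diag_mx (\row_k e k) *m W.
have QE : 1%:M - P = V *m diag_mx (\row_k (1 - e k)) *m W.
  have -> : \row_k (1 - e k) = const_mx 1 - \row_k e k by apply/rowP => k; rewrite !mxE.
  by rewrite linearB/= diag_const_mx mulmxBr mulmxBl mulmx1 VW.
have entry (a : 'I_N -> R[i]) i j : (V *m diag_mx (\row_k a k) *m W) i j = \sum_k V i k * W k j * a k.
  rewrite mul_mx_diag mxE; apply: eq_bigr => k _; rewrite !mxE; exact: mulrAC.
have cd k : cabs ((1 - d 0 k) ^+ n - (1 - e k)) @[n --> \oo] --> (0 : R).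
  rewrite /e; have [->|dn0] := eqVneq (d 0 k) 0.
    by under eq_fun do rewrite /= !subr0 expr1n subrr cabs0; exact: cvg_cst.
  have -> : (fun n => cabs ((1 - d 0 k) ^+ n - (1 - 1))) = fun n => (1 - Re (d 0 k)) ^+ n.
    apply/funext => n; rewrite subrr subr0 dr -[1]/((1 : R)%:C%C) -rmorphB -rmorphXn/=.
    rewrite /cabs normc_def/= expr0n/= addr0 sqrtr_sqr ger0_norm// exprn_ge0// subr_ge0.
    by rewrite -lecR -dr.
  have dk0 : 0 < Re (d 0 k) by rewrite -ltcR -dr lt_def dn0 d0.
  have dk1 : Re (d 0 k) <= 1 by rewrite -lecR -dr.
  by apply: cvg_expr; rewrite ger0_norm; lra.
(* In the eigenbasis the k-th coordinate of v is at most sqrt(q / d_k) when d_k is nonzero. When d_k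
   = 0 the inverse is 0, which is harmless because P kills that coordinate. *)
pose c j := \sum_k cabs (W k j) * (Num.sqrt (Re (d 0 k)))^-1.
have c0 j : 0 <= c j by apply: sumr_ge0 => k _; rewrite mulr_ge0 ?cabs_ge0// invr_ge0 sqrtr_ge0.
exists P, (\sum_j c j); split.
- by apply: sumr_ge0 => j _; exact: c0.
- move=> i j; rewrite QE entry.
  have h : \sum_k cabs (V i k * W k j) * cabs ((1 - d 0 k) ^+ n - (1 - e k)) @[n --> \oo] -->
      \sum_k cabs (V i k * W k j) * 0.
    apply: cvg_big => [|k _]; first exact: add_continuous.
    by apply: cvgM; [exact: cvg_cst|exact: cd].
  rewrite big1 in h; last by move=> k _; rewrite mulr0.
  apply: (squeeze_cvgr (f := fun=> 0)); [|exact: cvg_cst|exact: h].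
  apply: nearW => n; rewrite cabs_ge0/= iterE entry -sumrB.
  apply: le_trans (cabs_sum _ _) _; apply: ler_sum => k _.
  by rewrite -mulrBr [leLHS]cabsM.
- rewrite {1}XE /P !mulmxA -(mulmxA _ W V) WV mulmx1 -(mulmxA V) mulmx_diag [RHS]XE.
  congr (_ *m diag_mx _ *m _); apply/rowP => k; rewrite !mxE /e.
  by have [->|_] := eqVneq (d 0 k) 0; rewrite ?mulr0 ?mul1r.
- move=> v j; set q := Re _.
  have yq k : Re (d 0 k) * cabs ((v *m V) 0 k) ^+ 2 <= q.
    rewrite -lecR rmorphM rmorphXn/= -dr -cabsE /q.
    rewrite RRe_real; last by rewrite ger0_real//; exact: Xp.
    rewrite hE (bigD1 k)//= -[leLHS]addr0 lerD//.
      by rewrite normCK mulrCA mulrA.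
    by apply: sumr_ge0 => l _; rewrite mulrAC -normCK mulr_ge0// exprn_ge0.
  have -> : (v *m P) 0 j = \sum_k (v *m V) 0 k * e k * W k j.
    by rewrite /P !mulmxA mul_mx_diag mxE; apply: eq_bigr => k _; rewrite !mxE.
  apply: (@le_trans _ _ (c j * Num.sqrt q)); last first.
    by rewrite ler_wpM2r ?sqrtr_ge0// (bigD1 j)//= lerDl sumr_ge0.
  rewrite /c mulr_suml.
  apply: le_trans (cabs_sum _ _) _; apply: ler_sum => k _.
  rewrite /e; have [_|dn0] := eqVneq (d 0 k) 0.
    by rewrite mulr0 mul0r cabs0 !mulr_ge0 ?cabs_ge0 ?invr_ge0 ?sqrtr_ge0.
  rewrite mulr1 cabsM mulrC -mulrA ler_wpM2l ?cabs_ge0//.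
  have dk0 : 0 < Re (d 0 k) by rewrite -ltcR -dr lt_def dn0 d0.
  rewrite mulrC ler_pdivlMr ?sqrtr_gt0//.
  have -> : cabs ((v *m V) 0 k) = Num.sqrt (cabs ((v *m V) 0 k) ^+ 2).
    by rewrite sqrtr_sqr ger0_norm ?cabs_ge0.
  by rewrite -sqrtrM ?sqr_ge0//; apply: ler_wsqrtr; rewrite mulrC.
Qed.
End projection_on_range.

Section pointwise_limit.
Context (R : realType).

Lemma real_cauchy (a b : nat -> R) : (forall n j, `|a n - a (n + j)%N| <= b n) ->
  b n @[n --> \oo] --> (0 : R) -> exists l : R, a n @[n --> \oo] --> l.
Proof.
move=> ab b0; have : cvgn a.
  apply/cauchy_cvgP/cauchy_exP => e e0.
  move/cvgrPdist_lt : b0 => /(_ _ e0)[n0 _ bn0].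
  have bn : b n0 < e.
    by have := bn0 n0 (leqnn n0); rewrite sub0r normrN; apply: le_lt_trans; exact: ler_norm.
  exists (a n0); exists n0 => // n /= n0n.
  rewrite -ball_normE/= -(subnKC n0n); exact: le_lt_trans (ab _ _) bn.
by move=> /cvg_ex[l al]; exists l.
Qed.

Lemma complex_cauchy (a : nat -> R[i]) (b : nat -> R) :
  (forall n j, cabs (a n - a (n + j)%N) <= b n) -> b n @[n --> \oo] --> (0 : R) ->
  exists l, cabs (a n - l) @[n --> \oo] --> (0 : R).
Proof.
move=> ab b0.
have [x ax] : exists x : R, Re (a n) @[n --> \oo] --> x.
  apply: (real_cauchy (b := b)) (b0) => n j; apply: le_trans (ab n j).
  by rewrite -ReN -ReD Re_le_cabs.
have [y ay] : exists y : R, Im (a n) @[n --> \oo] --> y.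
  apply: (real_cauchy (b := b)) (b0) => n j; apply: le_trans (ab n j).
  by rewrite -ImN -ImD Im_le_cabs.
exists (Complex x y).
have h : `|Re (a n) - x| + `|Im (a n) - y| @[n --> \oo] --> `|x - x| + `|y - y|.
  by apply: cvgD; apply: cvg_norm; apply: cvgB => //; exact: cvg_cst.
rewrite !subrr normr0 addr0 in h.
apply: (squeeze_cvgr (f := fun=> 0)); [|exact: cvg_cst|exact: h].
apply: nearW => n; rewrite cabs_ge0/=; apply: le_trans (cabs_le _) _.
by rewrite ReD ImD ReN ImN.
Qed.

Lemma cmfun_lim (h_ : nat -> R -> R[i]) h : (forall n, cmfun (h_ n)) ->
  (forall t, cabs (h_ n t - h t) @[n --> \oo] --> (0 : R)) -> cmfun h.
Proof.
move=> mh ch; split.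
- apply: (@measurable_fun_cvg _ _ _ setT (fun n t => Re (h_ n t))) => [n|t _].
    by have [] := mh n.
  apply/cvgrPdist_le => e e0; move/cvgrPdist_le : (ch t) => /(_ _ e0)[n0 _ hn].
  exists n0 => // n /hn; rewrite sub0r normrN ger0_norm ?cabs_ge0//.
  by apply: le_trans; rewrite distrC -ReN -ReD Re_le_cabs.
- apply: (@measurable_fun_cvg _ _ _ setT (fun n t => Im (h_ n t))) => [n|t _].
    by have [] := mh n.
  apply/cvgrPdist_le => e e0; move/cvgrPdist_le : (ch t) => /(_ _ e0)[n0 _ hn].
  exists n0 => // n /hn; rewrite sub0r normrN ger0_norm ?cabs_ge0//.
  by apply: le_trans; rewrite distrC -ImN -ImD Im_le_cabs.
Qed.

Lemma half_pow_cvg (a : R) : a / 2 ^+ n @[n --> \oo] --> (0 : R).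
Proof.
have -> : (fun n => a / 2 ^+ n) = fun n => a * (2^-1) ^+ n.
  by apply/funext => n; rewrite exprVn.
rewrite -[X in _ --> X](mulr0 a); apply: cvgM; first exact: cvg_cst.
by apply: cvg_expr; rewrite ger0_norm ?invr_ge0// invf_lt1// ltr1n.
Qed.

Context (N : nat).
Implicit Types (X P : 'M[R[i]]_N).

Local Notation q X v := (Re (hform X v v)).

Lemma hform_cvg0 X (d : nat -> 'rV[R[i]]_N) :
  (forall k, cabs (d n 0 k) @[n --> \oo] --> (0 : R)) ->
  cabs (hform X (d n) (d n)) @[n --> \oo] --> (0 : R).
Proof.
move=> d0.
have h : \sum_k \sum_l cabs (d n 0 k) * cabs (d n 0 l) * cabs (X k l) @[n --> \oo] -->
    \sum_k \sum_l 0 * 0 * cabs (X k l).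
  apply: cvg_big => [|k _]; first exact: add_continuous.
  apply: cvg_big => [|l _]; first exact: add_continuous.
  by apply: cvgM; [apply: cvgM; exact: d0|exact: cvg_cst].
rewrite big1 in h; last by move=> k _; rewrite big1// => l _; rewrite !mul0r.
apply: (squeeze_cvgr (f := fun=> 0)); [|exact: cvg_cst|exact: h].
apply: nearW => n; rewrite cabs_ge0/= hformE2.
apply: le_trans (cabs_sum _ _) _; apply: ler_sum => k _.
apply: le_trans (cabs_sum _ _) _; apply: ler_sum => l _.
by rewrite !cabsM cabs_conj.
Qed.

(** The difference v - v P lies in the kernel of the form, because P X = X. *)
Lemma q_mulP X P v : X \is hermsymmx -> P *m X = X -> forall u,
  q X (u - v *m P) = q X (u - v).
Proof.
move=> Xh PX u; set b := v - v *m P.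
have b0 w : hform X b w = 0 by rewrite /hform mulmxBl -mulmxA PX subrr mul0mx mxE.
have -> : u - v *m P = (u - v) + b by rewrite /b addrA subrK.
by rewrite (hformDl _ (u - v) b) b0 addr0 (hformDr _ (u - v) b) (hform_herm b _ Xh) b0 conjC0 addr0.
Qed.

(** Splitting off one increment by q(a + b) <= 2 q(a) + 2 q(b) costs a factor 2 each time; the
    weights 2^k absorb it. *)
Lemma good_chain X (u : nat -> 'rV[R[i]]_N) n j : good X ->
  2 ^+ n * q X (u n - u (n + j)%N) <=
  2 * \sum_(n <= k < n + j) 2 ^+ k * q X (u k.+1 - u k).
Proof.
move=> gX; elim: j n => [|j IHj] n.
  by rewrite addn0 subrr hform0l mulr0 big_geq// mulr0.
rewrite big_ltn; last by rewrite -addSnnS leq_addr.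
have := IHj n.+1; rewrite addSnnS exprS.
have := good_qD (u n - u n.+1) (u n.+1 - u (n + j.+1)%N) gX; rewrite addrA subrK.
have -> : q X (u n - u n.+1) = q X (u n.+1 - u n).
  by rewrite -opprB hformNl hformNr opprK.
move: (q X _) (q X (u n.+1 - u n)) (q X (u n.+1 - _)) => a b c.
have : 0 < 2 ^+ n :> R by rewrite exprn_gt0.
move: (2 ^+ n) (\sum_(_ <= _ < _) _) => r s r0; nra.
Qed.

(** For singular X the coordinates of u_n are not controlled, but those of u_n P are, by the bound
    on P. Their limit w serves for u_n itself, since the form does not distinguish u_n from u_n
    P. *)
Lemma good_limit X P (c s : R) (u : nat -> 'rV[R[i]]_N) : good X ->
  P *m X = X -> 0 <= c ->
  (forall v j, cabs ((v *m P) 0 j) <= c * Num.sqrt (q X v)) ->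
  (forall n j, 2 ^+ n * q X (u n - u (n + j)%N) <= s) ->
  exists w : 'rV[R[i]]_N, (forall k, cabs ((u n *m P) 0 k - w 0 k) @[n --> \oo] --> (0 : R)) /\
    forall n, q X (u n - w) <= 2 * s / 2 ^+ n.
Proof.
move=> gX PX c0 cP us.
have Xh : X \is hermsymmx by case: gX => -[].
have us' n j : q X (u n - u (n + j)%N) <= s / 2 ^+ n.
  by rewrite ler_pdivlMr ?exprn_gt0// mulrC.
have lim k : exists l, cabs ((u n *m P) 0 k - l) @[n --> \oo] --> (0 : R).
  apply: (complex_cauchy (b := fun n => c * Num.sqrt (s / 2 ^+ n))).
    move=> n j; have -> : (u n *m P) 0 k - (u (n + j)%N *m P) 0 k = ((u n - u (n + j)%N) *m P) 0 k.
      by rewrite mulmxBl !mxE.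
    apply: le_trans (cP _ _) _; by rewrite ler_wpM2l// ler_wsqrtr.
  rewrite -[X in _ --> X](mulr0 c); apply: cvgM; first exact: cvg_cst.
  rewrite -[X in _ --> X]sqrtr0.
  by apply: (cvg_comp _ _ (half_pow_cvg s)); exact: sqrt_continuous.
have [w wP] := choice lim; exists (\row_k w k); split=> [k|n]; first by rewrite mxE.
pose d m := u m *m P - \row_k w k.
have d0 : cabs (hform X (d m) (d m)) @[m --> \oo] --> (0 : R).
  apply: hform_cvg0 => k; have := wP k.
  have E m : (u m *m P) 0 k - w k = d m 0 k by rewrite /d !mxE.
  by under eq_fun do rewrite E.
apply/ler_addgt0Pr => e e0.
have e20 : 0 < e / 2 by rewrite divr_gt0.
move/cvgrPdist_lt : d0 => /(_ _ e20)[m0 _ hm].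
have := hm (m0 + n)%N (leq_addr _ _); rewrite sub0r normrN ger0_norm ?cabs_ge0// => dm.
have -> : u n - \row_k w k = (u n - u (m0 + n)%N *m P) + d (m0 + n)%N.
  by rewrite /d addrA subrK.
apply: le_trans (good_qD _ _ gX) _; rewrite (q_mulP _ Xh PX) [in u (_ + _)%N]addnC.
have := us' n m0; have := le_trans (ler_norm _) (Re_le_cabs (hform X (d (m0 + n)%N) (d (m0 + n)%N))).
rewrite -mulrA; move: (q X _) (q X _) (s / _) (cabs _) dm => a b r z dm h1 h2.
by lra.
Qed.

End pointwise_limit.

(** * Limits of rapidly converging sequences in L^2(M) *)

Section Riesz_Fischer.
Context (R : realType) (N : nat) (M : matrix_measure R N) (D : regular_density M).
Implicit Types (f g h : R -> 'rV[R[i]]_N).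

Local Notation q t v := (Re (hform (D t) v v)).

Lemma cmfun_mx_iter n i j : cmfun (fun t => mx_iter (1%:M - D t) n i j).
Proof.
elim: n i j => [|n IHn] i j; first exact: cmfun_cst.
have -> : (fun t => mx_iter (1%:M - D t) n.+1 i j) =
    fun t => \sum_k mx_iter (1%:M - D t) n i k * ((1%:M : 'M[R[i]]_N) k j - D t k j).
  by apply/funext => t; rewrite /mx_iter iterS mxE; apply: eq_bigr => k _; rewrite !mxE.
apply: cmfun_sum => k; apply: cmfunM; first exact: IHn.
by apply: cmfunB; [exact: cmfun_cst|exact: rdens_cmfun].
Qed.

Lemma range_projection : exists (P : R -> 'M[R[i]]_N) (c : R -> R),
  [/\ forall i j, cmfun (fun t => P t i j), forall t, 0 <= c t,
      forall t, P t *m D t = D t &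
      forall t v j, cabs ((v *m P t) 0 j) <= c t * Num.sqrt (q t v)].
Proof.
have ex t : exists Pc : 'M[R[i]]_N * R, [/\ 0 <= Pc.2,
    forall i j, cabs (mx_iter (1%:M - D t) n i j - (1%:M - Pc.1) i j) @[n --> \oo] --> (0 : R),
    Pc.1 *m D t = D t &
    forall (v : 'rV[R[i]]_N) j, cabs ((v *m Pc.1) 0 j) <= Pc.2 * Num.sqrt (q t v)].
  by have [P [c h]] := good_projection (rdens_good D t); exists (P, c).
have [Pc h] := choice ex.
exists (fun t => (Pc t).1), (fun t => (Pc t).2); split => [i j|t|t|t]; try by have [] := h t.
have m1 : cmfun (fun t => (1%:M - (Pc t).1) i j).
  apply: (cmfun_lim (h_ := fun n t => mx_iter (1%:M - D t) n i j)) => [n|t].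
    exact: cmfun_mx_iter.
  by have [_ /(_ i j)] := h t.
have -> : (fun t => (Pc t).1 i j) = fun t => (1%:M : 'M[R[i]]_N) i j - (1%:M - (Pc t).1) i j.
  by apply/funext => t; rewrite !mxE opprB addrCA subrr addr0.
by apply: cmfunB => //; exact: cmfun_cst.
Qed.

Lemma sqint_q_integrable f : sqint D f ->
  (tau M).-integrable setT (EFin \o (fun t => q t (f t))).
Proof. by move=> /sqint_cinteg[]. Qed.

Lemma nsq_integral f : nsq D f = \int[tau M]_t q t (f t).
Proof. by rewrite nsqE ipE. Qed.

Lemma nsq_eintegral f : sqint D f -> (\int[tau M]_t (q t (f t))%:E)%E = (nsq D f)%:E.
Proof.
move=> fL; rewrite nsq_integral /Rintegral fineK//.
exact: integrable_fin_num (sqint_q_integrable fL).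
Qed.

Lemma sqint_of_bound f (s : R -> R) : vmfun f -> (tau M).-integrable setT (EFin \o s) ->
  (forall t, q t (f t) <= s t) -> sqint D f /\ nsq D f <= \int[tau M]_t s t.
Proof.
move=> mf si qs.
have fL : sqint D f.
  split=> //; apply: (cinteg_le (g := s)) (si); first exact: (cmfun_hform (rdens_cmfun D) mf mf).
  by move=> t; rewrite (q_real D) cabs_real ger0_norm ?(q_ge0 D).
split => //; rewrite nsq_integral; apply: le_Rintegral => //.
exact: sqint_q_integrable fL.
Qed.

Context (f_ : nat -> R -> 'rV[R[i]]_N).
Hypothesis fL : forall n, sqint D (f_ n).
(* The weight 2^n makes the square summable pointwise almost everywhere, the
   partial sums controlling 2^n times the squared distance from f_n to f_m. *)
Hypothesis fast : forall n, 2 ^+ n * nsq D (f_ n.+1 \- f_ n) <= (2 ^ n.+1)%:R^-1.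

Let qd k t := 2 ^+ k * q t (f_ k.+1 t - f_ k t).
Let S t := (\sum_(k <oo) (qd k t)%:E)%E.

Let qd_ge0 k t : 0 <= qd k t.
Proof. by rewrite mulr_ge0 ?exprn_ge0// (q_ge0 D). Qed.

Let qd_integrable k : (tau M).-integrable setT (EFin \o qd k).
Proof. exact: rintegrableZ (sqint_q_integrable (sqintB (fL k.+1) (fL k))). Qed.

Let mqd k : measurable_fun setT (EFin \o qd k).
Proof. by have /integrableP[] := qd_integrable k. Qed.

Let S_ge0 t : (0 <= S t)%E.
Proof. by apply: nneseries_ge0 => k _ _; rewrite lee_fin. Qed.

Let mS : measurable_fun setT S.
Proof.
apply: (ge0_emeasurable_sum (P := xpredT) (h := fun k t => (qd k t)%:E)).
  by move=> k t _ _; rewrite lee_fin.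
by move=> k _; exact: mqd.
Qed.

(** Termwise integration, then the geometric sum of the bounds in [fast]. *)
Let S_integral : (\int[tau M]_t S t <= 1)%E.
Proof.
rewrite integral_nneseries//; last by move=> k t _; rewrite lee_fin.
apply: le_trans (epsilon_trick0 xpredT ler01).
apply: lee_nneseries => k _; first by move=> _; apply: integral_ge0 => t _; rewrite lee_fin.
have -> : (\int[tau M]_t (qd k t)%:E)%E = (2 ^+ k * nsq D (f_ k.+1 \- f_ k))%:E.
  rewrite EFinM -(nsq_eintegral (sqintB (fL k.+1) (fL k))) /qd.
  under eq_integral do rewrite EFinM.
  by rewrite integralZl//; exact: sqint_q_integrable (sqintB (fL k.+1) (fL k)).
by rewrite lee_fin mul1r.
Qed.

Let S_integrable : (tau M).-integrable setT S.
Proof.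
apply/integrableP; split => //; under eq_integral do rewrite gee0_abs//.
exact: le_lt_trans S_integral (ltry _).
Qed.

Let E := [set t | (S t < +oo)%E].

Let mE : measurable E.
Proof. by rewrite -[E]setTI; apply: measurable_lte => //; exact: measurable_cst. Qed.

Let s t := fine (S t).

Let s_integrable : (tau M).-integrable setT (EFin \o s).
Proof.
apply: le_integrable S_integrable => //.
  by apply/measurable_EFinP; apply: measurableT_comp.
move=> t _ /=; rewrite /s; move: (S_ge0 t); case: (S t) => //= _.
by rewrite normr0 leey.
Qed.

(** Setting f_n to 0 where S is infinite changes nothing in norm and makes the estimates valid at
    every t. *)
Let f' n t := (\1_E t)%:C%C *: f_ n t.

Let f'L n : sqint D (f' n).
Proof.
apply: (sqintM (C := 1)) (fL n); first exact: cmfun_indic.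
by move=> t; rewrite cabs_real indicE normr_nat; case: (_ \in _).
Qed.

Let f'_ae n : n2 D (f_ n \- f' n) = 0.
Proof.
rewrite n2E nsq_integral [X in Num.sqrt X](_ : _ = 0) ?sqrtr0//.
have -> : (0 : R) = \int[tau M]_t (cst 0 t : R) by rewrite Rintegral_cst// mul0r.
rewrite /Rintegral; congr fine; apply: ae_eq_integral => //.
- have /integrableP[] // := sqint_q_integrable (sqintB (fL n) (f'L n)).
- by apply/measurable_EFinP; exact: measurable_cst.
- apply: filterS (integrable_ae measurableT S_integrable) => t /(_ I); rewrite ge0_fin_numE// => St _.
  have Et : \1_E t = 1 :> R by rewrite indicE mem_set.
  by rewrite /= /f' Et scale1r subrr hform0l.
Qed.

Lemma sqint_complete : exists2 g, sqint D g &
  forall e, 0 < e -> exists n0, forall n, (n0 <= n)%N -> n2 D (f_ n \- g) < e.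
Proof.
have [P [c [mP c0 PD cP]]] := range_projection.
have chain t n j : 2 ^+ n * q t (f' n t - f' (n + j)%N t) <= 2 * s t.
  apply: le_trans (good_chain (fun k => f' k t) n j (rdens_good D t)) _; rewrite ler_wpM2l//.
  (* Off E every f'_n vanishes; on E the sum from n to n + j is part of the convergent series S. *)
  have [Et|Et] := boolP (t \in E); last first.
    rewrite big1 ?fine_ge0// => k _.
    by rewrite /f' indicE (negbTE Et) !scale0r subrr hform0l mulr0.
  have SE : S t = (s t)%:E.
    by rewrite fineK// ge0_fin_numE//; move: Et; rewrite inE.
  rewrite -lee_fin -SE -sumEFin.
  apply: le_trans (nneseries_lim_ge (n + j) _); last by move=> k _ _; rewrite lee_fin.
  rewrite [leRHS](@big_cat_nat _ _ _ n)//= ?leq_addr//.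
  apply: le_trans (leeDr _ _); last by apply: sume_ge0 => k _; rewrite lee_fin.
  apply: lee_sum => k _.
  by rewrite lee_fin /f' indicE Et !scale1r.
have [g gP] := choice (fun t => good_limit (u := fun n => f' n t) (rdens_good D t) (PD t) (c0 t) (cP t) (chain t)).
have mg : vmfun g.
  move=> k; apply: (cmfun_lim (h_ := fun n t => (f' n t *m P t) 0 k)) => [n|t]; last exact: (gP t).1.
  under eq_fun do rewrite mxE; apply: cmfun_sum => l.
  by apply: cmfunM => //; have [mf _] := f'L n; exact: mf.
(* The pointwise bound of [good_limit], applied with 2 s, is integrated; the second factor 2 of the
   constant 4 is the one in its conclusion. *)
have key n : sqint D (f' n \- g) /\ nsq D (f' n \- g) <= 4 / 2 ^+ n * \int[tau M]_t s t.
  rewrite -RintegralZl//; apply: sqint_of_bound.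
  - move=> k; have [mf _] := f'L n.
    have -> : (fun t => (f' n \- g) t 0 k) = fun t => f' n t 0 k - g t 0 k.
      by apply/funext => t; rewrite !mxE.
    by apply: cmfunB; [exact: mf|exact: mg].
  - exact: rintegrableZ.
  - move=> t; apply: le_trans ((gP t).2 n) _.
    by rewrite mulrA -natrM mulrAC.
have gL : sqint D g.
  have -> : g = f' 0%N \- (f' 0%N \- g) by apply/funext => t /=; rewrite opprB addrCA subrr addr0.
  by apply: sqintB => //; exact: (key _).1.
exists g => // e e0.
have [n0 hn0] : exists n0, forall n, (n0 <= n)%N -> n2 D (f' n \- g) < e.
  apply: (n2_small (h_ := fun n => f' n \- g)) => //.
  apply: (squeeze_cvgr (f := fun=> 0)) (half_pow_cvg (4 * \int[tau M]_t s t)); last exact: cvg_cst.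
  by apply: nearW => n; rewrite nsq_ge0/= mulrAC (key n).2.
exists n0 => n /hn0; apply: le_lt_trans.
by have := n2B_trans (fL n) gL (f'L n); rewrite f'_ae add0r.
Qed.

End Riesz_Fischer.

(** * Polynomials *)

Section vector_polynomials.
Context (R : realType) (N : nat).
Implicit Types (p q : 'rV[{poly R[i]}]_N).

Definition mon (k : nat) (r : 'I_N) : 'rV[{poly R[i]}]_N := 'X^k *: delta_mx 0 r.

Lemma vpoly_ind (P : 'rV[{poly R[i]}]_N -> Prop) : P 0 ->
  (forall p q, P p -> P q -> P (p + q)) -> (forall a p, P p -> P (a%:P *: p)) ->
  (forall k r, P (mon k r)) -> forall p, P p.
Proof.
move=> P0 PD PZ Pm p; rewrite (row_sum_delta p).
apply: (big_ind P) => // r _; rewrite -[p 0 r]coefK poly_def scaler_suml.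
apply: (big_ind P) => // k _; rewrite -mul_polyC -scalerA.
by apply: PZ; exact: Pm.
Qed.

Lemma vpoly_funD p q t : vpoly_fun (p + q) t = vpoly_fun p t + vpoly_fun q t.
Proof. by apply/rowP => k; rewrite !mxE hornerD. Qed.

Lemma vpoly_funZ a p t : vpoly_fun (a%:P *: p) t = a *: vpoly_fun p t.
Proof. by apply/rowP => k; rewrite !mxE hornerM hornerC. Qed.

Lemma vpoly_fun0 t : vpoly_fun (0 : 'rV[{poly R[i]}]_N) t = 0.
Proof. by apply/rowP => k; rewrite !mxE horner0. Qed.

Lemma vpoly_fun_mon k r t : vpoly_fun (mon k r) t = (t%:C)%C ^+ k *: delta_mx 0 r.
Proof.
apply/rowP => j; rewrite !mxE eqxx/=.
by case: (j == r); rewrite ?mulr1 ?mulr0 ?hornerXn ?horner0.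
Qed.

Context (V : lmodType R[i]) (x : nat -> V).

Definition vec p : V := \sum_(r < N) \sum_(i < size (p 0 r)) (p 0 r)`_i *: x (N * i + r)%N.

Lemma vecE p n : (forall r, (size (p ord0 r) <= n)%N) ->
  vec p = \sum_(r < N) \sum_(i < n) (p 0 r)`_i *: x (N * i + r)%N.
Proof.
move=> pn; apply: eq_bigr => r _.
rewrite (big_ord_widen n (fun i => (p 0 r)`_i *: x (N * i + r)%N))//.
rewrite big_mkcond; apply: eq_bigr => i _; case: ltnP => // h.
by rewrite nth_default// scale0r.
Qed.

Lemma vec0 : vec 0 = 0.
Proof. by rewrite /vec big1// => r _; rewrite mxE size_poly0 big_ord0. Qed.

Lemma size_row_bound p : exists n, forall r, (size (p ord0 r) <= n)%N.
Proof. by exists (\max_r size (p ord0 r))%N => r; exact: leq_bigmax. Qed.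

Lemma vecD p q : vec (p + q) = vec p + vec q.
Proof.
have [n pn] := size_row_bound p; have [m qm] := size_row_bound q.
rewrite !(@vecE _ (maxn n m)).
- rewrite -big_split; apply: eq_bigr => r _; rewrite -big_split; apply: eq_bigr => i _.
  by rewrite !mxE coefD scalerDl.
- by move=> r; rewrite leq_max qm orbT.
- by move=> r; rewrite leq_max pn.
- move=> r; rewrite mxE; apply: leq_trans (size_polyD _ _) _.
  by rewrite geq_max !leq_max pn qm orbT.
Qed.

Lemma vecZ a p : vec (a%:P *: p) = a *: vec p.
Proof.
have [n pn] := size_row_bound p.
rewrite !(@vecE _ n)//; last first.
  by move=> r; rewrite mxE mul_polyC (leq_trans (size_scale_leq _ _)).
rewrite scaler_sumr; apply: eq_bigr => r _; rewrite scaler_sumr; apply: eq_bigr => i _.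
by rewrite mxE coefCM scalerA.
Qed.

Lemma vec_mon k r : vec (mon k r) = x (N * k + r)%N.
Proof.
rewrite /vec (bigD1 r)//= [X in _ + X]big1 ?addr0; last first.
  by move=> j jr; rewrite !mxE (negbTE jr) andbF mulr0 size_poly0 big_ord0.
rewrite !mxE !eqxx mulr1 size_polyXn big_ord_recr/= big1 ?add0r; last first.
  by move=> i _; rewrite coefXn ltn_eqF// scale0r.
by rewrite coefXn eqxx scale1r.
Qed.

Lemma Lin_vec (hN : (0 < N)%N) u : Lin x u -> exists p, u = vec p.
Proof.
move=> [n [c ->]]; elim: n => [|n [p IHn]].
  by exists 0; rewrite big_ord0 vec0.
rewrite big_ord_recr/= IHn.
exists (p + (c n)%:P *: mon (n %/ N) (Ordinal (ltn_pmod n hN))).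
by rewrite vecD vecZ vec_mon/= mulnC -divn_eq.
Qed.

End vector_polynomials.
Arguments mon {R N}.

Section polynomials_in_L2.
Context (R : realType) (N : nat) (hN : (0 < N)%N) (M : matrix_measure R N)
  (D : regular_density M).
Hypothesis hM : forall n k l, cintegrable (M k l) (fun t => (t%:C)%C ^+ n).
Implicit Types (p q : 'rV[{poly R[i]}]_N) (c : R -> R[i]).

Lemma cdens_rdens k l : cdens (M k l) (tau M) (fun t => D t k l).
Proof.
have [di dE] := cdens_density M k l.
have dD : {ae tau M, forall t, density M t k l = D t k l}.
  by apply: filterS (rdens_ae D) => t ->.
split; first exact: ae_eq_cinteg (rdens_cmfun D k l) dD di.
move=> A mA; rewrite dE//; apply: ae_eq_cint.
- by apply: cmfunM; [exact: cmfun_indic|exact: cinteg_cmfun di].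
- by apply: cmfunM; [exact: cmfun_indic|exact: rdens_cmfun].
- by apply: filterS dD => t ->.
Qed.

Lemma cmfun_id_real : cmfun (fun t : R => (t%:C)%C : R[i]).
Proof. exact: cmfun_real. Qed.

Lemma cinteg_moment n k l : cinteg (tau M) (fun t => (t%:C)%C ^+ n * D t k l).
Proof.
have [h _] := cintegrable_dens (cdens_rdens k l) (cmfunX n cmfun_id_real).
exact/h/hM.
Qed.

Lemma sqint_vpoly p : sqint D (vpoly_fun p).
Proof.
have s0 : sqint D (fun=> 0).
  split; first by move=> k; under eq_fun do rewrite mxE; exact: cmfun_cst.
  by under eq_fun do rewrite hform0l; exact: cinteg0.
elim/vpoly_ind : p => [|p q pL qL|a p pL|k r].
- by have -> : vpoly_fun 0 = fun=> 0 :> 'rV[R[i]]_N by apply/funext => t; rewrite vpoly_fun0.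
- have -> : vpoly_fun (p + q) = vpoly_fun p \+ vpoly_fun q :> (R -> _).
    by apply/funext => t; rewrite vpoly_funD.
  exact: (sqintD pL qL).
- have -> : vpoly_fun (a%:P *: p) = fun t => a *: vpoly_fun p t.
    by apply/funext => t; rewrite vpoly_funZ.
  exact: (sqintZ a pL).
- have -> : vpoly_fun (mon k r) = (fun t => (t%:C)%C ^+ k *: delta_mx 0 r) :> (R -> 'rV[R[i]]_N).
    by apply/funext => t; rewrite vpoly_fun_mon.
  split.
    move=> j; under eq_fun do rewrite mxE; apply: cmfunM; last exact: cmfun_cst.
    exact: (cmfunX k cmfun_id_real).
  under eq_fun do rewrite hformZl hformZr mulrA hform_delta rmorphXn/= conj_real -exprD.
  exact: cinteg_moment.
Qed.

(** Both sides are sesquilinear in (p, q), so monomials suffice. With c = 1 and T = 1 it yields the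
    isometry, with resolvents the identities used for (iv) => (i). *)
Lemma ip_multiplier_vpoly (H : completeNormedModType R[i])
    (dot : {dot H for (@Num.conj R[i])}) (x : nat -> H) (T : {linear H -> H})
    c (C : R) : cmfun c -> (forall t, cabs (c t) <= C) ->
  (forall (k l : nat) (r s : 'I_N), dot (T (x (N * k + r)%N)) (x (N * l + s)%N) =
     cintegral (M r s) (fun t => (t%:C)%C ^+ (k + l) * c t)) ->
  forall p q, ip D (fun t => c t *: vpoly_fun p t) (vpoly_fun q) =
    dot (T (vec x p)) (vec x q).
Proof.
move=> mc cC Tx p q; have cL f : sqint D f -> sqint D (fun t => c t *: f t) by exact: sqintM.
elim/vpoly_ind : p => [|p p' IH IH'|a p IH|k r].
- have -> : (fun t => c t *: vpoly_fun 0 t) = fun t => (0 : R[i]) *: vpoly_fun q t.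
    by apply/funext => t; rewrite vpoly_fun0 scaler0 scale0r.
  by rewrite (ipZl _ (sqint_vpoly q) (sqint_vpoly q)) mul0r vec0 linear0 dot0l.
- have -> : (fun t => c t *: vpoly_fun (p + p') t) =
      (fun t => c t *: vpoly_fun p t) \+ (fun t => c t *: vpoly_fun p' t).
    by apply/funext => t; rewrite vpoly_funD scalerDr.
  rewrite (ipDl (cL _ (sqint_vpoly p)) (cL _ (sqint_vpoly p')) (sqint_vpoly q)).
  by rewrite IH IH' vecD linearD dotDl.
- have -> : (fun t => c t *: vpoly_fun (a%:P *: p) t) = fun t => a *: (c t *: vpoly_fun p t).
    by apply/funext => t; rewrite vpoly_funZ scalerA mulrC -scalerA.
  rewrite (ipZl a (cL _ (sqint_vpoly p)) (sqint_vpoly q)).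
  by rewrite IH vecZ linearZ dotZl.
- rewrite vec_mon; elim/vpoly_ind : q => [|q q' IH IH'|a q IH|l s].
  + have -> : vpoly_fun 0 = fun t => (0 : R[i]) *: vpoly_fun (mon k r) t.
      by apply/funext => t; rewrite vpoly_fun0 scale0r.
    rewrite (ipZr _ (sqint_vpoly _) (cL _ (sqint_vpoly _))).
    by rewrite conjC0 mul0r vec0 dot0r.
  + have -> : vpoly_fun (q + q') = vpoly_fun q \+ vpoly_fun q' :> (R -> _).
      by apply/funext => t; rewrite vpoly_funD.
    rewrite (ipDr (sqint_vpoly q) (sqint_vpoly q') (cL _ (sqint_vpoly _))).
    by rewrite IH IH' vecD dotDr.
  + have -> : vpoly_fun (a%:P *: q) = fun t => a *: vpoly_fun q t.
      by apply/funext => t; rewrite vpoly_funZ.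
    rewrite (ipZr a (sqint_vpoly q) (cL _ (sqint_vpoly _))).
    by rewrite IH vecZ dotZr.
  + rewrite vec_mon Tx ipE.
    have mX := cmfunX (k + l) cmfun_id_real.
    have [h1 ->] := cintegrable_dens (cdens_rdens r s) (cmfunM mX mc).
      apply: eq_cint => t; rewrite !vpoly_fun_mon scalerA hformZl hformZr hform_delta.
      by rewrite rmorphXn/= conj_real exprD; ring.
    apply/h1; have := cintegM_bounded mc cC (cinteg_moment (k + l) r s).
    by under eq_fun do rewrite mulrCA mulrA.
Qed.

End polynomials_in_L2.

Section L2_more.
Context (R : realType) (N : nat) (M : matrix_measure R N) (D : regular_density M).
Implicit Types (f g : R -> 'rV[R[i]]_N) (c : R -> R[i]).

Lemma n2_self f : sqint D f -> n2 D (f \- f) = 0.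
Proof.
move=> fL; rewrite n2E (nsqB fL fL) nsqE; move: (Re _) => a.
by rewrite (_ : a + a - 2 * a = 0) ?sqrtr0//; ring.
Qed.

Lemma ip_multiplier_adj c f g :
  ip D (fun t => c t *: f t) g = ip D f (fun t => (c t)^* *: g t).
Proof. by rewrite !ipE; apply: eq_cint => t; rewrite hformZl hformZr conjCK. Qed.

(** Integrated form of r - conj r = (z - conj z) |r|^2 for r = 1/(t - z). Together with its
    counterpart [resolvent_norm] in H, it lets equality of norms follow from equality of scalar
    products with f. *)
Lemma ip_resolvent_norm z f : Im z != 0 -> sqint D f ->
  let g := fun t => resolvent_fun z t *: f t in
  (z - z^*) * ip D g g = ip D g f - ip D f g.
Proof.
move=> z0 fL g; have gL : sqint D g.
  apply: (sqintM (C := `|Im z|^-1)) => //; first exact: cmfun_resolvent.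
  by move=> t; exact: resolvent_bound_fun.
rewrite !ipE -cintZ; last exact: ip_cinteg.
rewrite -cintB; [|exact: ip_cinteg..].
apply: eq_cint => t; rewrite /g !(hformZl, hformZr) mulrA mulrA -mulrBl; congr (_ * _).
have r0 := resolvent_neq0 t z0; have r1 : (t%:C)%C - z^* != 0.
  by apply: resolvent_neq0; rewrite ImJ oppr_eq0.
rewrite /resolvent_fun fmorphV/= rmorphB/= conj_real.
by move: r0 r1; move: (t%:C)%C (z^*) => a b r0 r1; field; rewrite r0 r1.
Qed.

Lemma n2_multiplier_le c (C : R) f : cmfun c -> (forall t, cabs (c t) <= C) -> sqint D f ->
  n2 D (fun t => c t *: f t) <= C * n2 D f.
Proof.
move=> mc cC fL; have C0 : 0 <= C by exact: le_trans (cabs_ge0 _) (cC 0).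
have cfL := sqintM mc cC fL.
have h : nsq D (fun t => c t *: f t) <= C ^+ 2 * nsq D f.
  rewrite (nsq_integral D (fun t => c t *: f t)) (nsq_integral D f).
  rewrite -RintegralZl//; last exact: sqint_q_integrable fL.
  apply: le_Rintegral => //.
  - exact: sqint_q_integrable cfL.
  - by apply: rintegrableZ; exact: sqint_q_integrable fL.
  - by move=> t _; rewrite (qZ D) ler_wpM2r ?(q_ge0 D)// ler_pXn2r// nnegrE ?cabs_ge0.
rewrite (n2E D (fun t => c t *: f t)) (n2E D f).
apply: le_trans (ler_wsqrtr h) _; move: (nsq D f) => a.
by rewrite sqrtrM ?sqr_ge0// sqrtr_sqr ger0_norm.
Qed.

End L2_more.

Section dot_more.
Context (R : realType) (H : completeNormedModType R[i]).
Context (dot : {dot H for (@Num.conj R[i])}).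
Hypothesis hdot : forall u, dot u u = `|u| ^+ 2.

Lemma hnormB_sqr u v : hnorm (u - v) ^+ 2 =
  hnorm u ^+ 2 + hnorm v ^+ 2 - 2 * Re (dot u v).
Proof.
have E w : hnorm w ^+ 2 = Re (dot w w) by rewrite (dotE hdot).
rewrite !E dotBl !dotBr (dotC dot v u).
move: (dot u u) (dot u v) (dot v v) => [a a'] [b b'] [c c'] /=.
by ring.
Qed.

Lemma resolvent_norm T z u y : self_adjoint dot T -> T (y, u + z *: y) ->
  (z - z^*) * dot y y = dot y u - dot u y.
Proof.
move=> Tsa Ty; have := sa_symmetric Tsa Ty Ty.
rewrite dotDl dotDr dotZl dotZr => e.
have -> : dot y u = dot u y + z * dot y y - z^* * dot y y by rewrite e addrK.
by ring.
Qed.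

Lemma resolvent_adj T z u v y w : self_adjoint dot T -> T (y, u + z *: y) ->
  T (w, v + z^* *: w) -> dot y v = dot u w.
Proof.
move=> Tsa Ty Tw; have := sa_symmetric Tsa Ty Tw.
by rewrite dotDl dotDr dotZl dotZr conjCK => /addIr.
Qed.

End dot_more.

(** * The polynomials in H and in L^2(M) *)

Section polynomial_isometry.
Context (R : realType) (N : nat) (hN : (0 < N)%N) (M : matrix_measure R N)
  (D : regular_density M).
Hypothesis hM : forall n k l, cintegrable (M k l) (fun t => (t%:C)%C ^+ n).
Context (H : completeNormedModType R[i]) (dot : {dot H for (@Num.conj R[i])}).
Hypothesis hdot : forall u, dot u u = `|u| ^+ 2.
Context (x : nat -> H).
Hypothesis hspan : closure (Lin x) = [set: H].
Hypothesis hGamma : forall (k l : nat) (r s : 'I_N),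
  dot (x (N * k + r)%N) (x (N * l + s)%N) = moment M (k + l) r s.

Local Notation vec := (@vec R N H x).

Lemma ip_vpoly p q : ip D (vpoly_fun p) (vpoly_fun q) = dot (vec p) (vec q).
Proof.
have mc : cmfun (fun _ : R => 1 : R[i]) by exact: cmfun_cst.
have h (k l : nat) (r s : 'I_N) : dot ((idfun : {linear H -> H}) (x (N * k + r)%N)) (x (N * l + s)%N) =
    cintegral (M r s) (fun t => (t%:C)%C ^+ (k + l) * 1).
  rewrite /= hGamma mxE; congr cintegral.
  by apply/funext => t; rewrite mulr1.
have /= <- := ip_multiplier_vpoly D hM mc (fun=> lexx _) h p q.
by rewrite !ipE; apply: eq_cint => t; rewrite scale1r.
Qed.

Lemma dense_vec u (e : R) : 0 < e -> exists p, hnorm (u - vec p) < e.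
Proof.
move=> e0; have : closure (Lin x) u by rewrite hspan.
move=> /closure_hnormP/(_ _ e0)[v /(Lin_vec hN)[p ->]]; by exists p.
Qed.

(** Both squared distances expand into the same norms and scalar product. This compares f with u
    before any isomorphism between L^2(M) and H is available. *)
Lemma nsq_vpolyB f u q : sqint D f -> nsq D f = hnorm u ^+ 2 ->
  ip D f (vpoly_fun q) = dot u (vec q) -> n2 D (f \- vpoly_fun q) = hnorm (u - vec q).
Proof.
move=> fL fu fq; have qL := sqint_vpoly D hM q.
have nq : nsq D (vpoly_fun q) = hnorm (vec q) ^+ 2 by rewrite nsqE ip_vpoly (dotE hdot).
apply/eqP; rewrite -(@eqrXn2 _ 2)// ?n2_ge0 ?hnorm_ge0// n2_sqr (nsqB fL qL).
by rewrite (hnormB_sqr hdot) fu fq nq.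
Qed.

Lemma nsq_vpoly p : nsq D (vpoly_fun p) = hnorm (vec p) ^+ 2.
Proof. by rewrite nsqE ip_vpoly (dotE hdot). Qed.

(** The closure of the polynomials, which plays the role of the subspace S of the multiplier
    argument. *)
Definition approximable f := sqint D f /\
  forall e : R, 0 < e -> exists p, n2 D (f \- vpoly_fun p) < e.

Lemma approximableD f g : approximable f -> approximable g -> approximable (f \+ g).
Proof.
move=> [fL fa] [gL ga]; split=> [|e e0]; first exact: (sqintD fL gL).
have e20 : 0 < e / 2 by rewrite divr_gt0.
have [p fp] := fa _ e20; have [q gq] := ga _ e20; exists (p + q).
have -> : (f \+ g) \- vpoly_fun (p + q) = (f \- vpoly_fun p) \+ (g \- vpoly_fun q).
  by apply/funext => t /=; rewrite vpoly_funD opprD addrACA.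
have := n2D (sqintB fL (sqint_vpoly D hM p)) (sqintB gL (sqint_vpoly D hM q)).
by move: (n2 D _) (n2 D _) (n2 D _) fp gq => a b c; lra.
Qed.

Lemma approximable_closed f : sqint D f ->
  (forall e : R, 0 < e -> exists2 g, approximable g & n2 D (f \- g) < e) -> approximable f.
Proof.
move=> fL fa; split=> // e e0; have e20 : 0 < e / 2 by rewrite divr_gt0.
have [g [gL /(_ _ e20)[p gp]] fg] := fa _ e20; exists p.
have := n2B_trans fL (sqint_vpoly D hM p) gL.
by move: (n2 D _) (n2 D _) (n2 D _) fg gp => a b c; lra.
Qed.

Lemma approximable_vpoly p : approximable (vpoly_fun p).
Proof.
split=> [|e e0]; first exact: sqint_vpoly; exists p.
by rewrite (n2_self (sqint_vpoly D hM p)).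
Qed.

Lemma approximable_multiplier c (C : R) f : cmfun c -> (forall t, cabs (c t) <= C) ->
  (forall p, approximable (fun t => c t *: vpoly_fun p t)) ->
  approximable f -> approximable (fun t => c t *: f t).
Proof.
move=> mc cC cp [fL fa]; have C0 : 0 <= C by exact: le_trans (cabs_ge0 _) (cC 0).
apply: approximable_closed => [|e e0]; first exact: sqintM cC fL.
have e1 : 0 < e / (C + 1) by rewrite divr_gt0// ltr_wpDl.
have [p fp] := fa _ e1; exists (fun t => c t *: vpoly_fun p t) => //.
have -> : (fun t => c t *: f t) \- (fun t => c t *: vpoly_fun p t) =
    fun t => c t *: (f \- vpoly_fun p) t.
  by apply/funext => t; rewrite /= scalerBr.
apply: le_lt_trans (n2_multiplier_le mc cC (sqintB fL (sqint_vpoly D hM p))) _.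
move: fp; rewrite ltr_pdivlMr ?ltr_wpDl//; have := n2_ge0 D (f \- vpoly_fun p).
by move: (n2 D _) => a; nra.
Qed.

Lemma approximableZ a f : approximable f -> approximable (fun t => a *: f t).
Proof.
move=> fA; apply: (approximable_multiplier (c := fun=> a) (C := cabs a)) fA => //.
move=> p; have -> : (fun t => a *: vpoly_fun p t) = vpoly_fun (a%:P *: p).
  by apply/funext => t; rewrite vpoly_funZ.
exact: approximable_vpoly.
Qed.

Section resolvents.
Variable B : set (H * H).
Hypothesis Bsa : self_adjoint dot B.
Hypothesis hres : forall z, 0 < Im z -> exists T : {linear H -> H},
  (forall u, B (T u, u + z *: T u)) /\
  forall (k l : nat) (r s : 'I_N), dot (T (x (N * k + r)%N)) (x (N * l + s)%N) =
    cintegral (M r s) (fun t => (t%:C)%C ^+ (k + l) * resolvent_fun z t).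

Lemma ip_resolvent_vpoly z : Im z != 0 -> exists T : {linear H -> H},
  (forall u, B (T u, u + z *: T u)) /\
  forall p q, ip D (fun t => resolvent_fun z t *: vpoly_fun p t) (vpoly_fun q) =
    dot (T (vec p)) (vec q).
Proof.
have up w : 0 < Im w -> exists T : {linear H -> H},
    (forall u, B (T u, u + w *: T u)) /\
    forall p q, ip D (fun t => resolvent_fun w t *: vpoly_fun p t) (vpoly_fun q) =
      dot (T (vec p)) (vec q).
  move=> w0; have [T [TB Tx]] := hres w0; exists T; split => //.
  have w1 : Im w != 0 by rewrite gt_eqF.
  exact: (ip_multiplier_vpoly D hM (cmfun_resolvent w1) (fun t => resolvent_bound_fun t w1) Tx).
move=> z0; have [zp|zn] := ltP 0 (Im z); first exact: up.
(* The data concern the upper half-plane only. Below the axis, the resolvent is the adjoint of the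
   one at conj z, both for B and for multiplication by 1/(t - z). *)
have [|T [TB Tp]] := up z^*; first by rewrite ImJ oppr_gt0 lt_def eq_sym z0.
have [T' TB'] := resolvent_ex hdot Bsa z0.
exists T'; split => // p q.
have pL := sqint_vpoly D hM p; have qL := sqint_vpoly D hM q.
have rE : (fun t => (resolvent_fun z t)^* *: vpoly_fun q t) =
    fun t => resolvent_fun z^* t *: vpoly_fun q t.
  by apply/funext => t; rewrite /resolvent_fun fmorphV/= rmorphB/= conj_real.
have z1 : Im z^* != 0 by rewrite ImJ oppr_eq0.
have rL : sqint D (fun t => resolvent_fun z^* t *: vpoly_fun q t).
  apply: (sqintM (C := `|Im z^*|^-1)) (qL); first exact: cmfun_resolvent.
  by move=> t; exact: resolvent_bound_fun.
rewrite ip_multiplier_adj rE (ipC pL rL) Tp (resolvent_adj Bsa (TB' _) (TB _)).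
by symmetry; exact: dotC.
Qed.

(* The distance from a polynomial q to p/(t - z) is that from [vec q] to
   [T (vec p)] in H, by the resolvent identities on both sides. *)
Lemma approximable_resolvent z f : Im z != 0 -> approximable f ->
  approximable (fun t => resolvent_fun z t *: f t).
Proof.
move=> z0; have rb t := resolvent_bound_fun t z0.
apply: (approximable_multiplier (cmfun_resolvent z0) rb) => p.
have [T [TB Tp]] := ip_resolvent_vpoly z0.
have pL := sqint_vpoly D hM p; have gL := sqintM (cmfun_resolvent z0) rb pL.
have zz : z - z^* != 0.
  by apply: contra_neq z0 => /(congr1 (@complex.Im R)); rewrite ImD ImN ImJ/=; lra.
have nrm : nsq D (fun t => resolvent_fun z t *: vpoly_fun p t) = hnorm (T (vec p)) ^+ 2.
  rewrite nsqE; have -> : hnorm (T (vec p)) ^+ 2 = Re (dot (T (vec p)) (T (vec p))).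
    by rewrite (dotE hdot).
  congr Re; apply: (mulfI zz).
  rewrite (ip_resolvent_norm z0 pL) (resolvent_norm Bsa (TB _)) (ipC pL gL) Tp.
  by congr (_ - _); symmetry; exact: dotC.
split=> // e e0; have [q Tq] := dense_vec (T (vec p)) e0.
by exists q; rewrite (nsq_vpolyB gL nrm (Tp p q)).
Qed.

Lemma resolvents_approximable f : sqint D f -> approximable f.
Proof.
apply: resolvent_stable_full.
- by move=> g [].
- exact: approximableD.
- exact: approximableZ.
- exact: approximable_closed.
- by move=> z g; exact: approximable_resolvent.
- have -> : (fun=> 0) = vpoly_fun 0 :> (R -> 'rV[R[i]]_N).
    by apply/funext => t; rewrite vpoly_fun0.
  exact: approximable_vpoly.
- move=> k; have -> : (fun=> delta_mx 0 k) = vpoly_fun (mon 0 k) :> (R -> 'rV[R[i]]_N).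
    by apply/funext => t; rewrite vpoly_fun_mon expr0 scale1r.
  exact: approximable_vpoly.
Qed.

End resolvents.
End polynomial_isometry.

(** * The isomorphism of H with L^2(M) *)

Section vector_limits.
Context (R : realType) (H : completeNormedModType R[i]).

Lemma cvg_hnorm (F : set_system R) {FF : Filter F} (g : R -> H) l :
  (forall e : R, 0 < e -> \forall s \near F, hnorm (l - g s) < e) -> g s @[s --> F] --> l.
Proof.
move=> h; apply/cvgrPdist_lt => e e0.
have er : (Re e)%:C%C = e by rewrite RRe_real// gtr0_real.
have e1 : 0 < Re e by rewrite -ltcR er.
by apply: filterS (h _ e1) => s hs; rewrite normE -er ltcR.
Qed.

End vector_limits.

Section shift_operator.
Context (R : realType) (H : completeNormedModType R[i]) (N : nat) (x : nat -> H).

Lemma shift_operator_gen k : shift_operator N x (x k, x (k + N)%N).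
Proof.
exists k.+1, (fun i => (i == k)%:R).
rewrite big_ord_recr/= eqxx scale1r big1 ?add0r// => i _.
by rewrite ltn_eqF// scale0r.
Qed.

Lemma linear_rel_Lin (B : set (H * H)) : linear_rel B ->
  (forall k, B (x k, x (k + N)%N)) -> shift_operator N x `<=` B.
Proof.
move=> [B0 BL] gen _ [n [c ->]]; elim: n => [|n IHn]; first by rewrite big_ord0.
rewrite big_ord_recr/= addrC.
move: (\sum_(_ < _) _) IHn => [a b] Bab; exact: (BL _ _ _ _ _ (gen n) Bab).
Qed.

End shift_operator.

Section indicators.
Context (R : realType) (N : nat) (M : matrix_measure R N) (D : regular_density M).
Implicit Types (f g : R -> 'rV[R[i]]_N) (A B : set R).

Definition cut A f t : 'rV[R[i]]_N := (\1_A t)%:C%C *: f t.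

Lemma sqint_cut A f : measurable A -> sqint D f -> sqint D (cut A f).
Proof.
by move=> mA fL; apply: (sqintM (C := 1)) (fL); [exact: cmfun_indic|exact: cabs_indic].
Qed.

(** Dominated convergence along the sequence A_n. Uniformity over the subsets B carries the result
    from sequences to the limits in a real parameter required of a resolution of unity. *)
Lemma n2_cut_small (A_ : nat -> set R) f : (forall n, measurable (A_ n)) ->
  (forall t, exists n0, forall n, (n0 <= n)%N -> ~ A_ n t) -> sqint D f ->
  forall e, 0 < e -> exists n, forall B, measurable B -> B `<=` A_ n -> n2 D (cut B f) < e.
Proof.
move=> mA A0 fL e e0.
have [||t|t|t|n0 hn0] := @multiplier_cvg _ _ _ D (fun n t => (\1_(A_ n) t)%:C%C) (fun=> 0) 1 f _ _ _ _ _ fL _ e0.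
- by move=> n; exact: cmfun_indic.
- exact: cmfun_cst.
- by move=> s; exact: cabs_indic.
- by rewrite cabs0.
- have [n0 hn] := A0 t; apply: cvg_near_cst; exists n0 => // n /= /hn h.
  by rewrite indicE memNset// subr0 cabs0.
have := hn0 n0 (leqnn _); set g := _ \- _ => gn; exists n0 => B mB BA.
have gL : sqint D (cut (A_ n0) f) by exact: sqint_cut.
have gE : g = \- cut (A_ n0) f by apply/funext => t; rewrite /g/= scale0r sub0r.
rewrite gE (n2N gL) in gn.
have -> : cut B f = fun t => (\1_B t)%:C%C *: cut (A_ n0) f t.
  apply/funext => t; rewrite /cut scalerA -rmorphM/= !indicE; congr (_%:C%C *: _).
  have [tB|] := boolP (t \in B); last by rewrite mul0r.
  by rewrite mem_set ?mul1r//; apply: BA; rewrite inE in tB.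
have := n2_multiplier_le (cmfun_indic mB) (cabs_indic B) gL.
by rewrite mul1r => /le_lt_trans; apply.
Qed.

End indicators.

Section Hilbert_isomorphism.
Context (R : realType) (N : nat) (hN : (0 < N)%N) (M : matrix_measure R N)
  (D : regular_density M).
Hypothesis hM : forall n k l, cintegrable (M k l) (fun t => (t%:C)%C ^+ n).
Context (H : completeNormedModType R[i]) (dot : {dot H for (@Num.conj R[i])}).
Hypothesis hdot : forall u, dot u u = `|u| ^+ 2.
Context (x : nat -> H).
Hypothesis hspan : closure (Lin x) = [set: H].
Hypothesis hGamma : forall (k l : nat) (r s : 'I_N),
  dot (x (N * k + r)%N) (x (N * l + s)%N) = moment M (k + l) r s.
Hypothesis full : forall f, sqint D f ->
  forall e : R, 0 < e -> exists p, n2 D (f \- vpoly_fun p) < e.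

Local Notation vec := (@vec R N H x).

Let pL p := sqint_vpoly D hM p.

Lemma n2_vpolyB p q : n2 D (vpoly_fun p \- vpoly_fun q) = hnorm (vec p - vec q).
Proof.
apply: (nsq_vpolyB hM hdot hGamma) (pL p) _ _; first exact: nsq_vpoly.
exact: ip_vpoly.
Qed.

Lemma n2_vpoly p : n2 D (vpoly_fun p) = hnorm (vec p).
Proof. by rewrite n2E (nsq_vpoly D hM hdot hGamma) sqrtr_sqr ger0_norm ?hnorm_ge0. Qed.

(* The graph of the isomorphism of H with L^2(M) mapping vec p to p. *)
Definition rel u f := sqint D f /\ forall e : R, 0 < e ->
  exists p, n2 D (f \- vpoly_fun p) < e /\ hnorm (u - vec p) < e.

Lemma rel_vpoly p : rel (vec p) (vpoly_fun p).
Proof.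
by split=> // e e0; exists p; rewrite (n2_self (pL p)) subrr hnorm0.
Qed.

Lemma rel_lin a u v f g : rel u f -> rel v g ->
  rel (a *: u + v) (fun t => a *: f t + g t).
Proof.
move=> [fL fa] [gL ga]; have afL := sqintZ a fL.
split=> [|e e0]; first exact: (sqintD afL gL).
pose b := cabs a + 1; have b0 : 0 < b by rewrite ltr_wpDl// cabs_ge0.
have e1 : 0 < e / 2 / b by rewrite !divr_gt0.
have e2 : 0 < e / 2 by rewrite divr_gt0.
have [p [fp up]] := fa _ e1; have [q [gq vq]] := ga _ e2.
exists (a%:P *: p + q); split.
- have -> : (fun t => a *: f t + g t) \- vpoly_fun (a%:P *: p + q) =
      (fun t => a *: (f \- vpoly_fun p) t) \+ (g \- vpoly_fun q).
    by apply/funext => t /=; rewrite vpoly_funD vpoly_funZ opprD addrACA scalerBr.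
  have fpL := sqintB fL (pL p).
  apply: le_lt_trans (n2D (sqintZ a fpL) (sqintB gL (pL q))) _.
  by rewrite (n2Z a fpL); apply: lin_bound fp gq; [exact: cabs_ge0|exact: n2_ge0].
- by rewrite vecD vecZ; exact: hnorm_lin.
Qed.

Lemma relB u v f g : rel u f -> rel v g -> rel (u - v) (f \- g).
Proof.
move=> uf vg; have := rel_lin (-1) vg uf.
have -> : (fun t => -1 *: g t + f t) = f \- g.
  by apply/funext => t; rewrite scaleN1r addrC.
by rewrite scaleN1r addrC.
Qed.

Lemma rel_norm u f : rel u f -> n2 D f = hnorm u.
Proof.
move=> [fL fa]; apply/eqP; rewrite eq_le; apply/andP; split; apply/ler_addgt0Pr => e e0;
  have e2 : 0 < e / 2 by [rewrite divr_gt0].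
all: have [p [fp up]] := fa _ e2.
- have := n2D (sqintB fL (pL p)) (pL p).
  have -> : (f \- vpoly_fun p) \+ vpoly_fun p = f by apply/funext => t /=; rewrite subrK.
  rewrite n2_vpoly; have := hnormD (vec p - u) u; rewrite subrK hnormBC.
  by move: (n2 D _) (n2 D _) (hnorm _) (hnorm _) (hnorm _) fp up => a b c d r; lra.
- have := n2D (sqintB (pL p) fL) fL.
  have -> : (vpoly_fun p \- f) \+ f = vpoly_fun p by apply/funext => t /=; rewrite subrK.
  rewrite n2_vpoly (n2BC (pL p) fL); have := hnormD (u - vec p) (vec p); rewrite subrK.
  by move: (n2 D _) (n2 D _) (hnorm _) (hnorm _) (hnorm _) fp up => a b c d r; lra.
Qed.

Lemma rel_nsq u f : rel u f -> nsq D f = hnorm u ^+ 2.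
Proof. by move=> uf; rewrite -(rel_norm uf) n2_sqr. Qed.

(** Polarization: the norms of u, v and u - v give the real part, and the real part for i u gives
    the imaginary part. *)
Lemma rel_dot u v f g : rel u f -> rel v g -> dot u v = ip D f g.
Proof.
move=> uf vg.
have re u' f' : rel u' f' -> Re (dot u' v) = Re (ip D f' g).
  move=> uf'; have fL := uf'.1; have gL := vg.1.
  have := hnormB_sqr hdot u' v.
  rewrite -(rel_nsq uf') -(rel_nsq vg) -(rel_nsq (relB uf' vg)) (nsqB fL gL).
  move: (nsq D _) (nsq D _) (Re _) (Re _) => a b c d.
  by move=> /addrI/oppr_inj/mulfI -> //; rewrite pnatr_eq0.
apply: complex_ext; first exact: re.
have iu : rel ('i%C *: u) (fun t => 'i%C *: f t).
  have := rel_lin ('i%C - 1) uf uf.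
  rewrite scalerBl scale1r subrK.
  by under eq_fun do rewrite scalerBl scale1r subrK.
have := re _ _ iu; rewrite dotZl (ipZl _ uf.1 vg.1) !ReM/= !mul0r !mul1r !sub0r.
exact: oppr_inj.
Qed.

Lemma rel_uniq u v f g : rel u f -> rel v g -> n2 D (f \- g) = 0 -> u = v.
Proof.
move=> uf vg fg; apply/eqP; rewrite -subr_eq0; apply/eqP/hnorm_eq0.
by rewrite -(rel_norm (relB uf vg)).
Qed.

Lemma rel_congr u f g : rel u f -> sqint D g -> n2 D (f \- g) = 0 -> rel u g.
Proof.
move=> [fL fa] gL fg; split; first exact: gL.
move=> e e0; have [p [fp up]] := fa _ e0; exists p; split; last exact: up.
have := n2B_trans gL (pL p) fL; rewrite (n2BC gL fL) fg add0r.
by move=> /le_lt_trans; apply.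
Qed.

(** Polynomials converging to f, provided by [full], have Cauchy images by isometry, and H is
    complete. *)
Lemma rel_fun f : sqint D f -> exists u, rel u f.
Proof.
move=> fL.
have /choice[p fp] : forall n, exists p, n2 D (f \- vpoly_fun p) < (n.+1%:R)^-1.
  by move=> n; apply: full => //; rewrite invr_gt0.
have small e : 0 < e -> exists n0, forall n, (n0 <= n)%N -> n2 D (f \- vpoly_fun (p n)) < e.
  move=> e0; have [n0 hn0] := invS_small e0; exists n0 => n n0n.
  by apply: lt_trans (fp n) _; exact: hn0.
have [e e0|u pu] := @hnorm_complete _ _ (fun n => vec (p n)).
  have e2 : 0 < e / 2 by rewrite divr_gt0.
  have [n0 hn0] := small _ e2; exists n0 => n m /hn0 h1 /hn0 h2.
  rewrite -n2_vpolyB; have := n2B_trans (pL (p n)) (pL (p m)) fL.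
  rewrite (n2BC (pL (p n)) fL).
  by move: (n2 D _) (n2 D _) (n2 D _) h1 h2 => a b c; lra.
exists u; split=> // e e0; have [n0 h0] := pu _ e0; have [n1 h1] := small _ e0.
exists (p (n0 + n1)%N); rewrite h1 ?leq_addl//; split=> //.
by rewrite hnormBC h0// leq_addr.
Qed.

(** The mirror image of [rel_fun]: density of the vectors of polynomials in H, and completeness of
    L^2(M). *)
Lemma rel_vect u : exists f, rel u f.
Proof.
(* Consecutive approximants are then within 2 d_n = 2^-(n+1), so that 2^n times the square of their
   distance is at most 2^-(n+2), as [sqint_complete] requires with room to spare. *)
pose d n : R := (4 * 2 ^+ n)^-1.
have d0 n : 0 < d n by rewrite invr_gt0 mulr_gt0// exprn_gt0.
have dS n : d n.+1 = d n / 2 by rewrite /d exprS invfM invfM invfM mulrCA mulrC.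
have /choice[p up] : forall n, exists p, hnorm (u - vec p) < d n.
  by move=> n; exact: dense_vec.
have [n|g gL pg] := @sqint_complete _ _ _ D (fun n => vpoly_fun (p n)) (fun n => pL (p n)).
  have : n2 D (vpoly_fun (p n.+1) \- vpoly_fun (p n)) <= d n + d n.
    rewrite n2_vpolyB; apply: le_trans (hnormB_trans u _ _) _.
    rewrite hnormBC; have := up n; have := up n.+1; rewrite dS; have := d0 n.
    by move: (hnorm _) (hnorm _) (d n) => a b c; lra.
  rewrite -n2_sqr natrX [2 ^+ n.+1]exprS /d; have := n2_ge0 D (vpoly_fun (p n.+1) \- vpoly_fun (p n)).
  have : 0 < 2 ^+ n :> R by rewrite exprn_gt0.
  move: (n2 D _) (2 ^+ n) => a b b0 a0 h.
  have h1 : a * (2 * b) <= ((4 * b)^-1 + (4 * b)^-1) * (2 * b).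
    by rewrite ler_wpM2r// mulr_ge0// ltW.
  have e1 : ((4 * b)^-1 + (4 * b)^-1) * (2 * b) = 1 by field; rewrite gt_eqF.
  rewrite e1 in h1.
  rewrite -[leRHS]mul1r ler_pdivlMr ?mulr_gt0//.
  have : (a * (2 * b)) ^+ 2 <= 1 by rewrite expr_le1// !mulr_ge0// ltW.
  have := sqr_ge0 (a * b).
  nra.
exists g; split=> // e e0; have [n0 h0] := pg _ e0.
have [n1 h1] : exists n1, forall n, (n1 <= n)%N -> d n < e.
  have : d n @[n --> \oo] --> (0 : R).
    rewrite (_ : d = fun n => 4^-1 / 2 ^+ n); first exact: half_pow_cvg.
    by apply/funext => n; rewrite /d invfM.
  move=> /cvgrPdist_lt/(_ _ e0)[n1 _ hn]; exists n1 => n /hn.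
  by rewrite sub0r normrN gtr0_norm.
exists (p (n0 + n1)%N); split; last first.
  by apply: lt_trans (up _) _; apply: h1; rewrite leq_addl.
by rewrite (n2BC gL (pL _)); apply: h0; rewrite leq_addr.
Qed.

(** Functions related to the same vector differ by norm 0, and a bounded multiplier preserves this,
    so multiplication by c descends to vectors. *)
Lemma multiplier_operator c (C : R) : cmfun c -> (forall t, cabs (c t) <= C) ->
  exists E : {linear H -> H}, forall u f, rel u f -> rel (E u) (fun t => c t *: f t).
Proof.
move=> mc cC.
have cfg f g : sqint D f -> sqint D g -> n2 D (f \- g) = 0 ->
    n2 D ((fun t => c t *: f t) \- (fun t => c t *: g t)) = 0.
  move=> fL gL fg; have -> : (fun t => c t *: f t) \- (fun t => c t *: g t) =
      fun t => c t *: (f \- g) t by apply/funext => t; rewrite /= scalerBr.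
  apply/eqP; rewrite eq_le n2_ge0 andbT.
  by have := n2_multiplier_le mc cC (sqintB fL gL); rewrite fg mulr0.
pose P u v := exists2 f, rel u f & rel v (fun t => c t *: f t).
have [u|a u v u' v' [f uf vf] [f' uf' vf']|v [f uf vf]|E EP] := @linear_ex _ _ P.
- have [f uf] := rel_vect u; have [v vf] := rel_fun (sqintM mc cC uf.1).
  by exists v, f.
- exists (fun t => a *: f t + f' t); first exact: rel_lin.
  have := rel_lin a vf vf'.
  by under eq_fun do rewrite scalerA mulrC -scalerA -scalerDr.
- apply: hnorm_eq0; rewrite -(rel_norm vf).
  have f0 : n2 D f = 0 by rewrite (rel_norm uf) hnorm0.
  apply/eqP; rewrite eq_le n2_ge0 andbT.
  by have := n2_multiplier_le mc cC uf.1; rewrite f0 mulr0.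
- exists E => u f uf; have [g ug vg] := EP u.
  apply: rel_congr vg _ _; first exact: (sqintM mc cC uf.1).
  apply: cfg ug.1 uf.1 _.
  by rewrite (rel_norm (relB ug uf)) subrr hnorm0.
Qed.

Lemma rel_inj u v f : rel u f -> rel v f -> u = v.
Proof. by move=> uf vf; apply: (rel_uniq uf vf); exact: n2_self uf.1. Qed.

Definition mulX (f : R -> 'rV[R[i]]_N) t : 'rV[R[i]]_N := (t%:C)%C *: f t.

(** The domain condition, square integrability of t f, is contained in [rel]. *)
Definition mul_operator : set (H * H) :=
  [set p | exists2 f, rel p.1 f & rel p.2 (mulX f)].

Lemma mul_operator_linear : linear_rel mul_operator.
Proof.
split=> [|a u v u' v' [f uf vf] [f' uf' vf']].
  exists (vpoly_fun 0); first by rewrite /= -{1}(vec0 N x); exact: rel_vpoly.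
  have -> : mulX (vpoly_fun 0) = vpoly_fun 0.
    by apply/funext => t; rewrite /mulX vpoly_fun0 scaler0.
  by rewrite /= -{1}(vec0 N x); exact: rel_vpoly.
exists (fun t => a *: f t + f' t); first exact: rel_lin uf uf'.
have := rel_lin a vf vf'; rewrite /mulX.
by under eq_fun do rewrite scalerA mulrC -scalerA -scalerDr.
Qed.

Lemma mul_operator_symmetric : symmetric_rel dot mul_operator.
Proof.
move=> u v u' v' [f uf vf] [f' uf' vf'].
rewrite (rel_dot vf uf') (rel_dot uf vf') (ip_multiplier_adj D (fun t => (t%:C)%C)).
by rewrite !ipE; apply: eq_cint => t; rewrite conj_real.
Qed.

Lemma mul_operator_shift : shift_operator N x `<=` mul_operator.
Proof.
apply: linear_rel_Lin mul_operator_linear _ => k.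
pose r := Ordinal (ltn_pmod k hN); exists (vpoly_fun (mon (k %/ N) r)) => /=.
  by have := rel_vpoly (mon (k %/ N) r); rewrite vec_mon/= mulnC -divn_eq.
have := rel_vpoly (mon (k %/ N).+1 r).
rewrite vec_mon/= mulnS mulnC -addnA -divn_eq addnC.
have -> // : vpoly_fun (mon (k %/ N).+1 r) = mulX (vpoly_fun (mon (k %/ N) r)).
by apply/funext => t; rewrite /mulX !vpoly_fun_mon scalerA -exprS.
Qed.

Lemma dom_mul_operator : closure (dom mul_operator) = setT.
Proof.
apply/seteqP; split=> // u _; apply/closure_hnormP => e e0.
have [p up] := dense_vec hN hspan u e0; exists (vec p) => //.
have [_ TL] := mul_operator_linear.
exists (vec p, vec ('X *: p)) => //; exists (vpoly_fun p); first exact: rel_vpoly.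
have -> : mulX (vpoly_fun p) = vpoly_fun ('X *: p); last exact: rel_vpoly.
by apply/funext => t; apply/rowP => k; rewrite !mxE hornerM hornerX.
Qed.

Lemma ran_mul_operator z : Im z != 0 -> ran (op_shift mul_operator (- z)) = setT.
Proof.
move=> z0; apply/seteqP; split=> // u _; apply/ranP.
have [f uf] := rel_vect u.
(* t g = z g + f, so t g is square integrable along with f and g. *)
pose g t := resolvent_fun z t *: f t.
have gL : sqint D g.
  by apply: sqintM uf.1 => [|t]; [exact: cmfun_resolvent|exact: resolvent_bound_fun].
have [w wg] := rel_fun gL.
exists w, (z *: w + u); split; last by rewrite addrAC subrr add0r.
exists g => //=; have -> : mulX g = fun t => z *: g t + f t; last exact: rel_lin.
apply/funext => t; rewrite /mulX /g; apply/eqP; rewrite addrC -subr_eq -scalerBl.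
by rewrite scalerA /resolvent_fun mulfV ?scale1r// resolvent_neq0.
Qed.

Lemma mul_operator_sa : self_adjoint dot mul_operator.
Proof.
apply: (sa_criterion hdot mul_operator_linear mul_operator_symmetric dom_mul_operator).
  exact: (ran_mul_operator (Im_i R)).
by have := ran_mul_operator (Im_Ni R); rewrite opprK.
Qed.

Local Notation below s := (`]-oo, s[%classic).

Let mbelow (s : R) : measurable (below s).
Proof. exact: measurable_itv. Qed.

Lemma indic_below (s t : R) : \1_(below s) t = (t < s)%R%:R :> R.
Proof. by rewrite indicE mem_setE in_itv. Qed.

Lemma cut_spectral_family : exists E : R -> {linear H -> H},
  forall s u f, rel u f -> rel (E s u) (cut (below s) f).
Proof.
have h s : exists E : {linear H -> H}, forall u f, rel u f -> rel (E u) (cut (below s) f).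
  exact: (multiplier_operator (cmfun_indic (mbelow s)) (cabs_indic _)).
by have [E EP] := choice h; exists E.
Qed.

(** * The spectral resolution of multiplication by t *)

Section spectral_family.
Context (E : R -> {linear H -> H}).
Hypothesis EP : forall s u f, rel u f -> rel (E s u) (cut (below s) f).

Lemma cut_below_min s t (f : R -> 'rV[R[i]]_N) : s <= t -> cut (below s) (cut (below t) f) = cut (below s) f.
Proof.
move=> st; apply/funext => r; rewrite /cut scalerA -rmorphM/= !indic_below; congr (_%:C%C *: _).
have [rs|] := ltP r s; last by rewrite mul0r.
by rewrite (lt_le_trans rs st) mul1r.
Qed.

Let near_cut (F : set_system R) {FF : Filter F} (l : R -> H) (A_ : nat -> set R)
    (B : R -> set R) f : sqint D f -> (forall n, measurable (A_ n)) ->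
  (forall t, exists n0, forall n, (n0 <= n)%N -> ~ A_ n t) -> (forall s, measurable (B s)) ->
  (forall n, \forall s \near F, B s `<=` A_ n /\ hnorm (l s) = n2 D (cut (B s) f)) ->
  forall e : R, 0 < e -> \forall s \near F, hnorm (l s) < e.
Proof.
move=> fL mA A0 mB BA e e0; have [n hn] := n2_cut_small mA A0 fL e0.
by apply: filterS (BA n) => s [BsA ->]; exact: hn.
Qed.

Lemma resolution_cut : resolution_of_unity dot E.
Proof.
split.
- move=> t; split=> [u|u v].
    have [f uf] := rel_vect u; apply: rel_inj (EP t (EP t uf)) _.
    by rewrite cut_below_min//; exact: EP.
  have [f uf] := rel_vect u; have [g vg] := rel_vect v.
  rewrite (rel_dot (EP t uf) vg) (rel_dot uf (EP t vg)) ip_multiplier_adj.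
  by rewrite !ipE; apply: eq_cint => r; rewrite conj_real.
- move=> s t u st; have [f uf] := rel_vect u; apply: rel_inj (EP s (EP t uf)) _.
  by rewrite cut_below_min//; exact: EP.
(* (E_t - E_s) u corresponds to f cut to [s, t), and for s close to t this interval lies in [t -
   1/(n+1), t); these sets have empty intersection because t is excluded, whence left continuity. *)
- move=> t u; have [f uf] := rel_vect u; apply: cvg_hnorm.
  apply: (near_cut (A_ := fun n => `[t - n.+1%:R^-1, t[%classic)
    (B := fun s => `[s, t[%classic) uf.1).
  + by move=> n; exact: measurable_itv.
  + move=> r; have [rt|rt] := ltP r t; last first.
      by exists 0%N => n _ /=; rewrite in_itv/= ltNge rt andbF.
    have [|n0 hn0] := @invS_small _ (t - r); first by rewrite subr_gt0.
    exists n0 => n /hn0 h /=; rewrite in_itv/= lerBlDr -lerBlDl => /andP[h1 _].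
    by have := lt_le_trans h h1; rewrite ltxx.
  + by move=> s; exact: measurable_itv.
  + move=> n; near=> s.
    have st : s < t by near: s; exact: nbhs_left_lt.
    have sn : t - n.+1%:R^-1 < s.
      by near: s; apply: nbhs_left_gt; rewrite ltrBlDr ltrDl invr_gt0.
    split; first by move=> r /=; rewrite !in_itv/= => /andP[h1 ->]; rewrite (le_trans (ltW sn) h1).
    rewrite -(rel_norm (relB (EP t uf) (EP s uf))); congr (n2 D _).
    apply/funext => r; rewrite /cut/= !indic_below -scalerBl -rmorphB/= indicE mem_setE in_itv/=.
    congr (_%:C%C *: _); have [rs|sr] := ltP r s; first by rewrite (lt_trans rs st) subrr.
    by rewrite subr0.
- move=> u; have [f uf] := rel_vect u; apply: cvg_hnorm.
  apply: (near_cut (A_ := fun n => `]-oo, (- n%:R)[%classic) (B := fun s => below s) uf.1) => //.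
  + move=> r; exists (Num.truncn (- r)).+1 => n h /=; rewrite in_itv/= ltrNr => h1.
    have h2 : (Num.truncn (- r)).+1%:R <= n%:R :> R by rewrite ler_nat.
    have := lt_trans (lt_le_trans (truncnS_gt (- r)) h2) h1.
    by rewrite ltxx.
  + move=> n; near=> s; split; last by rewrite sub0r hnormN -(rel_norm (EP s uf)).
    have sn : s < - n%:R by near: s; apply: nbhs_ninfty_lt; exact: num_real.
    by move=> r /=; rewrite !in_itv/= => /lt_trans; apply.
- move=> u; have [f uf] := rel_vect u; apply: cvg_hnorm.
  apply: (near_cut (A_ := fun n => `[n%:R, +oo[%classic) (B := fun s => `[s, +oo[%classic) uf.1).
  + by move=> n; exact: measurable_itv.
  + move=> r; exists (Num.truncn r).+1 => n h /=; rewrite in_itv/= andbT => h1.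
    have h2 : (Num.truncn r).+1%:R <= n%:R :> R by rewrite ler_nat.
    have := lt_le_trans (lt_le_trans (truncnS_gt r) h2) h1.
    by rewrite ltxx.
  + by move=> s; exact: measurable_itv.
  + move=> n; near=> s; split.
      have sn : n%:R < s by near: s; apply: nbhs_pinfty_gt; exact: num_real.
      by move=> r /=; rewrite !in_itv/= !andbT => /(lt_le_trans sn)/ltW.
    rewrite -(rel_norm (relB uf (EP s uf))); congr (n2 D _).
    apply/funext => r; rewrite /cut/= indic_below indicE mem_setE in_itv/= andbT.
    by rewrite ltNge; case: (s <= r)%R; rewrite ?scale0r ?scale1r ?subr0 ?subrr.
Unshelve. all: by end_near.
Qed.

Lemma dot_cut u v f g s : rel u f -> rel v g -> dot (E s u) v =
  cint (tau M) (fun t => (\1_(below s) t)%:C%C * hform (D t) (f t) (g t)).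
Proof.
move=> uf vg; rewrite (rel_dot (EP s uf) vg) ipE.
by apply: eq_cint => t; rewrite hformZl.
Qed.

Lemma spectral_measure u v f g : rel u f -> rel v g ->
  exists nu : complex_measure R, forall t, cdistr nu t = dot (E t u) v.
Proof.
move=> uf vg; exists (complex_measure_of (ip_cinteg uf.1 vg.1)) => t.
by rewrite (dot_cut t uf vg) /cdistr (cdens_measure_of _).2.
Qed.

Lemma spectral_measure_dens nu u v f g : rel u f -> rel v g ->
  (forall t, cdistr nu t = dot (E t u) v) ->
  cdens nu (tau M) (fun t => hform (D t) (f t) (g t)).
Proof.
move=> uf vg nuE; apply: cdens_distr; first exact: (ip_cinteg uf.1 vg.1).
by move=> t; rewrite nuE (dot_cut t uf vg).
Qed.

Lemma sqint_mulXP f : sqint D f ->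
  sqint D (mulX f) <-> cinteg (tau M) (fun t => (t%:C)%C ^+ 2 * hform (D t) (f t) (f t)).
Proof.
move=> [mf _]; have qE t : hform (D t) (mulX f t) (mulX f t) = (t%:C)%C ^+ 2 * hform (D t) (f t) (f t).
  by rewrite /mulX hformZl hformZr conj_real mulrA.
split=> [[_]|h]; first by under eq_fun do rewrite qE.
split; last by under eq_fun do rewrite qE.
exact: (vmfunM (@cmfun_id_real R) mf).
Qed.

Lemma spectral_resolution_cut : spectral_resolution dot mul_operator E.
Proof.
have mX : cmfun (fun t : R => (t%:C)%C : R[i]) := @cmfun_id_real R.
have tE f g t : (t%:C)%C * hform (D t) (f t) (g t) = hform (D t) (mulX f t) (g t).
  by rewrite /mulX hformZl.
split; first exact: resolution_cut.
apply/seteqP; split=> -[u v].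
- move=> [f /= uf vf]; split.
    have [nu nuE] := spectral_measure uf uf; exists nu => //.
    apply/(cintegrable_dens (spectral_measure_dens uf uf nuE) (cmfunX 2 mX)).1.
    exact/(sqint_mulXP uf.1)/vf.1.
  move=> w; have [g wg] := rel_vect w; have [nu nuE] := spectral_measure uf wg.
  have [h1 h2] := cintegrable_dens (spectral_measure_dens uf wg nuE) mX.
  have h3 : cintegrable nu (fun t => (t%:C)%C).
    by apply/h1; under eq_fun do rewrite tE; exact: (ip_cinteg vf.1 wg.1).
  exists nu; split => //; rewrite (h2 h3) (rel_dot vf wg) ipE.
  by apply: eq_cint => t; rewrite tE.
(* The first condition says that t f is square integrable, hence related to some v'; the second that
   v and v' have the same scalar product with every w. *)
- move=> /= [[nu nuE nu2] uv]; have [f uf] := rel_vect u.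
  have XL : sqint D (mulX f).
    apply/(sqint_mulXP uf.1).
    by apply/(cintegrable_dens (spectral_measure_dens uf uf nuE) (cmfunX 2 mX)).1.
  have [v' vf'] := rel_fun XL; exists f => //=.
  suff -> : v = v' by [].
  apply: (dot_ext hdot) => w; have [g wg] := rel_vect w.
  have [nu' [nuE' nuX <-]] := uv w.
  have [_ h2] := cintegrable_dens (spectral_measure_dens uf wg nuE') mX.
  rewrite (h2 nuX) (rel_dot vf' wg) ipE.
  by apply: eq_cint => t; rewrite tE.
Qed.

Lemma cdistr_cut t k j : cdistr (M k j) t = dot (E t (x k)) (x j).
Proof.
have xk (l : 'I_N) : rel (x l) (vpoly_fun (mon 0 l)).
  by have := rel_vpoly (mon 0 l); rewrite vec_mon muln0.
rewrite (dot_cut t (xk k) (xk j)) /cdistr (cdens_rdens D k j).2//.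
apply: eq_cint => r; rewrite !vpoly_fun_mon !expr0 !scale1r.
by rewrite hform_delta.
Qed.

End spectral_family.

Lemma full_canonical : canonical_solution dot (moment M) x M.
Proof.
split; first by move=> n k l; split; [exact: hM|rewrite mxE].
have [E EP] := cut_spectral_family.
exists mul_operator, E; split.
- exact: mul_operator_sa.
- apply: subset_trans (sa_closed hdot mul_operator_sa).
  exact: closureS mul_operator_shift.
- exact: spectral_resolution_cut.
- exact: cdistr_cut.
Qed.

End Hilbert_isomorphism.

(** * Resolvents and moments *)

Section spectral_resolvent.
Context (R : realType).
Local Notation below s := (`]-oo, s[%classic).

Lemma cint_below_cvg (sigma : {finite_measure set R -> \bar R}) (h : R -> R[i]) :
  cinteg sigma h -> forall e : R, 0 < e -> exists n0, forall n, (n0 <= n)%N ->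
    cabs (cint sigma (fun t => (\1_(below n%:R) t)%:C%C * h t) - cint sigma h) < e.
Proof.
move=> hi e e0; have [h1 h2] := hi; have [m1 m2] := cinteg_cmfun hi.
have e2 : 0 < e / 2 by rewrite divr_gt0.
have mb (s : R) : measurable (below s) by exact: measurable_itv.
have key (r : R -> R) : measurable_fun setT r -> sigma.-integrable setT (EFin \o r) ->
    exists n0, forall n, (n0 <= n)%N ->
    `|\int[sigma]_t (\1_(below (n%:R : R)) t * r t) - \int[sigma]_t r t| < e / 2.
  move=> mr ri.
  have : \int[sigma]_t (\1_(below (n%:R : R)) t * r t) @[n --> \oo] --> \int[sigma]_t r t.
    apply: (dominated_Rintegral (g := fun t => `|r t|)) => //.
    - by move=> n; apply: measurable_funM => //; exact: measurable_indic.
    - move=> t; apply: cvg_near_cst; exists (Num.truncn t).+1 => // n /= tn.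
      by rewrite indic_below (lt_le_trans (truncnS_gt t)) ?mul1r// ler_nat.
    - exact: (integrable_norm ri).
    - by move=> n t; rewrite indic_below; case: (_ < _)%R; rewrite ?mul1r// mul0r normr0.
  move=> /cvgrPdist_lt/(_ _ e2)[n0 _ hn]; exists n0 => n /hn.
  by rewrite distrC.
have [n1 k1] := key _ m1 h1; have [n2 k2] := key _ m2 h2.
exists (n1 + n2)%N => n nn; apply: le_lt_trans (cabs_le _) _.
rewrite ReD ImD ReN ImN [e]splitr ltrD//=.
- under eq_Rintegral do rewrite ReM/= mul0r subr0.
  by apply: k1; exact: leq_trans (leq_addr _ _) nn.
- under eq_Rintegral do rewrite ImM/= mul0r addr0.
  by apply: k2; exact: leq_trans (leq_addl _ _) nn.
Qed.

Context (H : completeNormedModType R[i]) (dot : {dot H for (@Num.conj R[i])}).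
Hypothesis hdot : forall u, dot u u = `|u| ^+ 2.

(* For w = E_s v the spectral measure of (y, w) is that of (y, v) cut at s, so
   that the distribution function of nu at s is the integral up to s of
   t - z against the spectral measure of (y, v). *)
Lemma cintegral_resolvent T (E : R -> {linear H -> H}) nu z u v y :
  spectral_resolution dot T E -> Im z != 0 -> T (y, u + z *: y) ->
  (forall t, cdistr nu t = dot (E t u) v) ->
  cintegrable nu (resolvent_fun z) /\ cintegral nu (resolvent_fun z) = dot y v.
Proof.
move=> [[Eproj Emin _ _ Elim] TE] z0 Ty nuE.
have := Ty; rewrite TE => -[_ /= Tyw].
have Esym t a b : dot (E t a) b = dot a (E t b) by have [_] := Eproj t.
have [nv [nvE nvX _]] := Tyw v; have [sigma [h nvh]] := cdens_ex nv.
have hi : cinteg sigma h := nvh.1.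
have mX : cmfun (fun t : R => (t%:C)%C : R[i]) := @cmfun_id_real R.
have Xhi : cinteg sigma (fun t => (t%:C)%C * h t).
  by apply/(cintegrable_dens nvh mX).1.
have mb (s : R) : measurable (below s) by exact: measurable_itv.
have nvd s : dot (E s y) v = cint sigma (fun t => (\1_(below s) t)%:C%C * h t).
  by rewrite -nvE /cdistr nvh.2.
have kE t : ((t%:C)%C - z) * h t = (t%:C)%C * h t - z * h t by rewrite mulrBl.
have ki : cinteg sigma (fun t => ((t%:C)%C - z) * h t).
  under eq_fun do rewrite kE.
  by apply: cintegB => //; exact: cintegZ.
have nuh : cdens nu sigma (fun t => ((t%:C)%C - z) * h t).
  apply: cdens_distr (ki) _ => s; rewrite nuE.
  have [ns [nsE nsX nsI]] := Tyw (E s v).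
  have nsh : cdens ns sigma (fun t => (\1_(below s) t)%:C%C * h t).
    apply: cdens_distr => [|t]; first exact: cinteg_indicM.
    (* (E_t y, E_s v) = (E_min(s, t) y, v), which is the measure of (y, v) cut at s, evaluated at
       t. *)
    rewrite nsE -Esym; have [st|ts] := leP s t.
      rewrite Emin// nvd; apply: eq_cint => r; rewrite mulrA -rmorphM/= !indic_below.
      by have [rs|_] := ltP r s; [rewrite (lt_le_trans rs st) !mul1r|rewrite mulr0].
    rewrite Esym Esym Emin ?(ltW ts)// -Esym nvd; apply: eq_cint => r.
    rewrite mulrA -rmorphM/= !indic_below.
    by have [rt|_] := ltP r t; [rewrite (lt_trans rt ts) !mul1r|rewrite !mul0r].
  (* Since T y = u + z y, the integral of t up to s equals (E_s u, v) + z (E_s y, v); solving for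
     (E_s u, v) gives the distribution function of nu. *)
  have := nsI; rewrite (cintegrable_dens nsh mX).2//.
  rewrite -Esym linearD linearZ dotDl dotZl nvd => /eqP; rewrite -subr_eq => /eqP <-.
  rewrite -cintZ; last exact: cinteg_indicM.
  rewrite -cintB; first last.
  - by apply: cintegZ; exact: cinteg_indicM.
  - have := cinteg_indicM (mb s) Xhi; by under eq_fun do rewrite mulrCA.
  by apply: eq_cint => t; ring.
have rE t : resolvent_fun z t * (((t%:C)%C - z) * h t) = h t.
  by rewrite mulrA /resolvent_fun mulVf ?mul1r// resolvent_neq0.
have [i1 i2] := cintegrable_dens nuh (cmfun_resolvent z0).
have i3 : cintegrable nu (resolvent_fun z) by apply/i1; under eq_fun do rewrite rE.
split => //; rewrite i2//; under eq_cint do rewrite rE.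
(* The total mass of h sigma and (y, v) are both limits of (E_n y, v), the former by dominated
   convergence and the latter because E_s y tends to y. *)
apply/eqP; rewrite -subr_eq0 -normr_eq0 cabsE eq_complex/= eqxx andbT eq_le cabs_ge0 andbT.
apply/ler_addgt0Pr => e e0; rewrite add0r.
have e2 : 0 < e / 2 by rewrite divr_gt0.
have e3 : 0 < e / 2 / (hnorm v + 1) by rewrite divr_gt0// ltr_wpDl// hnorm_ge0.
have [n0 hn0] := cint_below_cvg hi e2.
move/cvgrPdist_lt : (Elim y) => /(_ ((e / 2 / (hnorm v + 1))%:C)%C).
rewrite ltcR => /(_ e3)[s0 [_ hs0]].
pose n := (n0 + (Num.truncn s0).+1)%N.
have ns : s0 < n%:R.
  by apply: lt_le_trans (truncnS_gt s0) _; rewrite ler_nat leq_addl.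
have := hs0 _ ns; rewrite normE ltcR => yn.
have := hn0 n (leq_addr _ _); rewrite -nvd => h1.
have h2 : cabs (dot (y - E n%:R y) v) <= hnorm (y - E n%:R y) * hnorm v.
  by rewrite -lecR -cabsE; exact: (dot_CS hdot).
have -> : cint sigma h - dot y v =
    - (dot (E n%:R y) v - cint sigma h) - dot (y - E n%:R y) v.
  by rewrite dotBl; ring.
apply: le_trans (cabsD _ _) _; rewrite !cabsN addrC.
have := lin_bound (hnorm_ge0 v) (hnorm_ge0 (y - E n%:R y)) yn h1.
rewrite mulrC => /ltW; apply: le_trans.
by rewrite lerD2r.
Qed.

End spectral_resolvent.

(** * The shift operator and the moments of its resolvents *)

Section shift.
Context (R : realType) (N : nat) (hN : (0 < N)%N) (M : matrix_measure R N).
Hypothesis hM : forall n k l, cintegrable (M k l) (fun t => (t%:C)%C ^+ n).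
Context (H : completeNormedModType R[i]) (dot : {dot H for (@Num.conj R[i])}).
Hypothesis hdot : forall u, dot u u = `|u| ^+ 2.
Context (x : nat -> H).
Hypothesis hspan : closure (Lin x) = [set: H].
Hypothesis hGamma : forall (k l : nat) (r s : 'I_N),
  dot (x (N * k + r)%N) (x (N * l + s)%N) = moment M (k + l) r s.

Local Notation A := (shift_operator N x).

Lemma Lin_linear (V : lmodType R[i]) (y : nat -> V) a u v :
  Lin y u -> Lin y v -> Lin y (a *: u + v).
Proof.
have widen n m (c : nat -> R[i]) : (n <= m)%N ->
    \sum_(k < n) c k *: y k = \sum_(k < m) (if (k < n)%N then c k else 0) *: y k.
  move=> nm; rewrite (big_ord_widen m (fun k => c k *: y k))// big_mkcond.
  by apply: eq_bigr => i _; case: ifP => // _; rewrite scale0r.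
move=> [n [c ->]] [m [d ->]]; exists (maxn n m).
exists (fun k => a * (if (k < n)%N then c k else 0) + (if (k < m)%N then d k else 0)).
rewrite (widen n (maxn n m)) ?leq_maxl// (widen m (maxn n m)) ?leq_maxr//.
rewrite scaler_sumr -big_split; apply: eq_bigr => k _.
by rewrite scalerDl scalerA.
Qed.

Lemma shift_operator_linear : linear_rel A.
Proof.
split=> [|a u v u' v' uv uv']; first by exists 0%N, (fun=> 0); rewrite big_ord0.
exact: (Lin_linear a uv uv').
Qed.

Lemma index_split k : exists (i : nat) (r : 'I_N), k = (N * i + r)%N.
Proof.
by exists (k %/ N)%N, (Ordinal (ltn_pmod k hN)); rewrite /= mulnC -divn_eq.
Qed.

(** On the generators this is the block Hankel structure: Gram entries depend only on k + l, and a
    shift by N raises one block index by 1. Linearity extends it one argument at a time. *)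
Lemma shift_operator_symmetric : symmetric_rel dot A.
Proof.
have gen k l : dot (x (k + N)%N) (x l) = dot (x k) (x (l + N)%N).
  have [i [r ->]] := index_split k; have [j [s ->]] := index_split l.
  have E a b : (N * a + b + N = N * a.+1 + b)%N by rewrite mulnS addnC addnA.
  by rewrite !E !hGamma addSnnS.
have step k u v : A (u, v) -> dot (x (k + N)%N) u = dot (x k) v.
  pose B := [set p : H * H | dot (x (k + N)%N) p.1 = dot (x k) p.2].
  have BL : linear_rel B.
    split=> [|a u1 v1 u2 v2]; rewrite /B/=; first by rewrite !dot0r.
    by rewrite !dotDr !dotZr => -> ->.
  have /(_ (u, v)) : A `<=` B by apply: linear_rel_Lin => // l; exact: gen.
  by apply.
move=> u v u' v' Auv Auv'.
pose B := [set p : H * H | dot p.2 u' = dot p.1 v'].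
have BL : linear_rel B.
  split=> [|a u1 v1 u2 v2]; rewrite /B/=; first by rewrite !dot0l.
  by rewrite !dotDl !dotZl => -> ->.
have /(_ (u, v)) : A `<=` B by apply: linear_rel_Lin => // k; exact: step.
by apply.
Qed.

Lemma dom_shift_operator : closure (dom A) = setT.
Proof.
apply/seteqP; split=> // u _; have : closure (Lin x) u by rewrite hspan.
apply: closureS => {u} _ [n [c ->]].
exists (\sum_(k < n) c k *: (x k, x (k + N)%N)); first by exists n, c.
by elim: n => [|n IHn]; rewrite ?big_ord0// !big_ord_recr/= IHn.
Qed.

(** A self-adjoint B is closed, so it extends A exactly when it extends the closure, to which the
    parametrization by unitaries between the defect spaces applies. *)
Lemma qsa_shiftP (B : set (H * H)) :
  (exists2 U, unitary_onto dot U (defect dot (closure A) 'i%C)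
                                 (defect dot (closure A) (- 'i%C)) &
     B = qsa_extension (closure A) U) <-> self_adjoint dot B /\ A `<=` B.
Proof.
have cL := closure_linear_rel shift_operator_linear.
have cs := closure_symmetric_rel hdot shift_operator_symmetric.
have cc : closure (closure A) `<=` closure A.
  by rewrite -(iffLR (closure_id _))//; exact: closed_closure.
have cd : closure (dom (closure A)) = setT.
  apply/seteqP; split=> // u _; have : closure (dom A) u by rewrite dom_shift_operator.
  apply: closureS => _ [p Ap <-]; exists p => //.
  exact: subset_closure.
split=> [[U Uu ->]|[Bsa AB]].
  split; first exact: (qsa_self_adjoint hdot cL cs cc cd Uu).
  case: Uu => UL _ _ _.
  exact: subset_trans (@subset_closure _ A) (sub_qsa (T := closure A) UL).
apply: (sa_qsa hdot cL cs cc cd Bsa).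
by apply: subset_trans (sa_closed hdot Bsa); exact: closureS.
Qed.

Context (D : regular_density M).

Lemma moment_resolvent_step z r s n : Im z != 0 ->
  cintegral (M r s) (fun t => (t%:C)%C ^+ n.+1 * resolvent_fun z t) =
  moment M n r s + z * cintegral (M r s) (fun t => (t%:C)%C ^+ n * resolvent_fun z t).
Proof.
move=> z0; have dD := cdens_rdens D r s.
have mX m : cmfun (fun t : R => (t%:C)%C ^+ m : R[i]) := cmfunX m (@cmfun_id_real R).
have mr := cmfun_resolvent z0.
have ri m : cinteg (tau M) (fun t => (t%:C)%C ^+ m * resolvent_fun z t * D t r s).
  have := cintegM_bounded mr (fun t => resolvent_bound_fun t z0) (cinteg_moment D hM m r s).
  by under eq_fun do rewrite mulrCA mulrA.
have cE m : cintegral (M r s) (fun t => (t%:C)%C ^+ m * resolvent_fun z t) =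
    cint (tau M) (fun t => (t%:C)%C ^+ m * resolvent_fun z t * D t r s).
  have [h1 h2] := cintegrable_dens dD (cmfunM (mX m) mr).
  by rewrite h2//; exact/h1.
rewrite mxE !cE (cintegrable_dens dD (mX n)).2; last exact: hM.
rewrite -cintZ; last exact: ri.
rewrite -cintD; [|exact: cinteg_moment|by apply: cintegZ; exact: ri].
apply: eq_cint => t; rewrite mulrA -mulrDl; congr (_ * _).
have zr : (t%:C)%C * resolvent_fun z t = 1 + z * resolvent_fun z t.
  apply/eqP; rewrite -subr_eq -mulrBl /resolvent_fun mulfV//.
  exact: resolvent_neq0.
by rewrite exprSr -mulrA zr; ring.
Qed.

(** Induction on k for all l, with an inner induction on l at k = 0. Raising k uses that T undoes B
    - z on x_(Nk+r); raising l moves B across the scalar product by symmetry. Both recursions are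
    those of [moment_resolvent_step]. *)
Lemma resolvent_moments (B : set (H * H)) z (T : {linear H -> H}) :
  self_adjoint dot B -> A `<=` B -> Im z != 0 ->
  (forall u, B (T u, u + z *: T u)) ->
  (forall r s : 'I_N, dot (T (x r)) (x s) = cintegral (M r s) (resolvent_fun z)) ->
  forall (k l : nat) (r s : 'I_N), dot (T (x (N * k + r)%N)) (x (N * l + s)%N) =
    cintegral (M r s) (fun t => (t%:C)%C ^+ (k + l) * resolvent_fun z t).
Proof.
move=> Bsa AB z0 TB T0; have Bs := sa_symmetric Bsa.
have xB i j : B (x (N * i + j)%N, x (N * i.+1 + j)%N).
  have -> : (N * i.+1 + j = N * i + j + N)%N by rewrite mulnS -addnA addnC.
  by apply: AB; exact: shift_operator_gen.
elim=> [|k IHk] l r s; last first.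
  have -> : T (x (N * k.+1 + r)%N) = x (N * k + r)%N + z *: T (x (N * k + r)%N).
    have e : x (N * k + r)%N = T (x (N * k.+1 + r)%N - z *: x (N * k + r)%N).
      apply: (resolvent_uniq hdot Bsa z0) (TB _).
      by rewrite subrK; exact: xB.
    by rewrite {1}e linearB linearZ subrK.
  by rewrite dotDl dotZl hGamma IHk addSn moment_resolvent_step.
elim: l => [|l IHl].
  rewrite !muln0 !add0n T0; congr cintegral.
  by apply/funext => t; rewrite expr0 mul1r.
have <- := Bs _ _ _ _ (TB (x (N * 0 + r)%N)) (xB l s).
by rewrite dotDl dotZl hGamma IHl addnS moment_resolvent_step.
Qed.

Lemma resolvent_inv (B : set (H * H)) z (T : {linear H -> H}) :
  self_adjoint dot B -> Im z != 0 -> (forall u, B (T u, u + z *: T u)) ->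
  injective T /\ op_shift (op_inv (fun_graph T)) z = B.
Proof.
move=> Bsa z0 TB; have [[_ _ Bsv] _ _] := Bsa; split.
  move=> u v e; have := TB u; rewrite e => Bu.
  exact: addIr (Bsv _ _ _ Bu (TB v)).
apply/seteqP; split=> [_ [[a b] /= ab <-]|[a b] Bab].
  by rewrite [a]ab; exact: TB.
exists (a, b - z *: a); last by rewrite /= subrK.
rewrite /op_inv /fun_graph/=; apply: (resolvent_uniq hdot Bsa z0) (TB _).
by rewrite subrK.
Qed.

End shift.

Theorem theorem2 (R : realType) (N : nat) (hN : (0 < N)%N)
    (M : matrix_measure R N)
    (hM : forall n k l, cintegrable (M k l) (fun t => (t%:C)%C ^+ n))
    (H : completeNormedModType R[i]) (dot : {dot H for (@Num.conj R[i])})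
    (hdot : forall u, dot u u = `|u| ^+ 2)
    (x : nat -> H) (hspan : closure (Lin x) = [set: H])
    (hGamma : forall (k l : nat) (r s : 'I_N),
       dot (x (N * k + r)%N) (x (N * l + s)%N) = moment M (k + l) r s) :
  let A := shift_operator N x in
  let Abar := closure A in
  (forall B : set (H * H),
     (exists2 U, unitary_onto dot U (defect dot Abar 'i%C)
                                    (defect dot Abar (- 'i%C)) &
                 B = qsa_extension Abar U) <->
     self_adjoint dot B /\ A `<=` B) /\
  [<-> L20 M = L2 M ;
       canonical_solution dot (moment M) x M ;
       exists2 U, unitary_onto dot U (defect dot Abar 'i%C)
                                     (defect dot Abar (- 'i%C)) &
         forall lam : R[i], 0 < complex.Im lam -> forall k j : 'I_N,
           exists2 y, op_inv (op_shift (qsa_extension Abar U) (- lam)) (x k, y) &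
             cintegral (M k j) (fun t => 1 / ((t%:C)%C - lam)) = dot y (x j) ;
       exists B, [/\ self_adjoint dot B, A `<=` B &
         forall lam : R[i], 0 < complex.Im lam ->
           exists D : {linear H -> H},
           [/\ exists c : R[i], forall u, `|D u| <= c * `|u|,
               forall (k l : nat) (r s : 'I_N),
                 dot (D (x (N * k + r)%N)) (x (N * l + s)%N) =
                 cintegral (M r s)
                   (fun t => (t%:C)%C ^+ (k + l) / ((t%:C)%C - lam)),
               injective D &
               op_shift (op_inv (fun_graph D)) lam = B]] ].
Proof.
move=> A Abar.
have [D0 [mD gD aD]] := good_density M hN.
pose D := RegularDensity mD gD aD.
have resE lam : (fun t => 1 / ((t%:C)%C - lam)) = resolvent_fun lam.
  by apply/funext => t; rewrite div1r.
split; first by move=> B; exact: qsa_shiftP.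
tfae.
- move=> L20E; apply: (full_canonical (D := D) hN hM hdot hspan hGamma) => f fL e e0.
  have : L20 M f by rewrite L20E; exact/(L2P D).
  move=> [_ /(_ _ e0)[p fp]]; exists p.
  exact/(L2_sqnorm_lt (sqintB fL (sqint_vpoly D hM p)) e0).
- move=> [_ [T [E [Tsa AT TE ME]]]].
  have AT' : A `<=` T by apply: subset_trans AT; exact: subset_closure.
  have [U Uu TU] := iffRL (qsa_shiftP hN hdot hspan hGamma T) (conj Tsa AT').
  exists U => // lam lam0 k j; rewrite -TU resE.
  have lam1 : complex.Im lam != 0 by rewrite gt_eqF.
  have [Y TY] := resolvent_ex hdot Tsa lam1; exists (Y (x k)).
    by exists (Y (x k), x k + lam *: Y (x k)); [exact: TY|rewrite /= scaleNr addrK].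
  exact: (cintegral_resolvent hdot TE lam1 (TY (x k)) (fun t => ME t k j)).2.
- move=> [U Uu MU]; have [Bsa AB] := iffLR (qsa_shiftP hN hdot hspan hGamma _) (ex_intro2 _ _ U Uu erefl).
  exists (qsa_extension Abar U); split => // lam lam0.
  have lam1 : complex.Im lam != 0 by rewrite gt_eqF.
  have [T TB] := resolvent_ex hdot Bsa lam1; exists T.
  have [Tinj TE] := resolvent_inv hdot Bsa lam1 TB; split => //.
  + exists (`|complex.Im lam|^-1%:C)%C => u; rewrite !normE -rmorphM/= lecR.
    rewrite ler_pdivlMl ?normr_gt0//.
    exact: (resolvent_bound hdot Bsa (TB u)).
  + apply: (resolvent_moments hM hdot hGamma D Bsa AB lam1 TB) => r s.
    have [y [[y1 y2] /= By [e1 e2]]] := MU _ lam0 r s; rewrite resE => ->.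
    (* The vector y supplied by (iii) is a value of the same resolvent at x_r, hence equal to T
       x_r. *)
    congr (dot _ _); apply: (resolvent_uniq hdot Bsa lam1 (TB _)).
    by rewrite -e1 -e2 scaleNr subrK.
- move=> [B [Bsa AB BD]].
  apply/seteqP; split=> [f []//|f fL2]; split => // e e0.
  have fL : sqint D f by apply/L2P.
  have [|_ /(_ _ e0)[p fp]] := resolvents_approximable hN hM hdot hspan hGamma Bsa _ fL.
    move=> z z0; have [T [_ Tx _ TB]] := BD _ z0; exists T; split; last exact: Tx.
    by move=> u; rewrite -TB; exists (T u, u).
  exists p; exact/(L2_sqnorm_lt (sqintB fL (sqint_vpoly D hM p)) e0).
Qed.
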